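(* Let $D\in\mathbb N$ with $D^5\le p$ and assume that $$\zeta:=\frac{\bar\Delta^4}{p}\max\Big(D^{18},\frac{n}{K^2}\Big)<1.$$ Then, under the Gaussian mixture prior described in the context, with $x=\mathbf 1_{k_1^*=k_2^*}$, $$MMSE_{\le D}\ \ge\ \frac1K-\frac1{K^2}\left[1+\frac{\zeta}{(1-\sqrt\zeta)^3}\right].$$
   Context: Prior: $n\ge2$, $p,K\ge1$ integers, $\sigma>0$, $\bar\Delta>0$. $k^*=(k_1^*,\dots,k_n^* )$ is uniformly distributed on $[K]^n$ (with $[K]=\{1,\dots,K\}$). Independently of $k^*$, the coordinates $\mu_{kj}$, $(k,j)\in[K]\times[p]$, are i.i.d. $\mathcal N(0,\lambda^2)$ with $\lambda^2=\frac1p\bar\Delta^2\sigma^2$. The observation is the matrix $Y\in\mathbb R^{n\times p}$ with $Y_{ij}=\mu_{k_i^*,j}+E_{ij}$, where the $E_{ij}$ are i.i.d. $\mathcal N(0,\sigma^2)$, independent of $(k^*,\mu)$. $MMSE_{\le D}:=\inf_{f}\mathbb E[(f(Y)-x)^2]$, where the infimum is over all real polynomials $f$ in the entries $(Y_{ij})$ of total degree at most $D$, and the expectation is under the joint law of $(k^*,\mu,E)$, in which $k^*$ is uniform on $[K]^n$, the $\mu_{kj}$ are i.i.d. $\mathcal N(0,\lambda^2)$, the $E_{ij}$ are i.i.d. $\mathcal N(0,\sigma^2)$, and $k^*,\mu,E$ are mutually independent. *)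

(* Defs.v *)
From HB Require Import structures.
From mathcomp Require Import all_boot all_order all_algebra.
From mathcomp Require Import all_classical all_reals all_analysis.
(* The notations of [mpoly] clash with those of MathComp-Analysis, so only its
   canonical structures and coercions are imported. *)
From mathcomp Require Import(canonicals,coercions) mpoly.

Set Implicit Arguments.
Unset Strict Implicit.
Unset Printing Implicit Defensive.

Import Order.TTheory GRing.Theory Num.Theory.
Import numFieldNormedType.Exports.

Local Open Scope classical_set_scope.
Local Open Scope ring_scope.

(* Mutual independence of a finite family of classes of events. *)
Definition mutually_independent (d : measure_display) (T : measurableType d)
    (R : realType) (P : probability T R) (I : finType)
    (F : I -> set (set T)) : Prop :=
  forall (J : {set I}) (A : I -> set T),
    (forall i, i \in J -> F i (A i)) ->
    P (\bigcap_(i in [set` J]) A i) = (\prod_(i in J) P (A i))%E.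

(* For a finite-valued [X], the sigma-algebra on the codomain is the discrete
   one. *)
Definition sigma_discrete (T S : Type) (X : T -> S) : set (set T) :=
  preimage_set_system setT X discrete_measurable.

Definition sigma_real (T : Type) (R : realType) (X : T -> R) : set (set T) :=
  preimage_set_system setT X measurable.

Definition sigma_real_family (T : Type) (R : realType) (I : Type)
    (X : I -> T -> R) : set (set T) :=
  <<s \bigcup_i sigma_real (X i) >>.

(* The second argument of [normal_prob] is the standard deviation, so this is
   the law N(0, s^2). *)
Definition centered_normal (d : measure_display) (T : measurableType d)
    (R : realType) (P : probability T R) (s : R) (X : {RV P >-> R}) : Prop :=
  forall A : set R, measurable A -> distribution P X A = normal_prob 0 s A.

(* The cluster labels [K] = {1, ..., K} are represented by 'I_K, and [lambda]
   is a standard deviation: lambda^2 = Delta^2 sigma^2 / p. *)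
Record gaussian_mixture_prior (d : measure_display) (T : measurableType d)
    (R : realType) (P : probability T R) (n p K : nat) (sigma Delta : R)
    (kstar : T -> {ffun 'I_n -> 'I_K})
    (mu : 'I_K -> 'I_p -> {RV P >-> R})
    (E : 'I_n -> 'I_p -> {RV P >-> R}) : Prop := GaussianMixturePrior {
  kstar_measurable : sigma_discrete kstar `<=` measurable ;
  kstar_uniform : forall a : {ffun 'I_n -> 'I_K},
    P (kstar @^-1` [set a]) = ((K%:R ^+ n)^-1)%:E ;
  mu_normal : forall k j,
    centered_normal (Num.sqrt (p%:R^-1 * Delta ^+ 2 * sigma ^+ 2)) (mu k j) ;
  mu_independent : mutually_independent P
    (fun kj : 'I_K * 'I_p => sigma_real (mu kj.1 kj.2)) ;
  E_normal : forall i j, centered_normal sigma (E i j) ;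
  E_independent : mutually_independent P
    (fun ij : 'I_n * 'I_p => sigma_real (E ij.1 ij.2)) ;
  kstar_mu_E_independent : mutually_independent P
    (tnth [tuple sigma_discrete kstar;
                 sigma_real_family (fun kj : 'I_K * 'I_p => mu kj.1 kj.2);
                 sigma_real_family (fun ij : 'I_n * 'I_p => E ij.1 ij.2)])
}.

Definition observation (T : Type) (R : realType) (n p K : nat)
    (kstar : T -> {ffun 'I_n -> 'I_K}) (mu : 'I_K -> 'I_p -> T -> R)
    (E : 'I_n -> 'I_p -> T -> R) (w : T) : 'M[R]_(n, p) :=
  \matrix_(i < n, j < p) (mu (kstar w i) j w + E i j w).

(* Evaluation of a polynomial in n * p indeterminates at the entries of a
   matrix; the indeterminate attached to the entry (i, j) is the one of index
   [mxvec_index i j]. *)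
Definition meval_mx (R : realType) (n p : nat) (f : mpoly.mpoly (n * p) R)
    (Y : 'M[R]_(n, p)) : R :=
  mpoly.meval (fun l => mxvec Y 0 l) f.

(* [mpoly.msize f] is the total degree of [f] plus one (0 when [f = 0]). *)
Definition MMSE_le (d : measure_display) (T : measurableType d)
    (R : realType) (P : probability T R) (n p : nat) (D : nat)
    (Y : T -> 'M[R]_(n, p)) (x : T -> R) : \bar R :=
  ereal_inf [set ('E_P[fun w => ((meval_mx f (Y w) - x w) ^+ 2)%R])%E |
             f in [set f : mpoly.mpoly (n * p) R | (mpoly.msize f <= D.+1)%N]].

(* Main.v *)
Require Import Defs.
From HB Require Import structures.
From mathcomp Require Import all_boot all_order all_algebra.
From mathcomp Require Import all_classical all_reals all_analysis.
From mathcomp Require Import -(notations) mpoly.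
From mathcomp Require Import measurable_realfun.
From mathcomp Require Import ring lra zify.

Set Implicit Arguments.
Unset Strict Implicit.
Unset Printing Implicit Defensive.

Import Order.TTheory GRing.Theory Num.Theory.
Import numFieldNormedType.Exports.

Local Open Scope classical_set_scope.
Local Open Scope ring_scope.

(* Conditionally on the labels, the entries of Y form a centered Gaussian vector,
   so their moments are governed by Stein's identity, which yields two facts.
   First, E[f(Y)^2] dominates the sum over r of sigma^(2r)/r! times the squared
   norm of the tensor of averages of the r-th derivatives of f: the conditional
   covariances are at least sigma^2 times the identity, and the average over the
   labels is taken by Jensen's inequality.  Secondly, E[x f(Y)] is a combination of
   averages of derivatives of f of even orders 2s along products of the operators
   sum_j d_(ij) d_(i'j), whose coefficients are the joint cumulants kappa(e) of
   the event k_1 = k_2 and of the events k_i = k_i', (i, i') in e.  Completing the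
   square at each order 2s bounds the gain of any polynomial by a multiple of
   sum_e kappa(e)^2, the Gram matrix of the quadratic words being controlled by
   its row sums.

   The multigraphs e with kappa(e) <> 0 have no cut vertex separating off a part
   that avoids 1 and 2; so all their vertices other than 1 and 2 have degree at
   least 2, and kappa(e) is at most K^(1 - #vertices) D^b, where b counts the edges
   at 1, 2 or at a vertex of degree at least 3.  A generating function in the
   degrees, evaluated at its saddle point, then gives
   sum_e kappa(e)^2 <= 2^s s! max(D^18, n/K^2)^s / (4 K^2) for s >= 1. *)

(** * Gaussian calculus on polynomials *)

(** The lower bound for E[f^2] only sees averages of derivatives of f under the mixture, so E[x f]
    has to be expressed through the same averages. Given labels a, the moment functional of Y is the
    noise functional composed with exp(t Q_a), where t = lambda^2 / 2 and Q_a adds up the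
    second-order operators of the pairs that a makes monochromatic. These operators have constant
    coefficients and commute, so averaging over a, with and without the factor x, gives two formal
    series of operators. The cumulants are the coefficients of their quotient; multiplying the
    quotient back by the second series restores the mixture average and eliminates the noise
    functional. All of this takes place on polynomials, a Gaussian law being a linear functional
    that satisfies Stein's identity; integrals serve only to identify the moments of Y with that
    functional. *)

Section Pairing.
Variables (R : realType) (N : nat).
Local Notation MP := (mpoly N R).
Local Notation Xv j := (mpolyX R (mnm1 j)).
Implicit Types (c d : 'I_N -> 'I_N -> R) (m : {scalar MP}) (q f : MP).

(* Stein's identity: when [m 1 = 1], [m] is the moment functional of N(0, c). *)
Definition ibp c (m : MP -> R) :=
  forall j q, m (Xv j * q) = \sum_l c j l * m (mderiv l q).

(** The [c]-contraction of the tensors of [m1]- and [m2]-averages of the [r]-th derivatives. Two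
    functionals are allowed because evaluation at 0 in the second slot turns the contraction into a
    test of [q] against a fixed polynomial. *)
Fixpoint pairing c (m1 m2 : MP -> R) r q f : R :=
  if r is r'.+1 then
    \sum_l \sum_l' c l l' * pairing c m1 m2 r' (mderiv l q) (mderiv l' f)
  else m1 q * m2 f.

Lemma pairing_linearr c m1 m2 r q : linear_for *%R (pairing c m1 m2 r q).
Proof.
elim: r q => [|r IH] q a f g /=; first by rewrite linearP mulrDr mulrCA.
rewrite mulr_sumr -big_split; apply: eq_bigr => l _ /=.
rewrite mulr_sumr -big_split; apply: eq_bigr => l' _ /=.
by rewrite linearP IH mulrDr mulrCA.
Qed.

HB.instance Definition _ c m1 m2 r q :=
  GRing.isLinear.Build R MP R _ (pairing c m1 m2 r q) (pairing_linearr c m1 m2 r q).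

Lemma pairing_linearl c m1 m2 r f :
  linear_for *%R (fun q => pairing c m1 m2 r q f).
Proof.
elim: r f => [|r IH] f a q g /=; first by rewrite linearP mulrDl mulrA.
rewrite mulr_sumr -big_split; apply: eq_bigr => l _ /=.
rewrite mulr_sumr -big_split; apply: eq_bigr => l' _ /=.
by rewrite linearP (IH _ a) mulrDr mulrCA.
Qed.

Lemma pairing_sumr c m1 m2 r q I (s : seq I) (a : I -> R) (f : I -> MP) :
  pairing c m1 m2 r q (\sum_(i <- s) a i *: f i) =
  \sum_(i <- s) a i * pairing c m1 m2 r q (f i).
Proof. by rewrite linear_sum; apply: eq_bigr => i _; rewrite linearZ. Qed.

Lemma pairing_suml c m1 m2 r f I (s : seq I) (a : I -> R) (q : I -> MP) :
  pairing c m1 m2 r (\sum_(i <- s) a i *: q i) f =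
  \sum_(i <- s) a i * pairing c m1 m2 r (q i) f.
Proof.
have l0 : pairing c m1 m2 r 0 f = 0.
  have /= := pairing_linearl c m1 m2 r f (-1) 0 0.
  by rewrite scaler0 addr0 mulN1r addNr.
elim: s => [|i s IH]; first by rewrite !big_nil l0.
by rewrite !big_cons (pairing_linearl c m1 m2 r f) IH.
Qed.

Lemma mderivXM l j q :
  mderiv l (Xv j * q) = Xv j * mderiv l q + (l == j)%:R *: q.
Proof.
rewrite mderivM addrC mderivX mnm1E eq_sym.
have [->|_] := eqVneq l j; last by rewrite !scale0r mul0r.
have -> : mnm_sub (mnm1 j) (mnm1 j) = mnm0 by apply/mnmP => i; rewrite mnmBE subnn mnm0E.
by rewrite scale1r mpolyX0 mul1r scale1r.
Qed.

(** By Leibniz, one of the [r] derivatives may hit [Xv j]; otherwise [Xv j] survives and Stein's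
    identity for [m2] removes it. The covariance [d] is kept apart from [c] so that [d = 0] covers
    evaluation at 0. *)
Lemma pairingXr c d m1 m2 r j q f :
    (forall l q, m2 (Xv l * q) = \sum_l' d l l' * m2 (mderiv l' q)) ->
  pairing c m1 m2 r q (Xv j * f) =
  \sum_l d j l * pairing c m1 m2 r q (mderiv l f) +
  r%:R * \sum_l c l j * pairing c m1 m2 r.-1 (mderiv l q) f.
Proof.
move=> m2X; elim: r q f => [|r IH] q f /=.
  rewrite mul0r addr0 m2X mulr_sumr; apply: eq_bigr => l _; ring.
have -> : \sum_l d j l * (\sum_l0 \sum_l' c l0 l' *
    pairing c m1 m2 r (mderiv l0 q) (mderiv l' (mderiv l f))) =
  \sum_l0 \sum_l' c l0 l' * \sum_l d j l *
    pairing c m1 m2 r (mderiv l0 q) (mderiv l (mderiv l' f)).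
  under eq_bigr do rewrite mulr_sumr; rewrite exchange_big /=.
  apply: eq_bigr => l0 _; under eq_bigr do rewrite mulr_sumr.
  rewrite exchange_big /=; apply: eq_bigr => l' _.
  rewrite mulr_sumr; apply: eq_bigr => l _.
  by rewrite mderiv_comm mulrCA.
have -> : r.+1%:R * (\sum_l c l j * pairing c m1 m2 r (mderiv l q) f) =
    \sum_l c l j * pairing c m1 m2 r (mderiv l q) f +
    \sum_l0 \sum_l' c l0 l' * (r%:R * \sum_l c l j *
       pairing c m1 m2 r.-1 (mderiv l (mderiv l0 q)) (mderiv l' f)).
  rewrite -add1n natrD mulrDl mul1r; congr (_ + _).
  case: r {IH} => [|r].
    by rewrite mul0r big1 // => l _; rewrite big1 // => l' _; rewrite mul0r mulr0.
  rewrite [RHS](_ : _ = r.+1%:R * \sum_l0 \sum_l' c l0 l' * (\sum_l c l j *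
       pairing c m1 m2 r (mderiv l (mderiv l0 q)) (mderiv l' f))); last first.
    rewrite mulr_sumr; apply: eq_bigr => l0 _.
    by rewrite mulr_sumr; apply: eq_bigr => l' _; rewrite mulrCA.
  congr (_ * _); rewrite /=.
  under eq_bigr do rewrite mulr_sumr; rewrite exchange_big /=.
  apply: eq_bigr => l0 _; under eq_bigr do rewrite mulr_sumr.
  rewrite exchange_big /=; apply: eq_bigr => l' _.
  rewrite mulr_sumr; apply: eq_bigr => l _.
  by rewrite mderiv_comm mulrCA.
have -> : \sum_l c l j * pairing c m1 m2 r (mderiv l q) f =
   \sum_l \sum_l' c l l' * ((l' == j)%:R * pairing c m1 m2 r (mderiv l q) f).
  apply: eq_bigr => l _; rewrite (bigD1 j) //= eqxx mul1r big1 ?addr0 //.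
  by move=> l' /negPf ->; rewrite mul0r mulr0.
rewrite -!big_split; apply: eq_bigr => l _ /=.
rewrite -!big_split; apply: eq_bigr => l' _ /=.
rewrite mderivXM linearD linearZ /= IH -!mulrDr.
by congr (_ * _); rewrite -addrA; congr (_ + _); rewrite addrC.
Qed.


Lemma msize_mderiv l f k : (msize f <= k.+1)%N -> (msize (mderiv l f) <= k)%N.
Proof.
move=> fk; rewrite [mmeasure _ _]msizeE; apply/bigmax_leqP_seq => m + _.
rewrite mcoeff_msupp mcoeff_mderiv => nz.
have /msize_mdeg_lt : (mnm_add m (mnm1 l)) \in msupp f.
  by rewrite mcoeff_msupp; apply: contraNN nz => /eqP ->; rewrite mul0rn.
rewrite mdegD mdeg1 addn1 => h; exact: (leq_trans h fk).
Qed.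

Lemma msize_linear k a f g : (msize f <= k)%N -> (msize g <= k)%N ->
  (msize (a *: f + g) <= k)%N.
Proof.
move=> fk gk; apply: (leq_trans (mmeasureD_le _ _ _)).
by rewrite geq_max gk andbT; apply: leq_trans fk; exact: msizeZ_le.
Qed.

Lemma msize_sum I (s : seq I) (P : pred I) (F : I -> MP) k :
  (forall i, P i -> (msize (F i) <= k)%N) -> (msize (\sum_(i <- s | P i) F i) <= k)%N.
Proof.
move=> Fk; elim/big_rec: _ => [|i f Pi fk]; first by rewrite mmeasure0.
by rewrite -[F i]scale1r msize_linear // Fk.
Qed.

(** The step assumes [P k] for every polynomial of the lower degree, not only for [f], because
    Stein's identity brings in the derivatives of [f]. *)
Lemma mpoly_deg_ind (P : nat -> MP -> Prop) :
    (forall k, P k 0) ->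
    (forall k a f g, P k f -> P k g -> P k (a *: f + g)) ->
    (forall k, P k 1) ->
    (forall k j f, (msize f <= k.+1)%N ->
       (forall h, (msize h <= k.+1)%N -> P k h) -> P k.+1 (Xv j * f)) ->
  forall k f, (msize f <= k.+1)%N -> P k f.
Proof.
move=> P0 Pl P1 PX k f fk.
suff Pm h : (mdeg h <= k)%N -> P k (mpolyX R h).
  rewrite [f]mpolyE big_seq.
  elim/big_rec: _ => [|h g hf Pg]; first exact: P0.
  by apply: Pl => //; apply: Pm; rewrite -ltnS (leq_trans (msize_mdeg_lt hf)).
move=> hk; elim: k {f fk} h hk => [|k IH] h.
  by rewrite leqn0 mdeg_eq0 => /eqP ->; rewrite mpolyX0; exact: P1.
have [->|h0] := eqVneq h mnm0; first by move=> _; rewrite mpolyX0; exact: P1.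
have [j hj] : exists j, h j != 0%N.
  apply/existsP; apply: contraNT h0 => /existsPn H.
  by apply/eqP/mnmP => j; rewrite mnm0E; apply/eqP; rewrite -[_ == _]negbK H.
have -> : h = mnm_add (mnm1 j) (mnm_sub h (mnm1 j)).
  apply/mnmP => i; rewrite mnmDE mnmBE mnm1E.
  by have [<-|_] := eqVneq j i; [rewrite subnKC // lt0n | rewrite subn0].
move=> hk; rewrite mpolyXD; apply: PX.
  by rewrite msizeX ltnS; rewrite mdegD mdeg1 in hk.
move=> f fk; rewrite [f]mpolyE big_seq.
elim/big_rec: _ => [|i g ig Pg]; first exact: P0.
by apply: Pl => //; apply: IH; rewrite -ltnS (leq_trans (msize_mdeg_lt ig)).
Qed.

Lemma pairing_eq0 c m1 m2 r q f : (msize f <= r)%N -> pairing c m1 m2 r q f = 0.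
Proof.
elim: r q f => [|r IH] q f /= fr.
  by move: fr; rewrite leqn0 mmeasure_poly_eq0 => /eqP ->; rewrite linear0 mulr0.
by rewrite big1 // => l _; rewrite big1 // => l' _; rewrite IH ?mulr0 // msize_mderiv.
Qed.

Lemma mderiv1 l : mderiv l (1 : MP) = 0.
Proof. by rewrite -mpolyX0 mderivX mnm0E scale0r. Qed.

Lemma pairing0 c m1 m2 q f : pairing c m1 m2 0 q f = m1 q * m2 f.
Proof. by []. Qed.

Lemma pairingS c m1 m2 r q f : pairing c m1 m2 r.+1 q f =
  \sum_l \sum_l' c l l' * pairing c m1 m2 r (mderiv l q) (mderiv l' f).
Proof. by []. Qed.

Arguments pairing : simpl never.

(** After Stein's identity for [Xv j], the derivatives falling on [f] and on [q] reproduce the two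
    terms of [pairingXr], the second through [r / r! = 1 / (r-1)!]. Hence [q] stays arbitrary in the
    induction on [f]. *)
Lemma ibp_mul_expand c m : ibp c m -> m 1 = 1 -> (forall i j, c i j = c j i) ->
  forall k f q, (msize f <= k.+1)%N ->
  m (q * f) = \sum_(r < k.+1) (r`!%:R)^-1 * pairing c m m r q f.
Proof.
move=> mX m1 cC k f + fk; move: k f fk; apply: mpoly_deg_ind.
- move=> k q; rewrite mulr0 linear0 big1 // => r _.
  by rewrite pairing_eq0 ?mulr0 // mmeasure0.
- move=> k a f g Hf Hg q; rewrite mulrDr -scalerAr linearP Hf Hg /= mulr_sumr.
  by rewrite -big_split; apply: eq_bigr => r _; rewrite /= linearP mulrDr mulrCA.
- move=> k q; rewrite mulr1 big_ord_recl pairing0 m1 mulr1 invr1 mul1r big1 ?addr0 //.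
  by move=> r _; rewrite pairing_eq0 ?mulr0 // msize1.
move=> k j f fk IH q.
have dk l : (msize (mderiv l f) <= k)%N by exact: msize_mderiv.
rewrite mulrCA mX.
under [RHS]eq_bigr do rewrite (pairingXr c m _ j q f mX) mulrDr.
rewrite big_split /=.
have -> : \sum_(r < k.+2) (r`!%:R)^-1 *
    (\sum_l c j l * pairing c m m r q (mderiv l f)) =
    \sum_l c j l * m (q * mderiv l f).
  under [RHS]eq_bigr do rewrite IH ?(leq_trans (dk _)) // mulr_sumr.
  rewrite exchange_big big_ord_recr /= [X in _ * X]big1 ?mulr0 ?addr0.
    apply: eq_bigr => r _; rewrite mulr_sumr; apply: eq_bigr => l _.
    by rewrite mulrCA.
  by move=> l _; rewrite pairing_eq0 ?mulr0 // (leq_trans (dk l)).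
have -> : \sum_(r < k.+2) (r`!%:R)^-1 *
    (r%:R * (\sum_l c l j * pairing c m m r.-1 (mderiv l q) f)) =
    \sum_l c j l * m (mderiv l q * f).
  rewrite big_ord_recl /= mul0r mulr0 add0r.
  under [RHS]eq_bigr do rewrite IH // mulr_sumr.
  rewrite exchange_big /=; apply: eq_bigr => r _.
  rewrite /bump /= add1n mulrA factS natrM invfM [_^-1 * _^-1]mulrC.
  rewrite -(mulrA _^-1) mulVf ?pnatr_eq0 // mulr1.
  by rewrite mulr_sumr; apply: eq_bigr => l _; rewrite cC mulrCA.
rewrite -big_split /=; apply: eq_bigr => l _.
by rewrite mderivM linearD mulrDr addrC.
Qed.

End Pairing.

Arguments pairing : simpl never.

Section Bessel.
Variables (R : realType) (N : nat).
Local Notation MP := (mpoly N R).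
Local Notation Xv j := (mpolyX R (mnm1 j)).
Implicit Types (m : {scalar MP}) (q f : MP).

Definition delta (i j : 'I_N) : R := (i == j)%:R.

Fixpoint bessel (m : MP -> R) r f : R :=
  if r is r'.+1 then \sum_l bessel m r' (mderiv l f) else m f ^+ 2.

Lemma bessel_ge0 m r f : 0 <= bessel m r f.
Proof. by elim: r f => [|r IH] f /=; [exact: sqr_ge0 | exact: sumr_ge0]. Qed.

Lemma sum_delta (F : 'I_N -> R) l : \sum_l' delta l l' * F l' = F l.
Proof.
rewrite (bigD1 l) //= /delta eqxx mul1r big1 ?addr0 // => l' /negPf.
by rewrite eq_sym => ->; rewrite mul0r.
Qed.

(** Each rank-one term of [c] contributes the pairing of one directional derivative with itself,
    nonnegative by induction, so only the multiple of the identity is kept. *)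
Lemma pairing_ge_bessel (B : finType) (s2 : R) (v : B -> 'I_N -> R) c m r f :
    0 <= s2 ->
    (forall l l', c l l' = s2 * delta l l' + \sum_b v b l * v b l') ->
  s2 ^+ r * bessel m r f <= pairing c m m r f f.
Proof.
move=> s0 cE; elim: r f => [|r IH] f; first by rewrite expr0 mul1r.
rewrite pairingS /= exprSr -mulrA.
have -> : \sum_l \sum_l' c l l' * pairing c m m r (mderiv l f) (mderiv l' f) =
    s2 * (\sum_l pairing c m m r (mderiv l f) (mderiv l f)) +
    \sum_b pairing c m m r (\sum_l v b l *: mderiv l f) (\sum_l v b l *: mderiv l f).
  have -> : \sum_b pairing c m m r (\sum_l v b l *: mderiv l f) (\sum_l v b l *: mderiv l f)
      = \sum_l \sum_l' \sum_b (v b l * v b l') * pairing c m m r (mderiv l f) (mderiv l' f).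
    under eq_bigr do rewrite pairing_suml.
    rewrite exchange_big /=; apply: eq_bigr => l _.
    under eq_bigr do rewrite pairing_sumr mulr_sumr.
    rewrite exchange_big /=; apply: eq_bigr => l' _; apply: eq_bigr => b _.
    by rewrite mulrA.
  rewrite mulr_sumr -big_split; apply: eq_bigr => l _ /=.
  rewrite -[X in s2 * X](sum_delta (fun l' => pairing c m m r (mderiv l f) (mderiv l' f))).
  rewrite mulr_sumr -big_split; apply: eq_bigr => l' _ /=.
  by rewrite cE mulrDl mulr_suml mulrA.
rewrite -[leLHS]addr0 mulrCA lerD //; last first.
  apply: sumr_ge0 => b _; apply: le_trans (IH _).
  by rewrite mulr_ge0 ?exprn_ge0 // bessel_ge0.
by rewrite ler_wpM2l // mulr_sumr; apply: ler_sum.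
Qed.

Lemma bessel_avg (A : finType) (L : {scalar MP}) (La : A -> {scalar MP}) r f :
    (0 < #|A|)%N -> (forall f, L f = #|A|%:R^-1 * \sum_a La a f) ->
  bessel L r f <= #|A|%:R^-1 * \sum_a bessel (La a) r f.
Proof.
move=> A0 LE; elim: r f => [|r IH] f /=; last first.
  by rewrite exchange_big /= mulr_sumr; apply: ler_sum.
have nz : #|A|%:R != 0 :> R by rewrite pnatr_eq0 -lt0n.
rewrite LE; set x := \sum_a _; set y := #|A|%:R.
have : 0 <= \sum_a (La a f - y^-1 * x) ^+ 2 by apply: sumr_ge0 => a _; exact: sqr_ge0.
have -> : \sum_a (La a f - y^-1 * x) ^+ 2 =
    \sum_a La a f ^+ 2 - x ^+ 2 * y^-1.
  under eq_bigr => a _.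
    rewrite (_ : _ ^+ 2 = La a f ^+ 2 - 2 * (y^-1 * x) * La a f + (y^-1 * x) ^+ 2); last by ring.
    over.
  rewrite big_split sumrB /= -mulr_sumr -/x.
  rewrite sumr_const -mulr_natl -/y; field; exact: nz.
rewrite subr_ge0 -(ler_pM2l (_ : 0 < y^-1)) ?invr_gt0 ?ltr0n //.
by rewrite (_ : (y^-1 * x) ^+ 2 = y^-1 * (x ^+ 2 / y)) //; ring.
Qed.

Lemma pairing_deltaS m1 m2 r q f : pairing delta m1 m2 r.+1 q f =
  \sum_l pairing delta m1 m2 r (mderiv l q) (mderiv l f).
Proof. by rewrite pairingS; apply: eq_bigr => l _; rewrite sum_delta. Qed.

Lemma pairing_deltaC m r q f :
  pairing delta m m r q f = pairing delta m m r f q.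
Proof.
elim: r q f => [|r IH] q f; first by rewrite !pairing0 mulrC.
by rewrite !pairing_deltaS; apply: eq_bigr => l _.
Qed.

(* Sum over the words [u] of length [r] of [(m1 (d_u f) - t * m2 (d_u q)) ^+ 2]. *)
Lemma bessel_complete m1 m2 (t : R) r f q :
  2 * t * pairing delta m1 m2 r f q - t ^+ 2 * pairing delta m2 m2 r q q
  <= bessel m1 r f.
Proof.
elim: r f q => [|r IH] f q.
  rewrite !pairing0 /= -subr_ge0.
  by rewrite (_ : _ - _ = (m1 f - t * m2 q) ^+ 2) ?sqr_ge0 //; ring.
rewrite !pairing_deltaS /= !mulr_sumr -sumrB; exact: ler_sum.
Qed.

(** The moment functional of the degenerate law N(0, 0): it satisfies Stein's identity with zero
    covariance. *)
Definition ev0 : {scalar MP} := meval (fun=> 0).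

Lemma ev0X j q : ev0 (Xv j * q) = 0.
Proof. by rewrite /ev0 /= mevalM mevalXU mul0r. Qed.

Lemma pairing_ev0X m r j q f :
  pairing delta m ev0 r.+1 q (Xv j * f) =
  r.+1%:R * pairing delta m ev0 r (mderiv j q) f.
Proof.
rewrite (@pairingXr _ _ _ (fun _ _ => 0)); last first.
  by move=> l g; rewrite ev0X big1 // => l' _; rewrite mul0r.
rewrite big1 ?add0r; last by move=> l _; rewrite mul0r.
congr (_ * _); rewrite -[RHS](sum_delta (fun l => pairing delta m ev0 r (mderiv l q) f)).
by apply: eq_bigr => l _; rewrite /delta eq_sym.
Qed.

End Bessel.

Section Words.
Variable A : finType.

(** Ordered words rather than multisets: powers of a sum then expand with coefficients 1, and
    factorials come only from exponential series. *)
Fixpoint words s : seq (seq A) :=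
  if s is s'.+1 then [seq a :: e | a <- enum A, e <- words s'] else [:: [::]].

Lemma big_words0 (V : nmodType) (F : seq A -> V) :
  \sum_(e <- words 0) F e = F [::].
Proof. by rewrite big_seq1. Qed.

Lemma big_wordsS (V : nmodType) (F : seq A -> V) s :
  \sum_(e <- words s.+1) F e = \sum_a \sum_(e <- words s) F (a :: e).
Proof. by rewrite big_allpairs_dep /= big_enum. Qed.

Lemma size_words s e : e \in words s -> size e = s.
Proof.
elim: s e => [|s IH] e /=; first by rewrite inE => /eqP ->.
by move=> /allpairsP[[a e'] /= [_ /IH <- ->]].
Qed.

End Words.

(** * Quadratic words and their Gram matrix *)

Section Quadratic.
Variables (R : realType) (N : nat).
Local Notation MP := (mpoly N R).
Local Notation Xv j := (mpolyX R (mnm1 j)).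
Variables (A J : finType) (u v : A -> J -> 'I_N).
Implicit Types (m : {scalar MP}) (f : MP) (e : seq A).

Definition quad a : MP := \sum_j Xv (u a j) * Xv (v a j).
Definition dquad a f : MP := \sum_j mderiv (v a j) (mderiv (u a j) f).
Definition quads e : MP := \prod_(a <- e) quad a.
Fixpoint dquads e f : MP := if e is a :: e' then dquads e' (dquad a f) else f.

Lemma dquad_is_linear a : linear (dquad a).
Proof.
move=> c f g; rewrite /dquad scaler_sumr -big_split; apply: eq_bigr => j _ /=.
by rewrite !linearP.
Qed.

HB.instance Definition _ a := GRing.isLinear.Build R MP MP _ (dquad a) (dquad_is_linear a).

Lemma dquads_is_linear e : linear (dquads e).
Proof. by elim: e => [|a e IH] c f g //=; rewrite linearP IH. Qed.

HB.instance Definition _ e := GRing.isLinear.Build R MP MP _ (dquads e) (dquads_is_linear e).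

Lemma pairing_linl m1 m2 r f (I : Type) (s : seq I) (q : I -> MP) :
  pairing (@delta R N) m1 m2 r (\sum_(i <- s) q i) f =
  \sum_(i <- s) pairing (@delta R N) m1 m2 r (q i) f.
Proof.
transitivity (\sum_(i <- s) 1 * pairing (@delta R N) m1 m2 r (q i) f).
  by rewrite -pairing_suml; congr pairing; apply: eq_bigr => i _; rewrite scale1r.
by apply: eq_bigr => i _; rewrite mul1r.
Qed.

(** Duality between multiplication and differentiation at 0: averaging [dquads e f] is testing [f]
    against the polynomial [quads e]. This lets the combination of averages in E[x f] come from a
    test polynomial of [bessel_complete]. *)
Lemma pairing_quads m f e :
  pairing (@delta R N) m (@ev0 R N) (size e).*2 f (quads e) =
  ((size e).*2)`!%:R * m (dquads e f).
Proof.
elim: e f => [|a e IH] f /=.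
  by rewrite double0 pairing0 /quads big_nil /ev0 /= meval1 mulr1 mul1r.
rewrite /quads big_cons -/(quads e) mulr_suml linear_sum /=.
under eq_bigr do rewrite -mulrA !pairing_ev0X.
rewrite -!mulr_sumr -pairing_linl -/(dquad a f) IH.
by rewrite doubleS !factS !natrM -!mulrA.
Qed.

(** Coefficientwise positivity, preserved by products and derivatives; it makes all entries of the
    Gram matrix [qdot] nonnegative, as a Schur test by row sums requires. *)
Definition nonneg f := forall h, 0 <= mcoeff h f.

Lemma nonneg_sum I (s : seq I) (P : pred I) (F : I -> MP) :
  (forall i, P i -> nonneg (F i)) -> nonneg (\sum_(i <- s | P i) F i).
Proof. by move=> F0 h; rewrite linear_sum; apply: sumr_ge0 => i Pi; exact: F0. Qed.

Lemma nonneg_mul f g : nonneg f -> nonneg g -> nonneg (f * g).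
Proof.
by move=> f0 g0 h; rewrite mcoeffM; apply: sumr_ge0 => k _; exact: mulr_ge0.
Qed.

Lemma nonnegX h : nonneg (mpolyX R h).
Proof. by move=> k; rewrite mcoeffX ler0n. Qed.

Lemma nonneg_mderiv l f : nonneg f -> nonneg (mderiv l f).
Proof. by move=> f0 h; rewrite mcoeff_mderiv mulrn_wge0. Qed.

Lemma nonneg_quad a : nonneg (quad a).
Proof. by apply: nonneg_sum => j _; apply: nonneg_mul; exact: nonnegX. Qed.

Lemma nonneg_quads e : nonneg (quads e).
Proof.
rewrite /quads; elim/big_rec: _ => [|a f _ f0]; first by rewrite -mpolyX0; exact: nonnegX.
by apply: nonneg_mul => //; exact: nonneg_quad.
Qed.

Lemma nonneg_dquads e f : nonneg f -> nonneg (dquads e f).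
Proof.
elim: e f => //= a e IH f f0; apply: IH; apply: nonneg_sum => j _.
by do 2 apply: nonneg_mderiv.
Qed.

Lemma ev0_ge0 f : nonneg f -> 0 <= @ev0 R N f.
Proof.
move=> f0; rewrite /ev0 /= mevalE; apply: sumr_ge0 => h _.
by rewrite mulr_ge0 // prodr_ge0 // => i _; rewrite exprn_ge0.
Qed.

Definition qdot e e' := @ev0 R N (dquads e (quads e')).

Lemma qdot_ge0 e e' : 0 <= qdot e e'.
Proof. by apply: ev0_ge0; apply: nonneg_dquads; exact: nonneg_quads. Qed.

Lemma qdotC e e' : size e = size e' -> qdot e e' = qdot e' e.
Proof.
move=> see; have nz : ((size e).*2)`!%:R != 0 :> R by rewrite pnatr_eq0 -lt0n fact_gt0.
apply: (mulfI nz); rewrite -pairing_quads pairing_deltaC see.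
by rewrite pairing_quads -see.
Qed.

Definition qsum (k : seq A -> R) s : MP := \sum_(e <- words A s) k e *: quads e.

Lemma pairing_qsum m f k s :
  pairing (@delta R N) m (@ev0 R N) s.*2 f (qsum k s) =
  (s.*2)`!%:R * \sum_(e <- words A s) k e * m (dquads e f).
Proof.
rewrite pairing_sumr mulr_sumr big_seq [RHS]big_seq; apply: eq_bigr => e.
by move=> /size_words <-; rewrite pairing_quads mulrCA.
Qed.

Lemma quads_sum s : \sum_(e <- words A s) quads e = (\sum_a quad a) ^+ s.
Proof.
elim: s => [|s IH]; first by rewrite big_words0 /quads big_nil expr0.
rewrite big_wordsS exprS -IH mulr_suml; apply: eq_bigr => a _.
by rewrite mulr_sumr; apply: eq_bigr => e _; rewrite /quads big_cons.
Qed.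

(* Schur test for the Gram matrix of the quadratic words. *)
Lemma qsum_norm_le k s (c : nat -> R) :
    (forall a s, dquad a ((\sum_a quad a) ^+ s.+1) = c s *: (\sum_a quad a) ^+ s) ->
  pairing (@delta R N) (@ev0 R N) (@ev0 R N) s.*2 (qsum k s) (qsum k s) <=
  (s.*2)`!%:R * (\prod_(i < s) c i) * \sum_(e <- words A s) k e ^+ 2.
Proof.
move=> cE; rewrite pairing_qsum -mulrA ler_wpM2l ?ler0n //.
have -> : \sum_(e <- words A s) k e * @ev0 R N (dquads e (qsum k s)) =
    \sum_(e <- words A s) \sum_(e' <- words A s) k e * k e' * qdot e e'.
  apply: eq_bigr => e _; rewrite /qsum linear_sum linear_sum mulr_sumr.
  by apply: eq_bigr => e' _; rewrite !linearZ /= -mulrA.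
(* The words [e'] add up to a power of the total quadratic form, and every letter of [e] lowers that
   power by one at the cost of a factor [c]. *)
have rowsum e : size e = s -> \sum_(e' <- words A s) qdot e e' = \prod_(i < s) c i.
  rewrite /qdot -linear_sum -linear_sum quads_sum /=.
  elim: s e => [|s IH] [|a e] //=; first by rewrite big_ord0 expr0 /ev0 /= meval1.
  move=> [se]; rewrite cE linearZ linearZ /= IH // big_ord_recr /= mulrC.
  by congr (_ * _).
(* Half of the row sums plus half of the column sums, to be compared termwise through
   [k e * k e' <= (k e ^+ 2 + k e' ^+ 2) / 2]. *)
have -> : \prod_(i < s) c i * \sum_(e <- words A s) k e ^+ 2 =
    \sum_(e <- words A s) \sum_(e' <- words A s) 2^-1 * (k e ^+ 2 + k e' ^+ 2) * qdot e e'.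
  rewrite -[LHS](_ : 2^-1 * (\prod_(i < s) c i * \sum_(e <- words A s) k e ^+ 2) +
    2^-1 * (\prod_(i < s) c i * \sum_(e <- words A s) k e ^+ 2) = _); last by field.
  have E1 : \prod_(i < s) c i * \sum_(e <- words A s) k e ^+ 2 =
      \sum_(e <- words A s) \sum_(e' <- words A s) k e ^+ 2 * qdot e e'.
    rewrite mulr_sumr big_seq [RHS]big_seq; apply: eq_bigr => e /size_words se.
    by rewrite -mulr_sumr rowsum // mulrC.
  have E2 : \prod_(i < s) c i * \sum_(e <- words A s) k e ^+ 2 =
      \sum_(e <- words A s) \sum_(e' <- words A s) k e' ^+ 2 * qdot e e'.
    rewrite E1 exchange_big /= big_seq [RHS]big_seq; apply: eq_bigr => e /size_words se.
    rewrite big_seq [RHS]big_seq; apply: eq_bigr => e' /size_words se'.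
    by rewrite qdotC // se.
  rewrite {1}E1 E2 !mulr_sumr -big_split; apply: eq_bigr => e _ /=.
  rewrite !mulr_sumr -big_split; apply: eq_bigr => e' _ /=; ring.
apply: ler_sum => e _; apply: ler_sum => e' _.
rewrite ler_wpM2r ?qdot_ge0 // -subr_ge0.
rewrite (_ : _ - _ = 2^-1 * (k e - k e') ^+ 2); last by field.
by rewrite mulr_ge0 ?invr_ge0 ?ler0n // sqr_ge0.
Qed.

End Quadratic.

(** * Cumulants along words *)

Section Shuffle.
Variables (R : realType) (A : Type).

Definition shift (phi : seq A -> R) a e := phi (a :: e).

(* Sum of [phi e1 * psi e2] over the ways to split the positions of [e] into two
   complementary subwords. *)
Fixpoint conv (phi psi : seq A -> R) e : R :=
  if e is a :: e' then conv (shift phi a) psi e' + conv phi (shift psi a) e'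
  else phi [::] * psi [::].

End Shuffle.

Lemma sum_pascal (V : zmodType) (G : nat -> nat -> V) s :
  \sum_(i < s.+1) (G i.+1 (s - i)%N + G i (s - i).+1) *+ 'C(s, i) =
  \sum_(i < s.+2) G i (s.+1 - i)%N *+ 'C(s.+1, i).
Proof.
under eq_bigr do rewrite mulrnDl.
rewrite big_split /= [RHS]big_ord_recl /= bin0 subn0.
under [X in _ = _ + X]eq_bigr => i _.
  rewrite /bump /= add1n binS mulrnDr subSS; over.
rewrite big_split /= [X in _ = _ + (X + _)]big_ord_recr /= bin_small // mulr0n addr0.
rewrite [RHS]addrA [RHS]addrC; congr (_ + _).
rewrite big_ord_recl /= bin0 subn0; congr (_ + _).
apply: eq_bigr => i _; rewrite /bump /= add1n; congr (G _ _ *+ _).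
by rewrite subnSK.
Qed.

Lemma sum_triangle (V : zmodType) (F : nat -> nat -> V) k :
    (forall i j, (k < i + j)%N -> F i j = 0) ->
  \sum_(s < k.+1) \sum_(i < s.+1) F i (s - i)%N =
  \sum_(i < k.+1) \sum_(j < k.+1) F i j.
Proof.
move=> F0.
have -> : \sum_(s < k.+1) \sum_(i < s.+1) F i (s - i)%N =
    \sum_(s < k.+1) \sum_(i < k.+1 | (i <= s)%N) F i (s - i)%N.
  apply: eq_bigr => s _.
  rewrite (big_ord_widen k.+1 (fun i => F i (s - i)%N)); last exact: ltn_ord.
  by apply: eq_bigl => i.
rewrite (exchange_big_dep predT) //=; apply: eq_bigr => i _.
rewrite -[RHS](big_mkord predT (F i)).
rewrite -(big_mkord (fun s => i <= s)%N (fun s => F i (s - i)%N)).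
rewrite (@big_cat_nat _ _ _ i) //=; last exact: ltnW.
rewrite big_nat_cond big_pred0 ?add0r; last first.
  by move=> j /=; case: ltnP => //=; rewrite ?andbF.
rewrite -{1}[i : nat]add0n big_addn.
rewrite [RHS](@big_cat_nat _ _ _ (k.+1 - i)) //=; last exact: leq_subr.
rewrite [X in _ = _ + X]big_nat_cond [X in _ = _ + X]big1 ?addr0; last first.
  by move=> j; rewrite andbT => /andP[+ _]; rewrite leq_subLR => /F0.
apply: eq_big => [j|j _]; first by rewrite leq_addl.
by rewrite addnK.
Qed.

Section Expansion.
Variables (R : realType) (N : nat).
Local Notation MP := (mpoly N R).
Local Notation Xv j := (mpolyX R (mnm1 j)).
Implicit Types (m : {scalar MP}) (f : MP).

(** [L1] is [L0] composed with [exp Q]: the commutator of [Q] with [Xv j] is the derivation along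
    row [j] of [g], so both sides obey Stein's identity for [c0 + g]. The series is finite because
    [Q] lowers the degree. *)
Lemma functional_expand c0 c1 (g : 'I_N -> 'I_N -> R) (L0 L1 : {scalar MP})
    (Q : {linear MP -> MP}) :
    ibp c0 L0 -> ibp c1 L1 -> L0 1 = 1 -> L1 1 = 1 ->
    (forall j l, c1 j l = c0 j l + g j l) ->
    (forall j f, Q (Xv j * f) = Xv j * Q f + \sum_l g j l *: mderiv l f) ->
    (forall l f, Q (mderiv l f) = mderiv l (Q f)) ->
    (forall k f, (msize f <= k.+1)%N -> (msize (Q f) <= k)%N) ->
  forall k f, (msize f <= k.+1)%N ->
  L1 f = \sum_(s < k.+1) (s`!%:R)^-1 * L0 (iter s Q f).
Proof.
move=> L0X L1X L01 L11 c1E QX Qd Qs.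
have iterL s a f h : iter s Q (a *: f + h) = a *: iter s Q f + iter s Q h.
  by elim: s => //= s ->; rewrite linearP.
have iter0 s : iter s Q 0 = 0.
  by elim: s => //= s ->; rewrite linear0.
have iters s k f : (msize f <= k)%N -> (msize (iter s Q f) <= k - s)%N.
  move=> fk; elim: s => [|s IH] /=; first by rewrite subn0.
  rewrite subnS; case: (k - s)%N IH => [|i]; last exact: Qs.
  rewrite leqn0 mmeasure_poly_eq0 => /eqP ->.
  by rewrite linear0 mmeasure0.
have iterd s l f : iter s Q (mderiv l f) = mderiv l (iter s Q f).
  by elim: s => //= s ->; rewrite Qd.
have iterX s j f : iter s Q (Xv j * f) = Xv j * iter s Q f +
    s%:R *: \sum_l g j l *: mderiv l (iter s.-1 Q f).
  elim: s => [|s IH] /=; first by rewrite scale0r addr0.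
  rewrite IH linearD QX linearZ /= -addrA; congr (_ + _).
  case: s {IH} => [|s] /=; first by rewrite scale0r addr0 scale1r.
  rewrite -[s.+2%:R]natr1 scalerDl scale1r addrC; congr (_ + _).
  congr (_ *: _); rewrite linear_sum; apply: eq_bigr => l _.
  by rewrite linearZ /= Qd.
apply: mpoly_deg_ind.
- by move=> k; rewrite linear0 big1 // => s _; rewrite iter0 linear0 mulr0.
- move=> k a f h Hf Hh; rewrite linearP Hf Hh /= mulr_sumr -big_split.
  by apply: eq_bigr => s _; rewrite /= iterL linearP mulrDr mulrCA.
- move=> k; rewrite L11 big_ord_recl /= L01 mulr1 invr1 big1 ?addr0 // => s _.
  have /= := iters s.+1 1%N 1; rewrite msize1 subSS sub0n leqn0 => /(_ isT).
  by rewrite mmeasure_poly_eq0 /bump /= add1n => /eqP ->; rewrite linear0 mulr0.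
move=> k j f fk IH; rewrite L1X.
under [RHS]eq_bigr do rewrite iterX linearD linearZ L0X mulrDr.
rewrite big_split /=.
have dk l : (msize (mderiv l f) <= k)%N by exact: msize_mderiv.
have -> : \sum_(s < k.+2) s`!%:R^-1 * (\sum_l c0 j l * L0 (mderiv l (iter s Q f))) =
    \sum_l c0 j l * L1 (mderiv l f).
  under [RHS]eq_bigr do rewrite IH ?(leq_trans (dk _)) // mulr_sumr.
  rewrite exchange_big big_ord_recr /= [X in _ * X]big1 ?mulr0 ?addr0; last first.
    move=> l _; rewrite -[Q _]/(iter k.+1 Q f) -iterd; have := iters k.+1 _ _ (dk l).
    rewrite subnS subnn leqn0 mmeasure_poly_eq0 => /eqP ->.
    by rewrite linear0 mulr0.
  apply: eq_bigr => s _; rewrite mulr_sumr; apply: eq_bigr => l _.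
  by rewrite iterd mulrCA.
have -> : \sum_(s < k.+2) s`!%:R^-1 *
    (s%:R * L0 (\sum_l g j l *: mderiv l (iter s.-1 Q f))) =
    \sum_l g j l * L1 (mderiv l f).
  under [RHS]eq_bigr do rewrite IH ?(leq_trans (dk _)) // mulr_sumr.
  rewrite exchange_big /= big_ord_recl /= mul0r mulr0 add0r.
  apply: eq_bigr => s _; rewrite /bump /= add1n mulrA factS natrM.
  rewrite invfM [_^-1 * _^-1]mulrC -(mulrA _^-1) mulVf ?pnatr_eq0 // mulr1.
  rewrite linear_sum mulr_sumr; apply: eq_bigr => l _.
  by rewrite linearZ iterd mulrCA.
by rewrite -big_split; apply: eq_bigr => l _; rewrite /= c1E mulrDl.
Qed.

Variables (A J : finType) (u v : A -> J -> 'I_N).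
Local Notation dquad := (@dquad R N A J u v).
Local Notation dquads := (@dquads R N A J u v).

Lemma dquad_mderiv l a f : dquad a (mderiv l f) = mderiv l (dquad a f).
Proof.
rewrite /dquad linear_sum; apply: eq_bigr => j _ /=.
by rewrite (mderiv_comm l (u a j)) (mderiv_comm l (v a j)).
Qed.

Lemma dquadC a b f : dquad a (dquad b f) = dquad b (dquad a f).
Proof.
transitivity (\sum_j dquad a (mderiv (v b j) (mderiv (u b j) f))).
  by rewrite -linear_sum.
by apply: eq_bigr => j _; rewrite !dquad_mderiv.
Qed.

Lemma dquads_dquad e a f : dquads e (dquad a f) = dquad a (dquads e f).
Proof. by elim: e f => //= b e IH f; rewrite dquadC IH. Qed.

Lemma msize_dquad k a f : (msize f <= k)%N -> (msize (dquad a f) <= k - 2)%N.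
Proof.
move=> fk; apply: msize_sum => j _.
have dd l (h : MP) i : (msize h <= i)%N -> (msize (mderiv l h) <= i.-1)%N.
  case: i => [|i] /=; last exact: msize_mderiv.
  by rewrite leqn0 mmeasure_poly_eq0 => /eqP ->; rewrite linear0 mmeasure0.
by rewrite subn2; exact: (dd _ _ _ (dd _ _ _ fk)).
Qed.

Lemma msize_dquads k e f : (msize f <= k)%N -> (msize (dquads e f) <= k - (size e).*2)%N.
Proof.
elim: e k f => [|a e IH] k f fk; first by rewrite subn0.
have := IH _ _ (msize_dquad a fk).
by rewrite -subnDA [size (a :: e)]/= doubleS add2n.
Qed.

(** The operator with symbol [phi] restricted to words of length [s]; divided by [s!] it is the term
    of order [s] of an exponential series. *)
Definition theta s (phi : seq A -> R) f : MP :=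
  \sum_(e <- words A s) phi e *: dquads e f.

Lemma theta_is_linear s phi : linear (theta s phi).
Proof.
move=> c f h; rewrite /theta scaler_sumr -big_split; apply: eq_bigr => e _ /=.
by rewrite linearP scalerDr scalerA mulrC -scalerA.
Qed.

HB.instance Definition _ s phi :=
  GRing.isLinear.Build R MP MP _ (theta s phi) (theta_is_linear s phi).

Lemma thetaS s phi f : theta s.+1 phi f = \sum_a theta s (shift phi a) (dquad a f).
Proof. by rewrite /theta big_wordsS. Qed.

Lemma theta_dquad s phi a f : theta s phi (dquad a f) = dquad a (theta s phi f).
Proof.
rewrite /theta linear_sum; apply: eq_bigr => e _.
by rewrite linearZ /= dquads_dquad.
Qed.

Lemma eq_theta s phi psi f : phi =1 psi -> theta s phi f = theta s psi f.
Proof. by move=> E; apply: eq_bigr => e _; rewrite E. Qed.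

Lemma thetaD s phi psi f :
  theta s (fun e => phi e + psi e) f = theta s phi f + theta s psi f.
Proof. by rewrite -big_split; apply: eq_bigr => e _; rewrite scalerDl. Qed.

(** Since the operators commute, [conv] on coefficients is the product of exponential series of
    operators. *)
Lemma theta_conv s phi psi f :
  theta s (conv phi psi) f =
  \sum_(i < s.+1) theta (s - i) psi (theta i phi f) *+ 'C(s, i).
Proof.
elim: s phi psi f => [|s IH] phi psi f.
  by rewrite big_ord_recl big_ord0 /theta !big_words0 /= addr0 scalerA mulrC.
rewrite thetaS -(sum_pascal (fun i j => theta j psi (theta i phi f))).
under eq_bigr => a _.
  rewrite (eq_theta _
    (psi := fun e => conv (shift phi a) psi e + conv phi (shift psi a) e)); last by [].
  rewrite thetaD !IH -big_split; over.
rewrite exchange_big; apply: eq_bigr => i _ /=.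
rewrite thetaS linear_sum [theta (s - i).+1 _ _]thetaS -big_split -sumrMnl.
by apply: eq_bigr => a _; rewrite mulrnDl (theta_dquad i phi).
Qed.

Lemma theta_iter s (w : A -> R) f :
  theta s (fun e => \prod_(a <- e) w a) f =
  iter s (fun f => \sum_a w a *: dquad a f) f.
Proof.
elim: s f => [|s IH] f; first by rewrite /theta big_words0 big_nil scale1r.
rewrite thetaS iterSr -IH linear_sum; apply: eq_bigr => a _.
rewrite linearZ /= /theta scaler_sumr; apply: eq_bigr => e _.
by rewrite /shift big_cons scalerA.
Qed.

Lemma msize_theta k s phi f : (msize f <= k)%N -> (msize (theta s phi f) <= k - s.*2)%N.
Proof.
move=> fk; rewrite /theta big_seq; apply: msize_sum => e /size_words <-.
exact: leq_trans (msizeZ_le _ _) (msize_dquads _ fk).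
Qed.

(** The series of [x * phi] factors as the series of [kappa] times that of the mean of [phi].
    Applying [L0] after the second factor gives back the mixture functional [L], so [L0] disappears
    from the result. *)
Lemma moment_cumulant (B : finType) (w x : B -> R) (t : R) (L0 L : {scalar MP})
    (La : B -> {scalar MP}) (Lx : MP -> R) (phi : B -> seq A -> R)
    (kappa : seq A -> R) :
    (forall a k f, (msize f <= k.+1)%N ->
      La a f = \sum_(s < k.+1) t ^+ s / s`!%:R * L0 (theta s (phi a) f)) ->
    (forall f, L f = \sum_a w a * La a f) ->
    (forall f, Lx f = \sum_a w a * (x a * La a f)) ->
    (forall e, conv kappa (fun e => \sum_a w a * phi a e) e =
               \sum_a w a * (x a * phi a e)) ->
  forall k f, (msize f <= k.+1)%N ->
  Lx f = \sum_(s < k./2.+1) t ^+ s / s`!%:R *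
    \sum_(e <- words A s) kappa e * L (dquads e f).
Proof.
move=> LaE LE LxE kE k f fk.
have avg (y : B -> R) h : (msize h <= k.+1)%N -> \sum_a y a * La a h =
    \sum_(s < k.+1) t ^+ s / s`!%:R * L0 (theta s (fun e => \sum_a y a * phi a e) h).
  move=> hk; under eq_bigr do rewrite (LaE _ _ _ hk) mulr_sumr.
  rewrite exchange_big; apply: eq_bigr => s _ /=.
  under eq_bigr do rewrite mulrCA; rewrite -mulr_sumr; congr (_ * _).
  rewrite /theta linear_sum; under eq_bigr do rewrite linear_sum mulr_sumr.
  rewrite exchange_big; apply: eq_bigr => e _ /=.
  by rewrite [RHS]linearZ /= mulr_suml; apply: eq_bigr => a _; rewrite linearZ /= mulrA.
pose P e := \sum_a w a * phi a e.
have -> : Lx f = \sum_(s < k.+1) \sum_(i < s.+1)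
    t ^+ i / i`!%:R * (t ^+ (s - i) / (s - i)`!%:R * L0 (theta (s - i) P (theta i kappa f))).
  rewrite LxE; under eq_bigr do rewrite mulrA; rewrite (avg _ _ fk).
  apply: eq_bigr => s _; rewrite (eq_theta _ (psi := conv kappa P)); last first.
    by move=> e; rewrite kE; apply: eq_bigr => a _; rewrite mulrA.
  rewrite theta_conv linear_sum mulr_sumr; apply: eq_bigr => i _.
  have is_ : (i <= s)%N by rewrite -ltnS.
  rewrite linearMn -mulr_natl -{1}(subnKC is_) exprD.
  have nz j : j`!%:R != 0 :> R by rewrite pnatr_eq0 -lt0n fact_gt0.
  rewrite -(bin_fact is_) !natrM; have := nz i; have := nz (s - i)%N.
  have : 'C(s, i)%:R != 0 :> R by rewrite pnatr_eq0 -lt0n bin_gt0.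
  by move=> ? ? ?; field; apply/and3P.
(* A term with [k < i + j] differentiates more than [k] times, so the double sum may be completed to
   a square in which [i] and [j] are independent. *)
rewrite (@sum_triangle _ (fun i j => t ^+ i / i`!%:R *
    (t ^+ j / j`!%:R * L0 (theta j P (theta i kappa f))))); last first.
  move=> i j kij; rewrite [theta j P _](_ : _ = 0) ?linear0 ?mulr0 //.
  apply/eqP; rewrite -(@mmeasure_poly_eq0 _ _ mdeg) -leqn0.
  apply: leq_trans (msize_theta _ _ (msize_theta _ _ fk)) _.
  by rewrite leqn0 -subnDA -doubleD subn_eq0 -addnn ltn_addr.
have -> : \sum_(i < k.+1) \sum_(j < k.+1) t ^+ i / i`!%:R *
    (t ^+ j / j`!%:R * L0 (theta j P (theta i kappa f))) =
    \sum_(i < k.+1) t ^+ i / i`!%:R * \sum_(e <- words A i) kappa e * L (dquads e f).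
  apply: eq_bigr => i _; rewrite -mulr_sumr -avg; last first.
    exact: leq_trans (msize_theta _ _ fk) (leq_subr _ _).
  rewrite -LE /theta linear_sum; congr (_ * _).
  by apply: eq_bigr => e _; rewrite linearZ.
rewrite [RHS](big_ord_widen k.+1 (fun s => t ^+ s / s`!%:R *
  \sum_(e <- words A s) kappa e * L (dquads e f))); last first.
  by lia.
rewrite [LHS](bigID (fun i : 'I_k.+1 => (i < k./2.+1)%N)) /= [X in _ + X]big1 ?addr0 // => i.
rewrite -leqNgt => ki; rewrite big_seq big1 ?mulr0 // => e /size_words se.
rewrite [dquads e f](_ : _ = 0) ?linear0 ?mulr0 //.
apply/eqP; rewrite -(@mmeasure_poly_eq0 _ _ mdeg) -leqn0.
apply: leq_trans (msize_dquads _ fk) _; rewrite leqn0 subn_eq0 se.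
by move: ki; lia.
Qed.

End Expansion.

(** * Formal cumulants of functions on words *)

Section Cumulant.
Import mathcomp.boot.fintype mathcomp.boot.finset.
Variables (R : realType) (A : eqType).
Implicit Types (e : seq A) (f g : seq A -> R).

Fixpoint splits e : seq (seq A * seq A) :=
  if e is a :: e' then
    [seq (a :: u.1, u.2) | u <- splits e'] ++ [seq (u.1, a :: u.2) | u <- splits e']
  else [:: ([::], [::])].

Lemma splitsE e : splits e = (e, [::]) :: behead (splits e).
Proof. by elim: e => //= a e ->. Qed.

Lemma size_splits e u : u \in behead (splits e) -> (size u.1 < size e)%N.
Proof.
elim: e u => //= a e IH u; rewrite splitsE /= mem_cat inE.
case/or3P => [/mapP[w /IH we ->]|/eqP ->|/mapP[w /IH we ->]] //=.
exact: ltnW.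
Qed.

Lemma convE f g e : conv f g e = \sum_(u <- splits e) f u.1 * g u.2.
Proof.
elim: e f g => [|a e IH] f g /=; first by rewrite big_seq1.
by rewrite !IH big_cat !big_map.
Qed.

(* Solves [conv k pr = px] for [k]; the first split of [e] is [(e, [::])]. *)
Fixpoint cumulant_rec (px pr : seq A -> R) m e : R :=
  if m is m'.+1 then
    px e - \sum_(u <- behead (splits e)) cumulant_rec px pr m' u.1 * pr u.2
  else 0.

Definition cumulant px pr e := cumulant_rec px pr (size e).+1 e.

Lemma cumulant_recE px pr m e : (size e < m)%N ->
  cumulant_rec px pr m e = cumulant px pr e.
Proof.
suff H m' k : (size e < m')%N -> (size e < k)%N ->
    cumulant_rec px pr m' e = cumulant_rec px pr k e by move=> em; exact: H.
elim: m' k e {m} => [//|m IH] [//|k] e em ek /=; congr (_ - _).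
rewrite big_seq [RHS]big_seq; apply: eq_bigr => u /size_splits ue.
by congr (_ * _); apply: IH; rewrite (leq_trans ue).
Qed.

Lemma conv_cumulant px pr e : pr [::] = 1 -> conv (cumulant px pr) pr e = px e.
Proof.
move=> pr1; rewrite convE splitsE big_cons /= pr1 mulr1 {1}/cumulant /=.
rewrite [X in _ - X + _](_ : _ = \sum_(u <- behead (splits e))
   cumulant px pr u.1 * pr u.2) ?subrK //.
rewrite big_seq [RHS]big_seq; apply: eq_bigr => u /size_splits ue.
by congr (_ * _); exact: cumulant_recE.
Qed.

(** Letters of a word may repeat, so subwords are indexed by sets of positions, [h] giving the
    letter at each position. *)
Lemma conv_map (L : finType) (h : L -> A) f g (r : seq L) : uniq r ->
  conv f g [seq h l | l <- r] = \sum_(S : {set L} | S \subset r)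
    f [seq h l | l <- r & l \in S] * g [seq h l | l <- r & l \notin S].
Proof.
elim: r f g => [|a r IH] f g /=.
  move=> _; rewrite (big_pred1 set0) //= => S.
  by apply/subsetP/eqP => [H|-> x]; [apply/setP => x; rewrite inE; apply/negP => /H | rewrite inE].
move=> /andP[ar ur]; rewrite !IH //.
rewrite [RHS](bigID (fun S : {set L} => a \in S)) /=; congr (_ + _).
  rewrite [RHS](reindex_onto (fun S => a |: S) (fun S => S :\ a)) /=; last first.
    by move=> S /andP[_ aS]; rewrite setD1K.
  apply: eq_big => [S|S Sr].
    rewrite setU11 andbT; apply/idP/andP => [Sr|[Sr /eqP aS]].
      have aS : a \notin S by apply: contraNN ar => /(subsetP Sr).
      split; last by rewrite setU1K.
      apply/subsetP => x; rewrite !inE => /orP[->//|/(subsetP Sr) ->].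
      by rewrite orbT.
    apply/subsetP => x xS; have := subsetP Sr x.
    rewrite !inE xS orbT => /(_ isT).
    by case/orP => // /eqP xa; move: xS; rewrite xa -aS !inE eqxx.
  rewrite !inE eqxx /= /shift; congr (f (_ :: _) * g _).
    by congr map; apply: eq_in_filter => x xr; rewrite !inE; case: eqP => // xa; rewrite -xa xr in ar.
  by congr map; apply: eq_in_filter => x xr; rewrite !inE; case: eqP => // xa; rewrite -xa xr in ar.
apply: eq_big => [S|S Sr].
  apply/idP/andP => [Sr|[Sr aS]].
    split; first by apply/subsetP => x /(subsetP Sr); rewrite !inE => ->; rewrite orbT.
    by apply: contraNN ar => /(subsetP Sr).
  apply/subsetP => x xS; have := subsetP Sr x xS; rewrite !inE => /orP[/eqP xa|//].
  by rewrite -xa xS in aS.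
have aS : a \notin S by apply: contraNN ar => /(subsetP Sr).
by rewrite (negPf aS).
Qed.

Lemma conv_map_set (L : finType) (h : L -> A) f g (S : {set L}) :
  conv f g [seq h l | l <- enum S] = \sum_(S' : {set L} | S' \subset S)
    f [seq h l | l <- enum S'] * g [seq h l | l <- enum (S :\: S')].
Proof.
rewrite conv_map ?enum_uniq //; apply: eq_big => [S'|S' S'S].
  by apply: eq_subset_r => x; rewrite mem_enum.
have -> : [seq l <- enum S | l \in S'] = enum S'.
  rewrite /enum_mem -filter_predI; apply: eq_filter => x /=.
  apply/andP/idP => [[]//|xS]; split=> //.
  by have := subsetP S'S x xS; rewrite mem_enum.
congr (_ * g (map _ _)).
by rewrite /enum_mem -filter_predI; apply: eq_filter => x /=; rewrite !inE.
Qed.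

End Cumulant.

(** * Cumulants of monochromatic edges *)

Section Coloring.
Import mathcomp.boot.fintype mathcomp.boot.finset.
Variables (R : realType) (V L : finType) (K' : nat) (g : L -> V * V).
Local Notation K := K'.+1.
Local Notation col := {ffun V -> 'I_K}.
Implicit Types (a b : col) (S : {set L}) (U W : {set V}).

Definition good a S := [forall l in S, a (g l).1 == a (g l).2].

Definition off W (Q : pred col) :=
  forall a b, (forall x, x \notin W -> a x = b x) -> Q a = Q b.

Definition within S U := forall l, l \in S -> ((g l).1 \in U) && ((g l).2 \in U).

Lemma goodP a S : reflect (forall l, l \in S -> a (g l).1 = a (g l).2) (good a S).
Proof. by apply: (iffP forall_inP) => H l /H /eqP. Qed.

Lemma goodU a S1 S2 : good a (S1 :|: S2) = good a S1 && good a S2.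
Proof.
apply/goodP/andP => [H|[/goodP H1 /goodP H2] l]; last first.
  by rewrite inE => /orP[/H1|/H2].
by split; apply/goodP => l lS; apply: H; rewrite inE lS ?orbT.
Qed.

Lemma off_good S W : within S (~: W) -> off W (good^~ S).
Proof.
move=> SW a b ab; apply/goodP/goodP => H l lS;
    have /andP[] := SW _ lS; rewrite !inE => w1 w2.
  by rewrite -!ab // H.
by rewrite !ab // H.
Qed.

(* The involution exchanges the two colourings on [W], after the cyclic shift
   of colours that makes them agree at the articulation vertex [o]. *)
Lemma card_independent (Q : pred col) W o S : off W Q -> o \notin W ->
    within S (o |: W) ->
  (#|[set a | Q a & good a S]| * #|{: col}| =
   #|[set a | Q a]| * #|[set a | good a S]|)%N.
Proof.
move=> Qoff oW SW; rewrite -cardsT -!cardsX.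
pose swap (u : col * col) : col * col :=
  ([ffun x => if x \in W then u.2 x + (u.1 o - u.2 o) else u.1 x],
   [ffun x => if x \in W then u.1 x - (u.1 o - u.2 o) else u.2 x]).
have swapK : involutive swap.
  move=> [a b]; congr pair; apply/ffunP => x; rewrite !ffunE /= (negPf oW);
    case: (x \in W) => //=; [exact: subrK | exact: addrK].
have swapE u : (swap u \in setX [set a | Q a & good a S] setT) =
    (u \in setX [set a | Q a] [set a | good a S]).
  case: u => a b; rewrite !inE andbT; congr (_ && _).
    by apply: Qoff => x xW; rewrite ffunE (negPf xW).
  have sE x : x \in o |: W -> (swap (a, b)).1 x = b x + (a o - b o).
    rewrite !inE ffunE => /orP[/eqP ->|->] //.
    by rewrite (negPf oW) /= addrC subrK.
  apply/goodP/goodP => H l lS; have /andP[g1 g2] := SW _ lS.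
    by have := H l lS; rewrite !sE // => /addIr.
  by rewrite !sE // H.
have -> : setX [set a | Q a & good a S] setT =
    swap @: setX [set a | Q a] [set a | good a S].
  apply/setP => u; apply/idP/imsetP => [uE|[w wE ->]].
    by exists (swap u); [rewrite -swapE swapK | rewrite swapK].
  by rewrite swapE.
by rewrite card_imset //; exact: can_inj swapK.
Qed.

Definition frac (Q : pred col) : R := #|[set a | Q a]|%:R / #|{: col}|%:R.

Lemma card_col_neq0 : #|{: col}|%:R != 0 :> R.
Proof. by rewrite pnatr_eq0 -lt0n card_ffun expn_gt0 card_ord. Qed.

Lemma frac_ge0 Q : 0 <= frac Q.
Proof. by rewrite /frac divr_ge0. Qed.

Lemma frac_independent Q W o S : off W Q -> o \notin W -> within S (o |: W) ->
  frac (fun a => Q a && good a S) = frac Q * frac (good^~ S).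
Proof.
move=> Qoff oW SW; rewrite /frac.
have /(congr1 (fun x => x%:R : R)) := card_independent Qoff oW SW.
rewrite !natrM => H; have nz := card_col_neq0.
apply: (mulIf nz); rewrite divfK // -[LHS](mulfK nz) H.
by field.
Qed.

Lemma frac_le_determined (Q : pred col) U :
    (forall a b, Q a -> Q b -> (forall x, x \notin U -> a x = b x) -> a = b) ->
  frac Q <= (K%:R ^+ #|U|)^-1.
Proof.
move=> inj; pose r a : col := [ffun x => if x \in U then ord0 else a x].
have Uc : (#|U| + #|~: U| = #|V|)%N by rewrite cardsC.
have : (#|[set a | Q a]| <= K ^ #|~: U|)%N.
  rewrite -(card_in_imset (f := r)); last first.
    move=> a b; rewrite !inE => Qa Qb /ffunP E; apply: inj => // x xU.
    by have := E x; rewrite !ffunE (negPf xU).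
  have <- : #|pffun_on (ord0 : 'I_K) (mem (~: U)) predT| = (K ^ #|~: U|)%N.
    by rewrite card_pffun_on card_ord.
  apply: subset_leq_card; apply/subsetP => _ /imsetP[a _ ->].
  apply/pffun_onP; split=> //; apply/supportP => x; rewrite !inE negbK ffunE.
  by move=> ->.
rewrite -(ler_nat R) => H; rewrite /frac card_ffun card_ord -Uc expnD natrM invfM mulrCA natrX.
rewrite -[leRHS]mulr1 ler_wpM2l ?invr_ge0 ?exprn_ge0 //.
by rewrite ler_pdivrMr ?mul1r // ltr0n expn_gt0.
Qed.

Variables v1 v2 : V.

Definition pr S := frac (good^~ S).
Definition px S := frac (fun a => (a v1 == a v2) && good a S).

Lemma pr0 : pr set0 = 1.
Proof.
rewrite /pr /frac (_ : [set a | _] = setT) ?cardsT ?divff ?card_col_neq0 //.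
by apply/setP => a; rewrite !inE; apply/goodP => l; rewrite inE.
Qed.

Variable k : {set L} -> R.
Hypothesis k_conv : forall S,
  \sum_(S' : {set L} | S' \subset S) k S' * pr (S :\: S') = px S.

Lemma off_same W : v1 \notin W -> v2 \notin W -> off W (fun a => a v1 == a v2).
Proof. by move=> w1 w2 a b ab; rewrite !ab. Qed.

Lemma cumulant_eq0 S1 S2 W o : [disjoint S1 & S2]%B -> S2 != set0 ->
    v1 \notin W -> v2 \notin W -> o \notin W ->
    within S1 (~: W) -> within S2 (o |: W) ->
  k (S1 :|: S2) = 0.
Proof.
move=> + + w1 w2 oW.
move: {-1}(#|S1 :|: S2|) (leqnn #|S1 :|: S2|) => m.
elim: m S1 S2 => [|m IH] S1 S2 Sm dis S20 SW1 SW2.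
  move: Sm S20; rewrite leqn0 cards_eq0 setU_eq0 => /andP[_ /eqP ->].
  by rewrite eqxx.
have prU (T1 T2 : {set L}) : T1 \subset S1 -> T2 \subset S2 -> pr (T1 :|: T2) = pr T1 * pr T2.
  move=> T1S T2S; rewrite /pr -(@frac_independent (good^~ T1) W o T2) //.
  - by congr frac; apply/funext => a; rewrite goodU.
  - by apply: off_good => l lT; apply: SW1; exact: (subsetP T1S).
  - by move=> l lT; apply: SW2; exact: (subsetP T2S).
have pxU : px (S1 :|: S2) = px S1 * pr S2.
  rewrite /px /pr -(@frac_independent _ W o S2) //.
  - by congr frac; apply/funext => a; rewrite goodU andbA.
  - move=> a b ab; congr (_ && _); first exact: (off_same w1 w2).
    exact: (off_good SW1).
have := k_conv (S1 :|: S2); rewrite (bigD1 (S1 :|: S2)) //= setDv pr0 mulr1.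
rewrite pxU -(k_conv S1) mulr_suml.
suff -> : \sum_(S' : {set L} | (S' \subset S1 :|: S2) && (S' != S1 :|: S2))
    k S' * pr ((S1 :|: S2) :\: S') =
    \sum_(S' : {set L} | S' \subset S1) k S' * pr (S1 :\: S') * pr S2.
  by move=> /(canRL (addrK _)); rewrite subrr.
rewrite (bigID (fun S' : {set L} => S' \subset S1)) /= [X in _ + X]big1 ?addr0.
  apply: eq_big => [S'|S' /andP[_ S'1]].
    apply/andP/idP => [[]//|S'1]; split=> //; rewrite (subset_trans S'1) ?subsetUl //=.
    apply: contraNN S20 => /eqP E; rewrite -subset0; apply/subsetP => l lS2.
    have : l \in S' by rewrite E inE lS2 orbT.
    by move/(subsetP S'1) => lS1; rewrite (disjointFr dis lS1) in lS2.
  rewrite -mulrA -prU ?subsetDl //; congr (_ * pr _).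
  rewrite setDUl; congr (_ :|: _); apply/setDidPl.
  rewrite disjoint_sym; exact: disjointWl dis.
move=> S' /andP[/andP[S'S S'n] S'1].
have E : S' = (S' :&: S1) :|: (S' :&: S2) by rewrite -setIUr; apply/esym/setIidPl.
suff -> : k S' = 0 by rewrite mul0r.
rewrite E; apply: IH.
- rewrite -E -ltnS (leq_trans _ Sm) //; apply: proper_card.
  by rewrite properEneq S'n.
- apply: disjointWl (subsetIr _ _) _; apply: disjointWr (subsetIr _ _) dis.
- apply: contraNN S'1 => /eqP S'2; rewrite E S'2 setU0; exact: subsetIr.
- by move=> l; rewrite inE => /andP[_]; exact: SW1.
- by move=> l; rewrite inE => /andP[_]; exact: SW2.
Qed.

Definition deg S x : nat := (\sum_(l in S) (((g l).1 == x) + ((g l).2 == x)))%N.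

Lemma cumulant_loop S l : k S != 0 -> l \in S -> (g l).1 != (g l).2.
Proof.
move=> kS lS; apply: contraNN kS => /eqP gl.
rewrite -(setD1K lS) setUC; apply/eqP; apply: (@cumulant_eq0 _ _ set0 (g l).1).
- by rewrite disjoint_sym disjoints1 !inE eqxx.
- by apply/set0Pn; exists l; rewrite inE.
- by rewrite inE.
- by rewrite inE.
- by rewrite inE.
- by move=> l' _; rewrite !inE.
- by move=> l'; rewrite inE => /eqP ->; rewrite !inE -gl eqxx.
Qed.

(** Otherwise the edges inside [U] would form a separate piece avoiding [v1] and [v2]; any vertex
    outside [U], such as [v1], then serves as the cut vertex. *)
Lemma cumulant_cross S U l0 : k S != 0 -> v1 \notin U -> v2 \notin U -> l0 \in S ->
    ((g l0).1 \in U) || ((g l0).2 \in U) ->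
  exists2 l, l \in S & ((g l).1 \in U) != ((g l).2 \in U).
Proof.
move=> kS U1 U2 l0S l0U.
have [/exists_inP[l lS lU]|/exists_inPn no] :=
  boolP [exists l in S, ((g l).1 \in U) != ((g l).2 \in U)]; first by exists l.
have same l : l \in S -> ((g l).1 \in U) = ((g l).2 \in U).
  by move=> /no; rewrite negbK => /eqP.
case/eqP: kS.
have -> : S = [set l in S | (g l).1 \notin U] :|: [set l in S | (g l).1 \in U].
  by apply/setP => l; rewrite !inE -andb_orr orNb andbT.
apply: (@cumulant_eq0 _ _ U v1) => //.
- rewrite disjoints_subset; apply/subsetP => l; rewrite !inE => /andP[-> ->] //.
- apply/set0Pn; exists l0; rewrite inE l0S /=.
  by move: l0U; rewrite (same _ l0S) orbb.
- by move=> l; rewrite !inE => /andP[lS lU]; rewrite -(same _ lS) lU.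
- by move=> l; rewrite !inE => /andP[lS lU]; rewrite -(same _ lS) lU !orbT.
Qed.

Lemma deg_gt0P S x : reflect (exists2 l, l \in S & ((g l).1 == x) || ((g l).2 == x))
  (0 < deg S x)%N.
Proof.
rewrite lt0n sum_nat_eq0 negb_forall_in; apply: (iffP exists_inP) => -[l lS H];
  exists l => //; by case: (_ == x) H; case: (_ == x).
Qed.

(** If no edge met [x], the other of [v1] and [v2] would cut off the whole graph: the case
    [S1 = set0], with all inner vertices in [W]. *)
Lemma cumulant_deg_end S x : k S != 0 -> S != set0 -> (x == v1) || (x == v2) ->
  (0 < deg S x)%N.
Proof.
move=> kS S0 xv; rewrite lt0n; apply: contraNN kS => /eqP dx.
have noinc l : l \in S -> ((g l).1 != x) && ((g l).2 != x).
  move=> lS; rewrite -negb_or; apply/negP => H.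
  by have : (0 < deg S x)%N; [apply/deg_gt0P; exists l | rewrite dx].
rewrite -[S]set0U; apply/eqP.
pose o := if x == v1 then v2 else v1.
apply: (@cumulant_eq0 _ _ (~: [set v1; v2]) o) => //.
- by rewrite -setI_eq0 set0I.
- by rewrite !inE eqxx.
- by rewrite !inE eqxx orbT.
- by rewrite /o !inE; case: ifP; rewrite eqxx ?orbT.
- by move=> l; rewrite inE.
move=> l /noinc /andP[]; move: xv; rewrite !inE /o.
have [->|_] /= := eqVneq x v1; last move=> /eqP ->.
  by move=> _ /negPf -> /negPf ->; rewrite !orbN.
by move=> /negPf -> /negPf ->; rewrite !orbF !orbN.
Qed.


Definition inc l x := ((g l).1 == x) || ((g l).2 == x).

Lemma deg_sub S' S x : S' \subset S -> (deg S' x <= deg S x)%N.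
Proof.
move=> S'S; rewrite /deg [leqRHS](big_setID S') /= (setIidPr S'S); exact: leq_addr.
Qed.

Lemma deg_ltn S' S l x : S' \subset S -> l \in S -> l \notin S' -> inc l x ->
  (deg S' x < deg S x)%N.
Proof.
move=> S'S lS lS' lx; apply: (@leq_trans (deg (l |: S') x)); last first.
  by apply: deg_sub; apply/subsetP => y; rewrite !inE => /orP[/eqP ->|/(subsetP S'S)].
rewrite /deg big_setU1 //= -[X in (X < _)%N]add0n ltn_add2r.
by case/orP: lx => ->; rewrite ?addn1.
Qed.

(** A pendant edge is cut off by the neighbour of its leaf: [W] is the leaf and [o] the other
    end. *)
Lemma cumulant_deg_neq1 S x : k S != 0 -> x != v1 -> x != v2 -> deg S x != 1%N.
Proof.
move=> kS x1 x2; apply/eqP => dx.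
have [l lS lx] : exists2 l, l \in S & inc l x by apply/deg_gt0P; rewrite dx.
have only l' : l' \in S -> l' != l -> ~~ inc l' x.
  move=> l'S l'l; apply/negP => l'x.
  have := @deg_ltn (S :\ l) S l x (subsetDl _ _) lS _ lx.
  rewrite dx !inE eqxx => /(_ isT); apply/negP; rewrite -leqNgt.
  by apply/deg_gt0P; exists l'; rewrite // !inE l'l.
have nl := cumulant_loop kS lS.
move: kS; apply/negP; rewrite negbK.
rewrite -(setD1K lS) setUC; apply/eqP.
apply: (@cumulant_eq0 _ _ [set x] (if (g l).1 == x then (g l).2 else (g l).1)).
- by rewrite disjoint_sym disjoints1 !inE eqxx.
- by apply/set0Pn; exists l; rewrite inE.
- by rewrite inE eq_sym.
- by rewrite inE eq_sym.
- by rewrite inE; case: ifPn => // /eqP <-; rewrite eq_sym.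
- move=> l'; rewrite !inE => /andP[l'l l'S].
  by have := only _ l'S l'l; rewrite negb_or.
- move=> l'; rewrite inE => /eqP ->; rewrite !inE; move: lx; rewrite /inc.
  by case: ifP => _ /= => [_|->]; rewrite ?eqxx ?orbT.
Qed.

Definition vset S := [set v1; v2] :|: [set x | (0 < deg S x)%N].

Lemma vset_sub S' S : S' \subset S -> vset S' \subset vset S.
Proof.
move=> S'S; apply: setUS; apply/subsetP => x; rewrite !inE => /leq_trans; apply.
exact: deg_sub.
Qed.

Lemma vset_ends S l : l \in S -> ((g l).1 \in vset S) && ((g l).2 \in vset S).
Proof.
move=> lS; rewrite !inE; apply/andP; split; apply/orP; right.
  by apply/deg_gt0P; exists l; rewrite // eqxx.
by apply/deg_gt0P; exists l; rewrite // eqxx orbT.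
Qed.

Lemma card_vset_gt0 S : (0 < #|vset S|)%N.
Proof. by apply/card_gt0P; exists v1; rewrite !inE eqxx. Qed.

(** The set where [a] and [b] disagree avoids [v1], [v2] and the vertices of [S'], and no edge
    leaves it: edges of [S'] lie outside it and the others are monochromatic for both colourings.
    Hence [cumulant_cross] forces it to be empty. *)
Lemma agree_from S S' a b : k S != 0 -> S' \subset S ->
    good a (S :\: S') -> good b (S :\: S') ->
    (forall x, x \in vset S' -> a x = b x) ->
    (forall x, x \notin vset S -> a x = b x) -> a = b.
Proof.
move=> kS S'S /goodP ga /goodP gb ab' ab.
apply/ffunP => x0; apply/eqP; apply/negPn/negP => x0D.
pose D := [set x | a x != b x].
have DvS' x : x \in D -> x \notin vset S'.
  by rewrite inE; apply: contraNN => /ab' ->.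
have x0v : x0 \in vset S by apply: contraNT x0D => /ab ->.
have D1 : v1 \notin D by apply/negP => /DvS'; rewrite !inE eqxx.
have D2 : v2 \notin D by apply/negP => /DvS'; rewrite !inE eqxx orbT.
have [l0 l0S l0x] : exists2 l, l \in S & inc l x0.
  have x0n : x0 \notin vset S' by apply: DvS'; rewrite inE.
  apply/deg_gt0P; move: x0v x0n; rewrite !inE negb_or => /orP[->//|dx _].
  exact: dx.
have [|l lS /negP] := cumulant_cross kS D1 D2 l0S.
  by case/orP: l0x => /eqP ->; rewrite [x0 \in D]inE x0D ?orbT.
apply.
have [lS'|lS'] := boolP (l \in S').
  have /andP[e1 e2] := vset_ends lS'.
  have N1 : (g l).1 \notin D by apply/negP => /DvS'; rewrite e1.
  have N2 : (g l).2 \notin D by apply/negP => /DvS'; rewrite e2.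
  by rewrite (negPf N1) (negPf N2).
have lD : l \in S :\: S' by rewrite inE lS' lS.
by rewrite !inE (ga _ lD) (gb _ lD) eqxx.
Qed.

Lemma pr_diff_le S S' : k S != 0 -> S' \subset S ->
  pr (S :\: S') <= (K%:R ^+ (#|vset S| - #|vset S'|))^-1.
Proof.
move=> kS S'S; have -> : (#|vset S| - #|vset S'|)%N = #|vset S :\: vset S'|.
  by rewrite cardsD (setIidPr (vset_sub S'S)).
apply: frac_le_determined => a b ga gb ab.
apply: (@agree_from S S') => // x xv; apply: ab; rewrite inE.
  by rewrite xv.
by rewrite (negPf xv) andbF.
Qed.

Lemma px_le S : k S != 0 -> px S <= (K%:R ^+ #|vset S|.-1)^-1.
Proof.
move=> kS; have -> : #|vset S|.-1 = #|vset S :\ v1|.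
  by rewrite [in LHS](cardsD1 v1) !inE eqxx.
apply: frac_le_determined => a b /andP[/eqP xa ga] /andP[/eqP xb gb] ab.
have ab1 : a v1 = b v1 by apply: ab; rewrite !inE eqxx.
apply: (@agree_from S set0) => //; rewrite ?sub0set ?setD0 // => x.
  rewrite !inE /deg big_set0 orbF => /orP[]/eqP -> //.
  by rewrite -xa -xb.
by move=> xv; apply: ab; rewrite inE (negPf xv) andbF.
Qed.

Definition big S x := [|| x == v1, x == v2 | (2 < deg S x)%N].

Definition ebig S := [set l in S | big S (g l).1 || big S (g l).2].

Lemma ebig_sub S' S : S' \subset S -> ebig S' \subset S' :&: ebig S.
Proof.
move=> S'S; apply/subsetP => l; rewrite !inE => /andP[lS' H].
rewrite lS' (subsetP S'S _ lS') /=.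
have bS x : big S' x -> big S x.
  rewrite /big => /or3P[->|->|h]; rewrite ?orbT //.
  by rewrite (leq_trans h (deg_sub _ S'S)) !orbT.
by case/orP: H => /bS ->; rewrite ?orbT.
Qed.

(* Every endpoint of an edge of [S' :\: S''] has degree at most 2 in [S]; an
   edge of [S'] leaving that set of endpoints would be a leaf of [S'']. *)
Lemma ebig_determines S S' S'' : k S' != 0 -> k S'' != 0 ->
    S' \subset S -> S'' \subset S ->
    S' :&: ebig S = S'' :&: ebig S -> S' \subset S''.
Proof.
move=> k1 k2 s1 s2 E; apply/negPn/negP => /subsetPn[l0 l0S' l0S''].
pose U := [set x | [exists l in S' :\: S'', inc l x]].
have Usmall x : x \in U -> ~~ big S x.
  rewrite inE => /exists_inP[l]; rewrite inE => /andP[lS'' lS'] lx.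
  apply: contraNN lS'' => bx.
  suff : l \in S'' :&: ebig S by rewrite inE => /andP[].
  rewrite -E !inE lS' (subsetP s1 _ lS') /=.
  by case/orP: lx => /eqP ->; rewrite bx ?orbT.
have U1 : v1 \notin U by apply/negP => /Usmall; rewrite /big eqxx.
have U2 : v2 \notin U by apply/negP => /Usmall; rewrite /big eqxx orbT.
have endsU l : l \in S' :\: S'' -> ((g l).1 \in U) && ((g l).2 \in U).
  move=> lD; rewrite !inE; apply/andP; split; apply/exists_inP; exists l => //;
    by rewrite /inc eqxx ?orbT.
have l0D : l0 \in S' :\: S'' by rewrite inE l0S''.
have [|l lS' lU] := cumulant_cross k1 U1 U2 l0S'.
  by have /andP[->] := endsU _ l0D.
have lS'' : l \in S''.
  apply: contraNT lU => lS''; have lD : l \in S' :\: S'' by rewrite inE lS''.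
  by have /andP[-> ->] := endsU _ lD.
have [x xU lx] : exists2 x, x \in U & inc l x.
  case: (boolP ((g l).1 \in U)) lU => [u1 _|_ /=].
    by exists (g l).1 => //; rewrite /inc eqxx.
  by rewrite negbK => u2; exists (g l).2 => //; rewrite /inc eqxx orbT.
have := Usmall _ xU; rewrite /big !negb_or -leqNgt => /and3P[x1 x2 dx].
have := xU; rewrite inE => /exists_inP[l']; rewrite inE => /andP[l'S'' l'S'] l'x.
have dx'' : (0 < deg S'' x)%N by apply/deg_gt0P; exists l.
have := leq_trans (deg_ltn s2 (subsetP s1 _ l'S') l'S'' l'x) dx.
rewrite ltnS => d1; move/eqP: (cumulant_deg_neq1 k2 x1 x2); apply.
by apply/eqP; rewrite eqn_leq d1.
Qed.

Lemma sum_subsets (E : {set L}) (B : R) :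
  \sum_(T : {set L} | T \subset E) B ^+ #|T| = (1 + B) ^+ #|E|.
Proof.
have -> : (1 + B) ^+ #|E| = \prod_l ((if l \in E then B else 0) + 1).
  rewrite -prodr_const [RHS](bigID (mem E)) /= [X in _ = _ * X]big1 ?mulr1.
    by apply: eq_bigr => l ->; rewrite addrC.
  by move=> l /negPf ->; rewrite add0r.
rewrite bigA_distr /= [LHS]big_mkcond /=; apply: eq_bigr => T _.
rewrite -big_mkcond /=; case: ifPn => [TE|/subsetPn[l lT lE]].
  rewrite -prodr_const; apply: eq_bigr => l lT.
  by rewrite (subsetP TE _ lT).
by rewrite (bigD1 l) //= (negPf lE) mul0r.
Qed.

(** Closes the induction of [cumulant_le]: the 1 stands for [px S] and the difference for the proper
    subsets of [ebig S]. *)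
Lemma subset_sum_le (m : nat) (B : R) : (0 < m)%N -> (m.*2)%:R <= B ->
  1 + ((1 + B) ^+ m - B ^+ m) <= B ^+ m.
Proof.
move=> m0 mB.
have B0 : 0 <= B by apply: le_trans mB; rewrite ler0n.
(* Bernoulli's inequality [(B / (1 + B)) ^+ i >= 1 - i / (1 + B)] with denominators cleared. *)
have H i : (1 + B) ^+ i * (1 + B - i%:R) <= (1 + B) * B ^+ i.
  elim: i => [|i IH]; first by rewrite !expr0 subr0 mul1r mulr1.
  have := ler_wpM2r B0 IH; rewrite -[leRHS]mulrA -exprSr; apply: le_trans.
  rewrite exprSr -2!mulrA ler_wpM2l ?exprn_ge0 ?addr_ge0 //.
  rewrite -natr1; have : 0 <= i%:R :> R by []. 
  by nra.
have m2 : m%:R * 2 <= B by rewrite -natrM muln2.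
case: m m0 mB m2 => // m _ _ m2.
have := H m.+1; have := @exprn_ege1 R m (1 + B); rewrite lerDl B0 => /(_ isT).
rewrite !(exprS (1 + B) m); set q := (1 + B) ^+ m; set r := B ^+ m.+1 => q1 Hm.
have : (1 + B) * (q * (1 + B - m.+1%:R)) <= (1 + B) * r by rewrite mulrA.
rewrite ler_pM2l; last by rewrite ltr_pwDl.
move=> h; nra.
Qed.

(** In the recursion for [k S], the powers of [K] from [k S'] and [pr (S :\: S')] combine to the
    same power for every [S']. Intersection with [ebig S] injects the proper subsets [S'] with
    [k S' != 0] into the proper subsets of [ebig S], so the cost in [B] grows with [ebig S] only and
    not with [S]. *)
Lemma cumulant_le (B : R) S : (#|S|.*2)%:R <= B ->
  `|k S| <= (K%:R ^+ #|vset S|.-1)^-1 * B ^+ #|ebig S|.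
Proof.
have [m] := ubnP #|S|; elim: m S => // m IH S; rewrite ltnS => Sm SB.
have [->|Sn0] := eqVneq S set0.
  have : \sum_(S' : {set L} | S' \subset set0) k S' * pr (set0 :\: S') = px set0 by [].
  rewrite (big_pred1 set0) => [|S']; last by rewrite subset0.
  rewrite set0D pr0 mulr1 => k0.
  have -> : ebig set0 = set0 by apply/setP => l; rewrite !inE.
  rewrite cards0 expr0 mulr1 k0 ger0_norm ?frac_ge0 //.
  have [/eqP kz|kz] := boolP (k set0 == 0); last exact: px_le.
  by rewrite -k0 kz invr_ge0 exprn_ge0.
have B0 : 0 <= B by apply: le_trans SB; rewrite ler0n.
have [->|kS] := eqVneq (k S) 0; first by rewrite normr0 mulr_ge0 ?invr_ge0 ?exprn_ge0.
have kE : k S = px S - \sum_(S' : {set L} | (S' \subset S) && (S' != S)) k S' * pr (S :\: S').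
  by rewrite -k_conv (bigD1 S) //= setDv pr0 mulr1 addrK.
have E0 : (0 < #|ebig S|)%N.
  have /deg_gt0P[l lS lx] := @cumulant_deg_end S v1 kS Sn0 (introT orP (or_introl (eqxx _))).
  apply/card_gt0P; exists l; rewrite inE lS /big.
  by case/orP: lx => ->; rewrite ?orbT.
have ES : (#|ebig S| <= #|S|)%N by apply: subset_leq_card; apply/subsetP => l; rewrite inE => /andP[].
have EB : (#|ebig S|.*2)%:R <= B by apply: le_trans SB; rewrite ler_nat leq_double.
have B1 : 1 <= B by apply: le_trans EB; rewrite ler1n double_gt0.
have Kinv j : 0 <= (K%:R ^+ j)^-1 :> R by rewrite invr_ge0 exprn_ge0.
apply: (@le_trans _ _ ((K%:R ^+ #|vset S|.-1)^-1 *
    (1 + ((1 + B) ^+ #|ebig S| - B ^+ #|ebig S|)))); last first.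
  by rewrite ler_wpM2l // subset_sum_le.
rewrite mulrDr mulr1 kE; apply: (le_trans (ler_normB _ _)).
rewrite ger0_norm ?frac_ge0 // lerD ?px_le //.
apply: (le_trans (ler_norm_sum _ _ _)).
pose F := [set S' : {set L} | (S' \subset S) && (S' != S) & k S' != 0].
apply: (@le_trans _ _ (\sum_(S' in F) (K%:R ^+ #|vset S|.-1)^-1 * B ^+ #|S' :&: ebig S|)).
  rewrite (bigID (fun S' => k S' == 0)) /= big1 ?add0r; last first.
    by move=> S' /andP[_ /eqP ->]; rewrite mul0r normr0.
  rewrite [leRHS](eq_bigl (fun S' => ((S' \subset S) && (S' != S)) && (k S' != 0))); last first.
    by move=> S'; rewrite inE.
  apply: ler_sum => S' /andP[/andP[S'S S'n] kS'].
  rewrite normrM (ger0_norm (frac_ge0 _)).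
  have S'lt : (#|S'| < #|S|)%N by apply: proper_card; rewrite properEneq S'n.
  have S'B : (#|S'|.*2)%:R <= B by apply: le_trans SB; rewrite ler_nat leq_double ltnW.
  have := IH S' (leq_trans S'lt Sm) S'B.
  move/ler_pM/(_ (pr_diff_le kS S'S)) => /(_ (normr_ge0 _) (frac_ge0 _)) /le_trans; apply.
  rewrite mulrAC -invfM -exprD.
  have -> : (#|vset S'|.-1 + (#|vset S| - #|vset S'|) = #|vset S|.-1)%N.
    have arith i j : (0 < i)%N -> (i <= j)%N -> (i.-1 + (j - i) = j.-1)%N.
      by clear; lia.
    by apply: arith; [exact: card_vset_gt0 | exact/subset_leq_card/vset_sub].
  rewrite ler_wpM2l // ler_weXn2l //.
  by apply: subset_leq_card; exact: ebig_sub.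
rewrite -mulr_sumr ler_wpM2l //.
have inj : {in F &, injective (fun S' : {set L} => S' :&: ebig S)}.
  move=> S1 S2; rewrite !inE => /andP[/andP[s1 _] k1] /andP[/andP[s2 _] k2] E.
  apply/eqP; rewrite eqEsubset; apply/andP.
  by split; apply: (@ebig_determines S).
rewrite -(big_imset (fun T : {set L} => B ^+ #|T|) inj) /= -(sum_subsets (ebig S) B).
rewrite [leRHS](_ : _ = \sum_(T : {set L} | (T \subset ebig S) && (T != ebig S)) B ^+ #|T|).
  2: by rewrite (bigD1 (ebig S)) //= addrAC subrr add0r.
rewrite [leLHS]big_mkcond [leRHS]big_mkcond; apply: ler_sum => T _.
case: ifP => [/imsetP[S']|_]; last by case: ifP => // _; rewrite exprn_ge0.
rewrite inE => /andP[/andP[s1 sn] k1] ->.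
rewrite subsetIr /=; case: ifPn => //; rewrite negbK => /eqP E.
(* If the trace of [S'] were all of [ebig S], then [S] and [S'] would have the same trace and hence
   be equal. *)
case/eqP: sn; apply/eqP; rewrite eqEsubset s1 /=.
apply: (@ebig_determines S) => //; rewrite E; apply/setIidPr.
by apply/subsetP => l; rewrite inE => /andP[].
Qed.

End Coloring.

(** * Counting words by degrees *)

Section WordCount.
Variables (R : realType) (V : finType).
Implicit Types (om : V -> nat -> R) (p : V -> {poly R}).

Lemma deriv_bigprod (s : seq V) p : uniq s ->
  (\prod_(i <- s) p i)^`() = \sum_(j <- s) (p j)^`() * \prod_(i <- s | i != j) p i.
Proof.
elim: s => [|a s IH] /=; first by rewrite !big_nil derivC.
move=> /andP[as_ us]; rewrite !big_cons derivM IH // eqxx /=; congr (_ + _).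
  congr (_ * _); rewrite big_seq_cond [RHS]big_seq_cond; apply: eq_bigl => i.
  by rewrite andbT; case: (boolP (i \in s)) => //= si; apply/esym; apply: contraNneq as_ => <-.
rewrite mulr_sumr big_seq [RHS]big_seq; apply: eq_bigr => j js.
by rewrite big_cons ifT 1?mulrCA //; apply: contraNneq as_ => ->.
Qed.

(** Here [p i] is the exponential generating series of the weights of letter [i]; choosing the first
    letter of a word corresponds to differentiating the product. *)
Lemma words_coef r om p :
    (forall i d, (d <= r)%N -> (p i)`_d = om i d / d`!%:R) ->
  \sum_(e <- words V r) \prod_i om i (count_mem i e) = r`!%:R * (\prod_i p i)`_r.
Proof.
elim: r om p => [|r IH] om p pE.
  rewrite big_words0 mul1r coef0_prod; apply: eq_bigr => i _.
  by rewrite pE // divr1.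
rewrite big_wordsS factS mulnC natrM -mulrA [X in _ * X]mulr_natl -coef_deriv.
have -> : (\prod_i p i)^`() = \sum_j (p j)^`() * \prod_(i | i != j) p i.
  rewrite -[in LHS]big_enum deriv_bigprod ?enum_uniq // big_enum.
  by apply: eq_bigr => j _; rewrite big_enum_cond.
rewrite coef_sum mulr_sumr; apply: eq_bigr => j _ /=.
(* Removing a first letter [j] shifts the weights of [j] by one, as differentiation does to its
   series. *)
pose om' i d := if i == j then om j d.+1 else om i d.
pose p' i := if i == j then (p j)^`() else p i.
have -> : (p j)^`() * \prod_(i | i != j) p i = \prod_i p' i.
  rewrite [RHS](bigD1 j) //= {1}/p' eqxx; congr (_ * _).
  by apply: eq_bigr => i /negPf ij; rewrite /p' ij.
rewrite -(IH om').
  apply: eq_bigr => e _; apply: eq_bigr => i _; rewrite /om' /= eq_sym.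
  by case: eqP => [->|_]; rewrite ?add1n ?add0n.
move=> i d dr; rewrite /p' /om'; case: eqP => _; last by rewrite pE // ltnW.
rewrite coef_deriv pE // factS natrM invfM -[LHS]mulr_natr -mulrA [X in _ * X]mulrAC.
by rewrite mulVf ?pnatr_eq0 // mul1r.
Qed.

(* Evaluating a power series with nonnegative coefficients at [y] bounds each
   of its coefficients. *)
Lemma words_sum_le r om (y : R) : 0 < y -> (forall i d, 0 <= om i d) ->
  \sum_(e <- words V r) \prod_i om i (count_mem i e) <=
  r`!%:R / y ^+ r * \prod_i (\sum_(d < r.+1) om i d / d`!%:R * y ^+ d).
Proof.
move=> y0 om0; pose p i := \poly_(d < r.+1) (om i d / d`!%:R).
have p0 i d : 0 <= (p i)`_d.
  by rewrite coef_poly; case: ifP => // _; rewrite divr_ge0.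
rewrite (@words_coef r om p) => [|i d dr]; last by rewrite coef_poly ltnS dr.
rewrite -mulrA ler_wpM2l // mulrC ler_pdivlMr ?exprn_gt0 //.
have -> : \prod_i (\sum_(d < r.+1) om i d / d`!%:R * y ^+ d) = (\prod_i p i).[y].
  by rewrite horner_prod; apply: eq_bigr => i _; rewrite horner_poly.
have P0 d : 0 <= (\prod_i p i)`_d.
  elim/big_ind: _ d => [d|q1 q2 h1 h2 d|i _ d]; [by rewrite coef1 ler0n | | exact: p0].
  by rewrite coefM; apply: sumr_ge0 => j _; rewrite mulr_ge0.
set q := \prod_i p i in P0 *.
rewrite horner_coef; have [rq|rq] := ltnP r (size q); last first.
  by rewrite nth_default // mul0r; apply: sumr_ge0 => d _; rewrite mulr_ge0 // exprn_ge0 // ltW.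
rewrite (bigD1 (Ordinal rq)) //= lerDl; apply: sumr_ge0 => d _.
by rewrite mulr_ge0 // exprn_ge0 // ltW.
Qed.

End WordCount.

(** * Elementary estimates on factorials and exponentials *)

Section Numeric.
Variable R : realType.
Local Notation e := (expR 1 : R).

Lemma expR1_le4 : e <= 4.
Proof.
have h : expR (2^-1 : R) <= 2.
  have := expR_ge1Dx (- 2^-1 : R); rewrite expRN.
  have := expR_gt0 (2^-1 : R); set x := expR _ => x0 h.
  have : (1 - 2^-1) * x <= 1 by rewrite -ler_pdivlMr // div1r.
  lra.
have -> : (1 : R) = 2^-1 + 2^-1 by field.
rewrite expRD; have := expR_gt0 (2^-1 : R); nra.
Qed.

Lemma fact_double_le s : ((s.*2)`! <= 4 ^ s * (s`! ^ 2))%N.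
Proof.
elim: s => // s IH; rewrite doubleS !factS expnS.
have -> : (4 * 4 ^ s * ((s.+1 * s`!) ^ 2) = (s.*2.+2 * s.*2.+2) * (4 ^ s * s`! ^ 2))%N.
  by rewrite -muln2; ring.
rewrite mulnA leq_mul // leq_mul2l; lia.
Qed.

(** Stirling's upper bound, up to a factor of order sqrt(s); the inductive step is
    [(1 - 1 / (s+2)) ^ (s+2) <= exp (-1)]. *)
Lemma fact_exp_le s : (0 < s)%N -> s`!%:R * e ^+ s <= e * s%:R ^+ s.+1.
Proof.
have e0 : 0 < e := expR_gt0 _.
case: s => // s _; elim: s => [|s IH]; first by rewrite mul1r expr1 expr1n mulr1.
have step : e * s.+1%:R ^+ s.+2 <= s.+2%:R ^+ s.+2.
  have h : s.+1%:R / s.+2%:R <= expR (- s.+2%:R^-1) :> R.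
    apply: le_trans (expR_ge1Dx _); rewrite -[s.+2%:R]natr1.
    have : s.+1%:R + 1 != 0 :> R by rewrite natr1 pnatr_eq0.
    by move=> nz; rewrite le_eqVlt; apply/orP; left; apply/eqP; field.
  have : (s.+1%:R / s.+2%:R) ^+ s.+2 <= expR (- s.+2%:R^-1) ^+ s.+2 :> R.
    by rewrite lerXn2r // nnegrE ?divr_ge0 // expR_ge0.
  rewrite -expRM_natl mulrN mulfV ?pnatr_eq0 // expRN expr_div_n ler_pdivrMr ?exprn_gt0 //.
  by rewrite mulrC ler_pdivlMr // mulrC.
rewrite factS natrM exprSr.
have : s.+2%:R * e * (s.+1`!%:R * e ^+ s.+1) <= s.+2%:R * e * (e * s.+1%:R ^+ s.+2).
  by rewrite ler_wpM2l // mulr_ge0 // ltW.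
rewrite (_ : s.+2%:R * s.+1`!%:R * (e ^+ s.+1 * e) =
  s.+2%:R * e * (s.+1`!%:R * e ^+ s.+1)); last by ring.
move=> /le_trans; apply.
by rewrite (exprS _ s.+2) [leRHS]mulrA (mulrC e s.+2%:R) ler_wpM2l.
Qed.

Lemma exp_tail_le (z : R) m r : 0 <= z <= 1 ->
  \sum_(d < r) (if (m < d)%N then z ^+ d / d`!%:R else 0) <= 2 * z ^+ m.+1 / 2 ^+ m.
Proof.
move=> /andP[z0 z1].
have F d : (2 ^ d.-1 <= d`!)%N.
  elim: d => // -[|d] //= IH; rewrite factS expnS leq_mul //.
apply: (@le_trans _ _ (\sum_(d < r) (if (m < d)%N then z ^+ m.+1 * 2 / 2 ^+ d else 0))).
  apply: ler_sum => d _; case: ifP => // md.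
  rewrite -mulrA; apply: ler_pM.
  - exact: exprn_ge0.
  - by rewrite invr_ge0.
  - by rewrite ler_wiXn2l.
  have d0 : (0 < d)%N by apply: leq_trans md.
  rewrite -[X in 2 / 2 ^+ X](prednK d0) exprS invfM mulVKf ?pnatr_eq0 //.
  rewrite lef_pV2 ?posrE ?exprn_gt0 ?ltr0n ?fact_gt0 //.
  by rewrite -natrX ler_nat.
(* The telescoped geometric tail; [maxn] makes the right-hand side 0 as long as the sum is empty. *)
suff H : \sum_(d < r) (if (m < d)%N then z ^+ m.+1 * 2 / 2 ^+ d else 0) <=
    z ^+ m.+1 * 2 * ((2 ^+ m)^-1 - (2 ^+ maxn m r.-1)^-1).
  apply: le_trans H _; rewrite (mulrC 2) ler_wpM2l ?mulr_ge0 ?exprn_ge0 //.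
  by rewrite gerBl invr_ge0 exprn_ge0.
elim: r => [|r IH]; first by rewrite big_ord0 maxn0 subrr mulr0.
rewrite big_ord_recr /=; case: ltnP => mr; last first.
  rewrite addr0; apply: le_trans IH _; rewrite (_ : maxn m r.-1 = m) //.
  by apply/maxn_idPl; lia.
apply: le_trans (lerD IH (lexx _)) _.
case: r mr {IH} => // r mr /=.
rewrite (_ : maxn m r = r); last by apply/maxn_idPr; lia.
rewrite -mulrDr ler_wpM2l ?mulr_ge0 ?exprn_ge0 // exprS invfM.
set x := (2 ^+ r)^-1; set w := (2 ^+ m)^-1; lra.
Qed.

End Numeric.

Section Weights.
Variables (R : realType) (V : finType) (v1 v2 : V) (v12 : v1 != v2).
Variables (c B : R) (c0 : 0 <= c).

(* The factor of [kappa e ^+ 2] attributed to a vertex [x] of degree [d]; [c] is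
   [K^-2] and [B] bounds the number of half-edges. *)
Definition weight (x : V) (d : nat) : R :=
  if (x == v1) || (x == v2) then (if d == 0 then 0 else c * B ^+ d.*2)
  else match d with
       | 0 => 1 | 1 => 0 | 2 => c | _ => c * B ^+ d.*2
       end.

Hypothesis B0 : 0 <= B.

Lemma weight_ge0 x d : 0 <= weight x d.
Proof.
have cB k : 0 <= c * B ^+ k by rewrite mulr_ge0 // exprn_ge0.
by rewrite /weight; case: ifP => _; [case: ifP | case: d => [|[|[|d]]]].
Qed.

Variable y : R.
Hypothesis y0 : 0 < y.
Local Notation z := (B ^+ 2 * y).
Hypothesis z1 : z <= 1.

Let z01 : 0 <= z <= 1.
Proof. by rewrite z1 mulr_ge0 ?exprn_ge0 // ltW. Qed.

Let zE d : c * B ^+ d.*2 / d`!%:R * y ^+ d = c * (z ^+ d / d`!%:R).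
Proof. by rewrite exprMn -exprM mul2n; ring. Qed.

Lemma weight_gf_end x r : (x == v1) || (x == v2) ->
  \sum_(d < r) weight x d / d`!%:R * y ^+ d <= c * (2 * z).
Proof.
move=> xe; apply: (@le_trans _ _ (c * \sum_(d < r) (if (0 < d)%N then z ^+ d / d`!%:R else 0))).
  rewrite mulr_sumr; apply: ler_sum => d _; rewrite /weight xe lt0n.
  by case: eqP => _ /=; [rewrite mul0r mul0r mulr0 | rewrite zE].
by rewrite ler_wpM2l //; apply: le_trans (exp_tail_le _ _ z01) _; rewrite expr1 divr1.
Qed.

(** Degree 0 gives 1, degree 1 is excluded, and degree 2, the dominant case, carries no power of
    [B]; all degrees from 3 on are absorbed in [z ^+ 3]. *)
Lemma weight_gf_inner x r : ~~ ((x == v1) || (x == v2)) ->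
  \sum_(d < r) weight x d / d`!%:R * y ^+ d <= 1 + c * (y ^+ 2 / 2 + z ^+ 3).
Proof.
move=> xe.
have z0 : 0 <= z by case/andP: z01.
have one k (a : R) : 0 <= a -> \sum_(d < r) (if val d == k then a else 0) <= a.
  move=> a0; rewrite -big_mkcond /=; case: (ltnP k r) => kr.
    by rewrite (big_pred1 (Ordinal kr)).
  by rewrite big_pred0 // => d; apply/negP => /eqP dk; rewrite -dk leqNgt ltn_ord in kr.
apply: (@le_trans _ _ (\sum_(d < r) ((if val d == 0 then 1 else 0) +
   (if val d == 2 then c * (y ^+ 2 / 2) else 0) +
   c * (if (2 < d)%N then z ^+ d / d`!%:R else 0)))).
  apply: ler_sum => -[[|[|[|d]]] dr] _ //=; rewrite /weight (negPf xe) ?add0r ?addr0.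
  - by rewrite mulr0 addr0 divr1 expr0 mulr1.
  - by rewrite !mul0r mulr0.
  - by rewrite mulr0 addr0 -mulrA (mulrC _^-1).
  - by rewrite -zE.
rewrite !big_split /= -mulr_sumr -addrA mulrDr lerD ?one // lerD ?one //.
  by rewrite mulr_ge0 // divr_ge0 // exprn_ge0 // ltW.
rewrite ler_wpM2l //; apply: le_trans (exp_tail_le _ _ z01) _.
rewrite ler_pdivrMr ?exprn_gt0 // mulrC ler_wpM2l ?exprn_ge0 //; lra.
Qed.

Lemma weight_gf_prod r : (1 + 1 <= #|V|)%N ->
  \prod_x (\sum_(d < r) weight x d / d`!%:R * y ^+ d) <=
  4 * c ^+ 2 * z ^+ 2 * expR (#|V|%:R * (c * (y ^+ 2 / 2 + z ^+ 3))).
Proof.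
move=> V2; have z0 : 0 <= z by case/andP: z01.
set t := c * (y ^+ 2 / 2 + z ^+ 3).
have t0 : 0 <= t by rewrite mulr_ge0 // addr_ge0 ?divr_ge0 ?exprn_ge0 // ltW.
have g0 x : 0 <= \sum_(d < r) weight x d / d`!%:R * y ^+ d.
  by apply: sumr_ge0 => d _; rewrite mulr_ge0 ?divr_ge0 ?weight_ge0 ?exprn_ge0 // ltW.
rewrite (bigD1 v1) //= (bigD1 v2) 1?eq_sym //= mulrA.
apply: ler_pM; rewrite ?mulr_ge0 ?prodr_ge0 //.
  apply: le_trans (ler_pM (g0 _) (g0 _) (weight_gf_end _ _) (weight_gf_end _ _)) _;
    rewrite ?eqxx ?orbT //.
  by rewrite le_eqVlt; apply/orP; left; apply/eqP; ring.
apply: (@le_trans _ _ (\prod_(x | (x != v1) && (x != v2)) expR t)).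
  apply: ler_prod => x /andP[x1 x2]; rewrite g0 /=.
  apply: le_trans (weight_gf_inner _ _) (expR_ge1Dx _).
  by rewrite negb_or x1.
rewrite prodr_const -expRM_natl ler_expR ler_wpM2r // ler_nat.
by rewrite -sum1_card -[leqRHS]sum1_card big_mkcond leq_sum // => x _; case: ifP.
Qed.

End Weights.

Local Ltac nneg := repeat first
  [ assumption | exact: ler0n | by apply: ltW | apply: mulr_ge0 | apply: exprn_ge0
  | rewrite invr_ge0 ].

(* The evaluation point [y] is the saddle point of [exp(Nb y^2 / 2) / y^(2s)]. *)
Lemma weight_words_le (R : realType) (V : finType) (v1 v2 : V) (c B Nb : R) s :
    v1 != v2 -> 0 <= c -> (0 < s)%N -> (s.*2)%:R <= B ->
    B ^+ 18 <= Nb -> #|V|%:R * c <= Nb ->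
  \sum_(w <- words V s.*2) \prod_x weight v1 v2 c B x (count_mem x w) <=
  (2 ^+ s * s`!%:R) * (c ^+ 2 * Nb ^+ s / 4).
Proof.
move=> v12 c0 s0 sB BN cN.
have B2 : 2 <= B by apply: le_trans sB; rewrite ler_nat; lia.
have B0 : 0 <= B by apply: le_trans B2.
have Bgt0 : 0 < B by apply: lt_le_trans B2.
have N0 : 0 < Nb by apply: lt_le_trans BN; rewrite exprn_gt0.
pose q : R := (s.*2)%:R / Nb.
have sgt0 : 0 < s%:R :> R by rewrite ltr0n.
have q0 : 0 < q by rewrite divr_gt0 // ltr0n double_gt0.
pose y := Num.sqrt q.
have y0 : 0 < y by rewrite sqrtr_gt0.
have y2 : y ^+ 2 = q by rewrite sqr_sqrtr // ltW.
pose z := B ^+ 2 * y.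
have z0 : 0 <= z by rewrite mulr_ge0 ?exprn_ge0 // ltW.
have z2 : z ^+ 2 = B ^+ 4 * q by rewrite exprMn y2 -exprM.
(* The exponent 18 enters here, through [s.*2 <= B] and [B ^+ 18 <= Nb]. It gives [B ^+ 5 * z <= 1],
   the square of the left side being [B ^+ 14 * q]. *)
have qB : q * B ^+ 17 <= 1.
  rewrite /q mulrAC ler_pdivrMr // mul1r; apply: le_trans BN.
  by rewrite [leRHS]exprS ler_wpM2r // exprn_ge0.
have Bk k : 1 <= B ^+ k by rewrite exprn_ege1 // (le_trans _ B2) // ler1n.
have zB : (B ^+ 5 * z) ^+ 2 <= 1.
  rewrite exprMn z2 -exprM mulrA -exprD; apply: le_trans qB.
  by rewrite [leLHS]mulrC ler_wpM2l ?(ltW q0) // ler_weXn2l // (le_trans _ B2) // ler1n.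
have zB1 : B ^+ 5 * z <= 1.
  have zB0 : 0 <= B ^+ 5 * z by rewrite mulr_ge0 ?exprn_ge0.
  by rewrite -(@ler_pXn2r _ 2) ?nnegrE // expr1n.
have z1 : z <= 1 by apply: le_trans zB1; rewrite -[leLHS]mul1r ler_wpM2r.
apply: le_trans (@words_sum_le R V _ _ y y0 (fun x d => weight_ge0 _ _ c0 B0 x d)) _.
have V2 : (1 + 1 <= #|V|)%N.
  rewrite (cardD1 v1) inE leq_add2l (cardD1 v2) !inE eq_sym v12; exact: leq_addr.
have e1 := expR1_le4 R; have e0 : 0 < expR 1 :> R := expR_gt0 _.
(* By the choice of [y], [Nb * y ^+ 2 / 2 = s], while [Nb * z ^+ 3 = B ^+ 4 * s.*2 * z <= B ^+ 5 * z
   <= 1]; the extra factor [exp 1] is at most 4. *)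
have E : expR (#|V|%:R * (c * (y ^+ 2 / 2 + z ^+ 3))) <= expR 1 ^+ s * 4.
  rewrite (_ : expR 1 ^+ s = expR s%:R :> R); last by rewrite -expRM_natl mulr1.
  apply: (@le_trans _ _ (expR s%:R * expR 1)); last by rewrite ler_wpM2l // expR_ge0.
  rewrite -expRD ler_expR mulrA; apply: (@le_trans _ _ (Nb * (y ^+ 2 / 2 + z ^+ 3))).
    by rewrite ler_wpM2r // addr_ge0 ?divr_ge0 ?exprn_ge0 // ltW.
  rewrite mulrDr lerD //.
    rewrite y2 /q -mul2n natrM le_eqVlt; apply/orP; left; apply/eqP.
    by field; rewrite gt_eqF.
  rewrite exprSr z2 /q mulrA (_ : Nb * _ = B ^+ 4 * (s.*2)%:R); last by field; rewrite gt_eqF.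
  apply: le_trans zB1; rewrite ler_wpM2r // [leRHS]exprSr ler_wpM2l // exprn_ge0 //.
have G := weight_gf_prod v12 c0 B0 y0 z1 (s.*2.+1) V2.
have F0 : 0 <= (s.*2)`!%:R / y ^+ s.*2 by rewrite divr_ge0 // exprn_ge0 // ltW.
apply: le_trans (ler_wpM2l F0 G) _.
have F1 : 0 <= 4 * c ^+ 2 * z ^+ 2.
  by nneg.
apply: le_trans (ler_wpM2l F0 (ler_wpM2l F1 E)) _.
have -> : y ^+ s.*2 = q ^+ s by rewrite -mul2n exprM y2.
have F2 : (s.*2)`!%:R <= (2 ^+ s * 2 ^+ s) * (s`!%:R * s`!%:R) :> R.
  have := fact_double_le s; rewrite -(ler_nat R) => /le_trans; apply.
  rewrite natrM !natrX -(expr2 s`!%:R) -exprMn (_ : 2 * 2 = 4%:R :> R) //.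
  by rewrite -natrM.
have Fe := fact_exp_le R s0.
rewrite z2.
have qs : q ^+ s = 2 ^+ s * s%:R ^+ s / Nb ^+ s.
  by rewrite /q expr_div_n -mul2n natrM exprMn.
have ss0 : 0 < s%:R ^+ s :> R by rewrite exprn_gt0.
have Ns0 : 0 < Nb ^+ s by rewrite exprn_gt0.
have t0 : 0 < 2 ^+ s :> R by rewrite exprn_gt0.
have fs0 : 0 < s`!%:R :> R by rewrite ltr0n fact_gt0.
apply: (@le_trans _ _ ((2 ^+ s * 2 ^+ s) * (s`!%:R * s`!%:R) / q ^+ s *
    (4 * c ^+ 2 * (B ^+ 4 * q) * (expR 1 ^+ s * 4)))).
  by apply: ler_wpM2r; [nneg | apply: ler_wpM2r => //; nneg].
(* Isolates [s! * e ^+ s] for Stirling's bound; the other factorial stays in the result. *)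
have -> : (2 ^+ s * 2 ^+ s) * (s`!%:R * s`!%:R) / q ^+ s *
    (4 * c ^+ 2 * (B ^+ 4 * q) * (expR 1 ^+ s * 4)) =
    (2 ^+ s * s`!%:R * c ^+ 2 * Nb ^+ s * (16 * B ^+ 4 * q) / s%:R ^+ s) *
    (s`!%:R * expR 1 ^+ s).
  by rewrite qs; field; rewrite !gt_eqF.
have P0 : 0 <= 2 ^+ s * s`!%:R * c ^+ 2 * Nb ^+ s * (16 * B ^+ 4 * q) / s%:R ^+ s.
  by nneg.
apply: le_trans (ler_wpM2l P0 Fe) _.
have -> : 2 ^+ s * s`!%:R * c ^+ 2 * Nb ^+ s * (16 * B ^+ 4 * q) / s%:R ^+ s *
    (expR 1 * s%:R ^+ s.+1) =
    (2 ^+ s * s`!%:R) * (c ^+ 2 * Nb ^+ s * (16 * B ^+ 4 * q * expR 1 * s%:R)).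
  by rewrite (exprS s%:R s); field; rewrite gt_eqF.
have cN0 : 0 <= c ^+ 2 * Nb ^+ s by nneg.
apply: ler_wpM2l; first by nneg.
apply: ler_wpM2l => //.
have s2 : s%:R * 2 <= B by rewrite -natrM muln2.
(* It remains to bound [16 * B ^+ 4 * q * e * s] by 1/4. With [e <= 4] and [s <= B / 2] it is at
   most [32 * q * B ^+ 5], and [2 ^+ 12 * q * B ^+ 5 <= q * B ^+ 17 <= 1] because [B >= 2]. *)
apply: (@le_trans _ _ (16 * B ^+ 4 * q * 4 * (B / 2))).
  apply: ler_pM; [by nneg | by nneg | | lra].
  by apply: ler_wpM2l => //; nneg.
have h12 : 2 ^+ 12 <= B ^+ 12 by rewrite lerXn2r ?nnegrE.
have : q * B ^+ 5 * 2 ^+ 12 <= 1.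
  apply: le_trans qB; rewrite -mulrA ler_wpM2l ?(ltW q0) //.
  rewrite (_ : 17%N = (5 + 12)%N) // exprD ler_wpM2l ?exprn_ge0 //.
rewrite (_ : 16 * B ^+ 4 * q * 4 * (B / 2) = 32 * (q * B ^+ 5)); last by rewrite (exprS B 4); field.
rewrite (_ : 2 ^+ 12 = 4096 :> R); last by rewrite -natrX.
set w := q * B ^+ 5; lra.
Qed.

Section EqualityCumulant.
Import mathcomp.boot.fintype mathcomp.boot.finset.
Variables (R : realType) (V : finType) (K' : nat) (v1 v2 : V) (v12 : v1 != v2).
Local Notation K := K'.+1.
Local Notation col := {ffun V -> 'I_K}.
Implicit Types (a : col) (e : seq (V * V)).

Definition monochrom a e : R := \prod_(b <- e) (a b.1 == a b.2)%:R.
Definition mono_prob e : R := \sum_(a : col) #|{: col}|%:R^-1 * monochrom a e.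
Definition mono_joint e : R :=
  \sum_(a : col) #|{: col}|%:R^-1 * ((a v1 == a v2)%:R * monochrom a e).
Definition kappa := cumulant mono_joint mono_prob.

Lemma monochrom_good (L : finType) (g : L -> V * V) a (S : {set L}) :
  monochrom a [seq g l | l <- enum S] = (good g a S)%:R.
Proof.
rewrite /monochrom big_map big_enum /=; case: (boolP (good g a S)) => [/goodP H|].
  by rewrite big1 // => l lS; rewrite H // eqxx.
move=> /forall_inPn[l lS /negPf gl].
by rewrite (bigD1 l) //= gl mul0r.
Qed.

Lemma frac_sum (Q : pred col) : \sum_(a : col) #|{: col}|%:R^-1 * (Q a)%:R = frac R Q.
Proof.
rewrite -mulr_sumr mulrC /frac; congr (_ / _).
by rewrite -sum1dep_card natr_sum [RHS]big_mkcond; apply: eq_bigr => a _; case: (Q a).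
Qed.

Lemma mono_prob_pr (L : finType) (g : L -> V * V) (S : {set L}) :
  mono_prob [seq g l | l <- enum S] = pr R K' g S.
Proof.
by rewrite /mono_prob /pr -frac_sum; apply: eq_bigr => a _; rewrite monochrom_good.
Qed.

Lemma mono_joint_px (L : finType) (g : L -> V * V) (S : {set L}) :
  mono_joint [seq g l | l <- enum S] = px R K' g v1 v2 S.
Proof.
rewrite /mono_joint /px -frac_sum; apply: eq_bigr => a _; rewrite monochrom_good.
by case: (_ == _); rewrite ?mul1r ?mul0r.
Qed.

Lemma mono_prob_nil : mono_prob [::] = 1.
Proof.
rewrite /mono_prob -mulr_sumr; under eq_bigr do rewrite /monochrom big_nil.
by rewrite sumr_const mulVf // card_col_neq0.
Qed.

Lemma kappa_conv e : conv kappa mono_prob e = mono_joint e.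
Proof. exact: conv_cumulant mono_prob_nil. Qed.

Lemma frac_equal : frac R (fun a : col => a v1 == a v2) = K%:R^-1.
Proof.
apply/le_anti/andP; split.
  rewrite -[K%:R]expr1 -(cards1 v2); apply: frac_le_determined => a b.
  move=> /eqP ga /eqP gb ab; apply/ffunP => x.
  have ab1 : a v1 = b v1 by apply: ab; rewrite inE.
  have [->|xv2] := eqVneq x v2; last by apply: ab; rewrite inE.
  by rewrite -ga -gb.
(* For the lower bound: recolouring [v2] like [v1] while recording its old colour is injective. *)
pose f (a : col) : col * 'I_K := ([ffun x => if x == v2 then a v1 else a x], a v2).
have finj : injective f.
  move=> a b [/ffunP E1 E2]; apply/ffunP => x; have := E1 x; rewrite !ffunE.
  by case: eqP => [->|].
have : (#|{: col}| <= #|[set a : col | a v1 == a v2]| * K)%N.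
  rewrite -[X in (_ <= _ * X)%N]card_ord -[#|'I_K|]cardsT -cardsX -(card_codom finj).
  apply: subset_leq_card; apply/subsetP => _ /codomP[a ->].
  by rewrite !inE /= !ffunE eqxx (negPf v12) eqxx.
rewrite -(ler_nat R) natrM /frac => H.
rewrite ler_pdivlMr ?lt0r ?card_col_neq0 //= ler_pdivrMl ?ltr0n //.
by rewrite mulrC.
Qed.

Lemma mono_joint_nil : mono_joint [::] = K%:R^-1.
Proof.
rewrite /mono_joint -frac_equal -frac_sum; apply: eq_bigr => a _.
by rewrite /monochrom big_nil mulr1.
Qed.

Lemma kappa_nil : kappa [::] = K%:R^-1.
Proof. by rewrite -mono_joint_nil -kappa_conv /= mono_prob_nil mulr1. Qed.

(** An edge word read as the word of its half-edges: occurrences of a vertex count its degree, so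
    sums over multigraphs with weights on degrees become sums over plain words. *)
Definition halves e := flatten [seq [:: b.1; b.2] | b <- e].

Lemma count_halves x e :
  count_mem x (halves e) = (\sum_(b <- e) ((b.1 == x) + (b.2 == x)))%N.
Proof.
elim: e => [|b e IH]; first by rewrite big_nil.
by rewrite big_cons -IH /= addnA.
Qed.

Lemma sum_halves s (F : seq V -> R) :
  \sum_(e <- words (V * V)%type s) F (halves e) = \sum_(w <- words V s.*2) F w.
Proof.
elim: s F => [|s IH] F; first by rewrite !big_words0.
rewrite doubleS !big_wordsS; under [RHS]eq_bigr do rewrite big_wordsS.
rewrite pair_bigA; apply: eq_bigr => -[x y] _ /=.
exact: (IH (fun w => F [:: x, y & w])).
Qed.

(** The square of [cumulant_le]: each vertex of [vset] contributes [K^-2], the prefactor [K^2]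
    compensates for one of them, and the edges of [ebig] are at most the half-edges at big vertices.
    The zero weights do not occur, by the degree constraints on nonzero cumulants. *)
Lemma kappa_sq_le (B : R) s e : (0 < s)%N -> (s.*2)%:R <= B ->
    e \in words (V * V)%type s ->
  kappa e ^+ 2 <= K%:R ^+ 2 *
    \prod_x weight v1 v2 (K%:R ^+ 2)^-1 B x (count_mem x (halves e)).
Proof.
move=> s0 sB /size_words se.
have B2 : 2 <= B by apply: le_trans sB; rewrite ler_nat; lia.
have B0 : 0 <= B by apply: le_trans B2.
have B1 : 1 <= B by apply: le_trans B2; rewrite ler1n.
have Kn0 j : 0 <= (K%:R ^+ j)^-1 :> R by rewrite invr_ge0 exprn_ge0.
pose g := tnth (in_tuple e); pose k (S : {set 'I_(size e)}) := kappa [seq g l | l <- enum S].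
have kc (S : {set 'I_(size e)}) :
    \sum_(S' : {set 'I_(size e)} | S' \subset S) k S' * pr R K' g (S :\: S') =
    px R K' g v1 v2 S.
  rewrite -mono_joint_px -kappa_conv conv_map_set; apply: eq_bigr => S' _.
  by rewrite mono_prob_pr.
have eT : [seq g l | l <- enum [set: 'I_(size e)]] = e.
  rewrite (_ : enum _ = enum 'I_(size e)); first exact: map_tnth_enum.
  by apply: eq_enum => l; rewrite inE.
have degE x : count_mem x (halves e) = deg g setT x.
  rewrite count_halves /deg -{1}eT big_map big_enum /=.
  by apply: eq_bigl => l; rewrite inE.
have W0 : 0 <= K%:R ^+ 2 *
    \prod_x weight v1 v2 (K%:R ^+ 2)^-1 B x (count_mem x (halves e)).
  by rewrite mulr_ge0 ?exprn_ge0 // prodr_ge0 // => x _; exact: weight_ge0.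
have [k0|kn0] := eqVneq (kappa e) 0; first by rewrite k0 expr0n.
have kT : k setT = kappa e by rewrite /k eT.
have kT0 : k setT != 0 by rewrite kT.
have T0 : [set: 'I_(size e)] != set0 by rewrite -card_gt0 cardsT card_ord se.
have H := @cumulant_le R V _ K' g v1 v2 k kc B setT.
have cB : (#|[set: 'I_(size e)]|.*2)%:R <= B by rewrite cardsT card_ord se.
have {}H := H cB; rewrite kT in H.
rewrite -real_normK ?num_real //.
have := ler_pM (normr_ge0 _) (normr_ge0 _) H H; rewrite -expr2 => /le_trans; apply.
set T := setT in H kT0 T0 degE *.
pose vs := vset g v1 v2 T.
have -> : \prod_x weight v1 v2 (K%:R ^+ 2)^-1 B x (count_mem x (halves e)) =
    (\prod_x (if x \in vs then (K%:R ^+ 2)^-1 else 1)) *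
    \prod_x (if big g v1 v2 T x then B ^+ (deg g T x).*2 else 1).
  rewrite -big_split; apply: eq_bigr => x _; rewrite degE /weight /= /vs /big !inE.
  case: ifPn => [xv|]; last rewrite negb_or => /andP[x1 x2].
    have := cumulant_deg_end kc kT0 T0 xv; rewrite lt0n => /negPf ->.
    by case/orP: xv => ->; rewrite ?orbT.
  have := cumulant_deg_neq1 kc kT0 x1 x2.
  rewrite (negPf x1) (negPf x2) /=.
  by case: (deg g T x) => [|[|[|d]]] //=; rewrite ?mulr1 ?mul1r.
rewrite -!big_mkcond /= prodr_const prodrXr.
have bdeg : (#|ebig g v1 v2 T| <= \sum_(x | big g v1 v2 T x) deg g T x)%N.
  rewrite /deg exchange_big /= -sum1_card.
  rewrite [leqLHS]big_mkcond [leqRHS]big_mkcond; apply: leq_sum => l _.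
  case: ifP => [|_ //]; rewrite inE => /andP[-> lb].
  have [x xb lx] : exists2 x, big g v1 v2 T x & inc g l x.
    by case/orP: lb => lb; [exists (g l).1 | exists (g l).2]; rewrite // /inc eqxx ?orbT.
  rewrite (bigD1 x) //=; apply: leq_trans (leq_addr _ _).
  by case/orP: lx => ->; rewrite ?addn1.
have vs0 : (0 < #|vs|)%N by exact: card_vset_gt0.
have KE : K%:R ^+ 2 * (K%:R ^+ 2)^-1 ^+ #|vs| = (K%:R ^+ #|vs|.-1)^-1 ^+ 2 :> R.
  rewrite -{1}(prednK vs0) (exprS (K%:R ^+ 2)^-1) mulrA mulfV ?expf_neq0 ?pnatr_eq0 // mul1r.
  by rewrite !exprVn -!exprM mulnC.
rewrite [leRHS]mulrA KE -/vs -[leLHS]expr2 exprMn ler_wpM2l ?exprn_ge0 //.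
rewrite -exprM ler_weXn2l //; under eq_bigr do rewrite -muln2.
by rewrite -big_distrl leq_mul2r bdeg orbT.
Qed.

Lemma sum_kappa_sq_le (B Nb : R) s : (0 < s)%N -> (s.*2)%:R <= B ->
    B ^+ 18 <= Nb -> #|V|%:R / K%:R ^+ 2 <= Nb ->
  \sum_(e <- words (V * V)%type s) kappa e ^+ 2 <=
  2 ^+ s * s`!%:R * (Nb ^+ s / (4 * K%:R ^+ 2)).
Proof.
move=> s0 sB BN VN.
have K0 : K%:R != 0 :> R by rewrite pnatr_eq0.
apply: (@le_trans _ _ (\sum_(e <- words (V * V)%type s) K%:R ^+ 2 *
    \prod_x weight v1 v2 (K%:R ^+ 2)^-1 B x (count_mem x (halves e)))).
  by rewrite big_seq [leRHS]big_seq; apply: ler_sum => e; exact: kappa_sq_le.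
rewrite -mulr_sumr (sum_halves s (fun w =>
  \prod_x weight v1 v2 (K%:R ^+ 2)^-1 B x (count_mem x w))).
have c0 : 0 <= (K%:R ^+ 2)^-1 :> R by rewrite invr_ge0 exprn_ge0.
have := weight_words_le v12 c0 s0 sB BN VN.
have K2 : 0 <= K%:R ^+ 2 :> R by rewrite exprn_ge0.
move=> /(ler_wpM2l K2) /le_trans; apply.
by rewrite le_eqVlt; apply/orP; left; apply/eqP; field.
Qed.

End EqualityCumulant.

(** * Gaussian moments and independence *)

Section Density.
Local Open Scope ereal_scope.
Import HBNNSimple.
Context d (T : measurableType d) (R : realType).
Variables (mu : {measure set T -> \bar R}) (nu : {measure set R -> \bar R}).
Variables (U X : T -> R).
Hypotheses (mU : measurable_fun [set: T] U) (U0 : forall x, (0 <= U x)%R).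
Hypothesis mX : measurable_fun [set: T] X.
Hypothesis UX : forall A : set R, measurable A ->
  \int[mu]_x (U x * \1_A (X x))%:E = nu A.

Lemma density_integral_nnsfun (h : {nnsfun R >-> R}) :
  \int[mu]_x (U x * h (X x))%:E = \int[nu]_y (h y)%:E.
Proof.
rewrite [RHS]integralT_nnsfun sintegralE.
have hE x : (U x * h (X x))%:E =
    \sum_(r \in range h) (r * (U x * \1_(h @^-1` [set r]) (X x)))%:E.
  rewrite fsumEFin //; congr EFin; rewrite [in LHS]fimfunE mulr_fsumr.
  by apply: eq_fsbigr => r _; rewrite mulrCA.
have mh r : measurable (h @^-1` [set r]) by exact: measurable_funPTI.
have mUX r : measurable_fun [set: T] (fun x => (U x * \1_(h @^-1` [set r]) (X x))%R).
  by apply: measurable_funM => //; apply: measurableT_comp => //.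
under eq_integral do rewrite hE.
rewrite ge0_integral_fsum //; last 2 first.
  by move=> r; apply/measurable_EFinP; exact: measurable_funM.
  move=> r x _; rewrite lee_fin indicE; case: (boolP (_ \in _)) => [|_].
    by rewrite inE /= => <-; rewrite !mulr_ge0.
  by rewrite !mulr0.
apply: eq_fsbigr => r; rewrite inE => -[y _ <-].
under eq_integral do rewrite EFinM.
rewrite ge0_integralZl_EFin //.
- by rewrite UX.
- by move=> x _; rewrite lee_fin mulr_ge0.
- exact/measurable_EFinP.
Qed.

Lemma density_integral (f : R -> R) : measurable_fun [set: R] f ->
  (forall y, (0 <= f y)%R) ->
  \int[mu]_x (U x * f (X x))%:E = \int[nu]_y (f y)%:E.
Proof.
move=> mf f0.
have mfE : measurable_fun [set: R] (EFin \o f) by exact/measurable_EFinP.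
pose h := nnsfun_approx measurableT mfE.
have h_cvg y : (EFin \o h n) y @[n --> \oo] --> (f y)%:E.
  apply: (cvg_nnsfun_approx measurableT mfE) => // z _; exact: f0.
have h_nd y : {homo (fun n => (h n y)%:E) : n m / (n <= m)%N >-> n <= m}.
  by move=> a b ab; rewrite lee_fin; exact/lefP/nd_nnsfun_approx.
have mh n : measurable_fun [set: R] (h n) by exact: measurable_funP.
have -> : \int[nu]_y (f y)%:E = limn (fun n => \int[nu]_y (h n y)%:E).
  under eq_integral do rewrite -(cvg_lim _ (h_cvg _)) //.
  apply: monotone_convergence => //.
  - by move=> n; exact/measurable_EFinP.
  - by move=> n x _; rewrite lee_fin.
  - by move=> x _; exact: h_nd.
have -> : \int[mu]_x (U x * f (X x))%:E = limn (fun n => \int[mu]_x (U x * h n (X x))%:E).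
  have cU x : (U x * h n (X x))%:E @[n --> \oo] --> (U x * f (X x))%:E.
    under eq_fun do rewrite EFinM; rewrite EFinM; apply: cvgeZl => //.
    exact: h_cvg.
  under eq_integral do rewrite -(cvg_lim _ (cU _)) //.
  apply: monotone_convergence => //.
  - move=> n; apply/measurable_EFinP; apply: measurable_funM => //.
    exact: measurableT_comp.
  - by move=> n x _; rewrite lee_fin mulr_ge0.
  - move=> x _ a b ab; rewrite lee_fin ler_wpM2l //.
    by have := h_nd (X x) _ _ ab; rewrite lee_fin.
by under eq_fun do rewrite density_integral_nnsfun.
Qed.


Lemma density_integrable (f : R -> R) : measurable_fun [set: R] f ->
  mu.-integrable [set: T] (fun x => (U x * f (X x))%:E) <->
  nu.-integrable [set: R] (EFin \o f).
Proof.
move=> mf; have mUf : measurable_fun [set: T] (fun x => (U x * f (X x))%:E).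
  by apply/measurable_EFinP; apply: measurable_funM => //; exact: measurableT_comp.
have mfE : measurable_fun [set: R] (EFin \o f) by exact/measurable_EFinP.
have E : \int[mu]_x `|(U x * f (X x))%:E| = \int[nu]_y `|(EFin \o f) y|.
  rewrite -(density_integral (f := fun y => `|f y|%R)) //; last exact: measurableT_comp.
  by apply: eq_integral => x _; rewrite /= normrM ger0_norm.
by split=> /integrableP[_]; rewrite ?E -?E => H; apply/integrableP; split; rewrite ?E // -E.
Qed.

Lemma density_integral_signed (f : R -> R) : measurable_fun [set: R] f ->
  nu.-integrable [set: R] (EFin \o f) ->
  \int[mu]_x (U x * f (X x))%:E = \int[nu]_y (f y)%:E.
Proof.
move=> mf inf.
pose f1 y := Num.max (f y) 0%R; pose f2 y := Num.max (- f y)%R 0%R.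
have fE y : f y = (f1 y - f2 y)%R.
  by rewrite /f1 /f2; case: (lerP 0 (f y)) => h; [rewrite max_r|rewrite max_l];
    rewrite ?oppr_le0 ?oppr_ge0 ?subr0 ?sub0r ?opprK // ltW.
have mf1 : measurable_fun [set: R] f1 by exact: measurable_funrpos.
have mf2 : measurable_fun [set: R] f2 by exact: measurable_funrneg.
have f10 y : (0 <= f1 y)%R by rewrite le_max lexx orbT.
have f20 y : (0 <= f2 y)%R by rewrite le_max lexx orbT.
have le1 y : (f1 y <= `|f y|)%R by rewrite ge_max normr_ge0 ler_norm.
have le2 y : (f2 y <= `|f y|)%R by rewrite ge_max normr_ge0 -normrN ler_norm.
have i1 : nu.-integrable [set: R] (EFin \o f1).
  apply: le_integrable inf => //; first exact/measurable_EFinP.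
  by move=> y _; rewrite /= lee_fin ger0_norm.
have i2 : nu.-integrable [set: R] (EFin \o f2).
  apply: le_integrable inf => //; first exact/measurable_EFinP.
  by move=> y _; rewrite /= lee_fin ger0_norm.
under eq_integral do rewrite fE mulrBr EFinB.
rewrite integralB //; try exact/density_integrable.
rewrite !density_integral //.
under [RHS]eq_integral do rewrite fE EFinB.
by rewrite integralB.
Qed.

End Density.

Section Gaussian.
Variables (R : realType) (s : R) (s0 : 0 < s).
Local Notation leb := (@lebesgue_measure R).
Local Notation pdf := (normal_pdf 0 s).

Fixpoint normal_moment (s : R) d : R :=
  match d with
  | 0 => 1 | 1 => 0 | d'.+2 => d'.+1%:R * s ^+ 2 * normal_moment s d'
  end.

Lemma normal_pdf_expR x : pdf x = normal_peak s * expR (- (x ^+ 2 / (s ^+ 2 *+ 2))).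
Proof. by rewrite normal_pdfE ?gt_eqF // /normal_fun subr0 mulNr. Qed.

(* The Gaussian weight splits as the product of two Gaussian weights of twice
   the variance, and one of them absorbs the power of [x]. *)
Lemma normal_pdf_absorb k : exists2 C : R, 0 <= C &
  forall x, x ^+ (k.*2) * pdf x <= C * normal_pdf 0 (s * Num.sqrt 2) x.
Proof.
pose w : R := s ^+ 2 * 2 * 2.
have w0 : 0 < w by rewrite !mulr_gt0 ?exprn_gt0 ?ltr0n.
have e2 : s ^+ 2 *+ 2 = s ^+ 2 * 2 by rewrite mulr_natr.
have s2 : (s * Num.sqrt 2) ^+ 2 *+ 2 = w.
  by rewrite exprMn sqr_sqrtr ?ler0n // -mulr_natr.
have q0 : s * Num.sqrt 2 != 0 by rewrite mulf_neq0 ?gt_eqF ?sqrtr_gt0.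
have p0 := normal_peak_gt0 q0.
exists (normal_peak s * (k`!%:R * w ^+ k) / normal_peak (s * Num.sqrt 2)).
  by rewrite divr_ge0 ?mulr_ge0 ?normal_peak_ge0 ?exprn_ge0 // ltW.
move=> x; rewrite normal_pdf_expR (normal_pdfE _ q0) /normal_fun subr0 s2.
rewrite [leRHS]mulrA divfK ?gt_eqF // mulrCA -[leRHS]mulrA ler_wpM2l ?normal_peak_ge0 //.
have -> : expR (- (x ^+ 2 / (s ^+ 2 *+ 2))) = expR (- x ^+ 2 / w) * expR (- x ^+ 2 / w).
  rewrite -expRD; congr expR; rewrite /w e2; field; exact: lt0r_neq0.
rewrite mulrA ler_wpM2r ?expR_ge0 // mulNr expRN.
rewrite ler_pdivrMr ?expR_gt0 //.
have u0 : 0 <= x ^+ 2 / w by rewrite divr_ge0 ?sqr_ge0 // ltW.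
have : (x ^+ 2 / w) ^+ k <= k`!%:R * expR (x ^+ 2 / w).
  rewrite -ler_pdivrMl ?ltr0n ?fact_gt0 // [leLHS]mulrC.
  case: k => [|k]; first by rewrite expr0 fact0 divr1 -[leLHS]expR0 ler_expR.
  by apply: le_trans (expR_ge1Dxn k u0); rewrite lerDr.
rewrite expr_div_n ler_pdivrMr ?exprn_gt0 // -exprM mul2n => /le_trans; apply.
by rewrite mulrAC.
Qed.

(** Only even powers are absorbed directly; [|x| ^+ d <= 1 + x ^+ d.*2] reduces every power to
    them. *)
Lemma normal_pdf_pow_bound d : exists2 C : R, 0 <= C &
  forall x, `|x ^+ d * pdf x| <= C * (pdf x + normal_pdf 0 (s * Num.sqrt 2) x).
Proof.
have [C C0 H] := normal_pdf_absorb d.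
exists (1 + C) => [|x]; first by rewrite addr_ge0.
have p0 := normal_pdf_ge0 0 s x; have q0 := normal_pdf_ge0 0 (s * Num.sqrt 2) x.
rewrite normrM (ger0_norm p0) normrX.
have : `|x| ^+ d <= 1 + x ^+ d.*2.
  rewrite -mul2n exprM -real_normK ?num_real // -exprM mulnC exprM.
  by set t := `|x| ^+ d; have : 0 <= (t - 1) ^+ 2 := sqr_ge0 _; nra.
move=> /(ler_wpM2r p0) /le_trans; apply; rewrite mulrDl mul1r.
by have := H x; nra.
Qed.

Lemma measurable_pow_pdf d : measurable_fun [set: R] (fun x => (x ^+ d * pdf x)%:E).
Proof.
apply/measurable_EFinP; apply: measurable_funM; first exact: measurable_funX.
exact: measurable_normal_pdf.
Qed.

Lemma integrable_pow_pdf d : leb.-integrable [set: R] (fun x => (x ^+ d * pdf x)%:E).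
Proof.
have [C C0 H] := normal_pdf_pow_bound d.
have I2 : leb.-integrable [set: R]
    (fun x => C%:E * ((pdf x)%:E + (normal_pdf 0 (s * Num.sqrt 2) x)%:E))%E.
  by apply: integrableZl => //; apply: integrableD => //; exact: integrable_normal_pdf.
apply: le_integrable I2 => //; first exact: measurable_pow_pdf.
move=> x _; rewrite -EFinD -EFinM /= lee_fin; apply: le_trans (H x) _.
exact: ler_norm.
Qed.

(** [h d] is the derivative of [F d]; the vanishing of its integral is the recursion of the Gaussian
    moments. *)
Let F d (x : R) := x ^+ d * pdf x.
Let h d (x : R) := d%:R * (x ^+ d.-1 * pdf x) - s^-2 * (x ^+ d.+1 * pdf x).

Lemma is_derive_pow_pdf d (x : R) : is_derive x (1 : R) (F d) (h d x).
Proof.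
pose c : R := (s ^+ 2 *+ 2)^-1.
have pdfE : pdf = normal_peak s *: (expR \o ((- c) *: (id ^+ 2 : R -> R))).
  apply/funext => y; rewrite normal_pdf_expR /= /c.
  by congr (_ * expR _); rewrite mulrC -mulNr.
have XE n y : (id ^+ n : R -> R) y = y ^+ n by rewrite exprfctE.
have FE : F d = (id ^+ d : R -> R) * pdf.
  by apply/funext => y; rewrite /F -[in LHS]XE.
have pdfx := congr1 (fun f => f x) pdfE.
rewrite FE pdfE; apply: is_derive_eq.
rewrite -pdfE /h pdfx /=.
have -> : s ^- 2 = 2 * c by rewrite /c -[_ *+ 2]mulr_natr; field; exact: lt0r_neq0.
rewrite /GRing.scale /=.
rewrite !XE.
set e := expR _; rewrite -[_ *: e]/(normal_peak s * e).
rewrite (exprS x d) expr1; ring.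
Qed.


(** By the estimate at [d.+1], [|x| * |F d x|] is bounded, so the boundary terms decay like the
    harmonic sequence. *)
Lemma cvg_pow_pdf d : F d n.+1%:R - F d (- n.+1%:R) @[n --> \oo] --> (0 : R).
Proof.
have [C C0 H] := normal_pdf_pow_bound d.+1.
have q0 : s * Num.sqrt 2 != 0 by rewrite mulf_neq0 ?gt_eqF ?sqrtr_gt0.
pose M := C * (normal_peak s + normal_peak (s * Num.sqrt 2)).
have bound n (x : R) : `|x| = n.+1%:R -> `|F d x| <= M * harmonic n.
  move=> xn; rewrite /harmonic /= -[leRHS]/(M / n.+1%:R) ler_pdivlMr // -xn -normrM mulrC.
  rewrite mulrA -exprS; apply: le_trans (H x) _; rewrite ler_wpM2l // lerD //.
    by apply: normal_pdf_ub; exact: lt0r_neq0.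
  exact: normal_pdf_ub.
apply/norm_cvg0P; apply: (@squeeze_cvgr _ _ _ _ (fun=> 0) (fun n => (M + M) * harmonic n)).
- apply: nearW => n; rewrite normr_ge0 /=; apply: le_trans (ler_normB _ _) _.
  by rewrite mulrDl lerD // bound ?normrN // ger0_norm.
- exact: cvg_cst.
rewrite -[X in _ --> X](mulr0 (M + M)); apply: cvgM; first exact: cvg_cst.
exact: cvg_harmonic.
Qed.

Lemma integrable_deriv_pow_pdf d : leb.-integrable [set: R] (EFin \o h d).
Proof.
rewrite (_ : EFin \o h d = (fun x => d%:R%:E * (x ^+ d.-1 * pdf x)%:E -
   (s^-2)%:E * (x ^+ d.+1 * pdf x)%:E)%E); last by apply/funext => x.
by apply: integrableB => //; apply: integrableZl => //; exact: integrable_pow_pdf.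
Qed.

Lemma continuous_pow_pdf d : continuous (fun x : R => x ^+ d * pdf x).
Proof.
move=> x; apply: cvgM; first exact: exprn_continuous.
by apply: continuous_normal_pdf; exact: lt0r_neq0.
Qed.

Lemma integral_deriv_pow_pdf d : (\int[leb]_x (h d x)%:E = 0)%E.
Proof.
pose I n : set R := `[- n.+1%:R, n.+1%:R]%classic.
pose f_ n : R -> \bar R := (EFin \o h d) \_ (I n).
have mh : measurable_fun [set: R] (EFin \o h d).
  exact: measurable_int (integrable_deriv_pow_pdf d).
have [|||||_ _] := @dominated_convergence _ _ _ leb [set: R] measurableT f_
  (EFin \o h d) (fun x => `|(EFin \o h d) x|%E).
- move=> n; apply/measurable_restrict => //; first exact: measurable_itv.
  exact: measurable_funS mh.
- exact: mh.
- apply: aeW => x _; apply: cvg_near_cst.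
  exists (Num.truncn `|x|).+1 => //= n xn.
  rewrite /f_ patchE mem_set // /I /= in_itv /= -ler_norml.
  apply: le_trans (ltW (truncnS_gt _)) _; rewrite ler_nat.
  exact: leq_trans xn _.
- exact: integrable_abse (integrable_deriv_pow_pdf d).
- apply: aeW => x n _; rewrite /f_ patchE; case: ifP => _ //.
  by rewrite abse0 abse_ge0.
have fE n : (\int[leb]_x f_ n x = (F d n.+1%:R - F d (- n.+1%:R))%:E)%E.
  rewrite -integral_mkcond EFinB.
  apply: (@continuous_FTC2 R (h d) (F d)).
  - by apply: (@lt_trans _ _ 0); rewrite ?oppr_lt0 ltr0n.
  - apply: continuous_subspaceT => x.
    apply: cvgB; (apply: cvgM; [exact: cvg_cst | exact: continuous_pow_pdf]).
  - split; first by move=> x _; have [] := is_derive_pow_pdf d x.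
      by apply: cvg_at_right_filter; exact: continuous_pow_pdf.
    by apply: cvg_at_left_filter; exact: continuous_pow_pdf.
  - by move=> x _; rewrite derive1E; have [_ ->] := is_derive_pow_pdf d x.
under [X in X @ _ --> _]eq_fun do rewrite fE.
move=> cv; have : (F d n.+1%:R - F d (- n.+1%:R))%:E @[n --> \oo] --> 0%E.
  by apply: cvg_EFin; [exact: nearW | exact: cvg_pow_pdf].
by move/(cvg_unique _ cv) => -> //.
Qed.

Lemma integral_pow_pdf d :
  (\int[leb]_x (x ^+ d * pdf x)%:E = (normal_moment s d)%:E)%E.
Proof.
have rec e : (\int[leb]_x (x ^+ e.+1 * pdf x)%:E =
    (s ^+ 2 * e%:R)%:E * \int[leb]_x (x ^+ e.-1 * pdf x)%:E)%E.
  have := integral_deriv_pow_pdf e; rewrite /h.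
  under eq_integral do rewrite EFinB !(EFinM _ (_ * _)).
  have i1 := integrable_pow_pdf e.-1; have i2 := integrable_pow_pdf e.+1.
  rewrite integralB //; try by apply: integrableZl.
  rewrite !integralZl //.
  have /fineK <- := integrable_fin_num measurableT i1.
  have /fineK <- := integrable_fin_num measurableT i2.
  rewrite -!EFinM -EFinB => -[] /eqP; rewrite subr_eq0 => /eqP E; congr EFin.
  rewrite -mulrA E mulrA mulfV ?mul1r // sqrf_eq0; exact: lt0r_neq0.
elim/ltn_ind: d => -[|[|d]] IH.
- by under eq_integral do rewrite expr0 mul1r; rewrite integral_normal_pdf.
- by rewrite rec mulr0 mul0e.
by rewrite rec /= IH // -EFinM [s ^+ 2 * _]mulrC.
Qed.

End Gaussian.

Section NormalMoments.
Context d (T : measurableType d) (R : realType) (P : probability T R).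

(** The law of [X] is the image both of [P] with density 1 and of Lebesgue measure with density
    [normal_pdf 0 s]; [density_integral_signed] is applied to each. *)
Lemma centered_normal_moment (s : R) (X : {RV P >-> R}) k :
    0 < s -> centered_normal s X ->
  P.-integrable [set: T] (fun w => (X w ^+ k)%:E) /\
  (\int[P]_w (X w ^+ k)%:E = (normal_moment s k)%:E)%E.
Proof.
move=> s0 XN.
have mk : measurable_fun [set: R] (fun y : R => y ^+ k) by exact: measurable_funX.
have mp : measurable_fun [set: R] (normal_pdf 0 s) by exact: measurable_normal_pdf.
have p0 (x : R) : 0 <= normal_pdf 0 s x by exact: normal_pdf_ge0.
have D1 (A : set R) : measurable A ->
    (\int[@lebesgue_measure R]_x (normal_pdf 0 s x * \1_A (idfun x))%:E = distribution P X A)%E.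
  move=> mA; rewrite XN // /normal_prob [RHS]integral_mkcond.
  apply: eq_integral => x _; rewrite patchE indicE /=.
  by case: (x \in A); rewrite ?mulr1 ?mulr0.
have D2 (A : set R) : measurable A ->
    (\int[P]_w (1 * \1_A (X w))%:E = distribution P X A)%E.
  move=> mA; under eq_integral do rewrite mul1r.
  have := integral_indic P measurableT (measurable_sfunP X mA).
  by rewrite setIT.
have mid : measurable_fun [set: R] (@idfun R) by exact: measurable_id.
have iD : (distribution P X).-integrable [set: R] (EFin \o (fun y : R => y ^+ k)).
  apply: (proj1 (@density_integrable _ (measurableTypeR R) R (@lebesgue_measure R)
    (distribution P X) (normal_pdf 0 s) idfun mp p0 mid D1 (fun y => y ^+ k) mk)).
  under eq_fun do rewrite mulrC; exact: integrable_pow_pdf.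
have m1 : measurable_fun [set: T] (fun=> 1 : R) by exact: measurable_cst.
have p1 (w : T) : 0 <= (1 : R) by exact: ler01.
have mX : measurable_fun [set: T] X by [].
split.
  have /(density_integrable m1 p1 mX D2 mk) := iD.
  by apply: eq_integrable => // w _; rewrite mul1r.
have := density_integral_signed m1 p1 mX D2 mk iD.
under eq_integral do rewrite mul1r; move=> ->.
rewrite -(@density_integral_signed _ (measurableTypeR R) R (@lebesgue_measure R)
  (distribution P X) (normal_pdf 0 s) idfun mp p0 mid D1 (fun y => y ^+ k) mk iD).
rewrite -(integral_pow_pdf s0).
by apply: eq_integral => x _; rewrite mulrC.
Qed.

End NormalMoments.

(** * Product formula for independent random variables *)

Section Factorization.
Context d (T : measurableType d) (R : realType) (P : probability T R).

Let rprob (A : set T) : R := fine (P A).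

Let rprobE (A : set T) : measurable A -> P A = (rprob A)%:E.
Proof. by move=> mA; rewrite /rprob fineK // fin_num_measure. Qed.

(** The hypothesis on [W] says that under the density [W / c] the variable [X] keeps its law. *)
Lemma factor_nonneg (X : {RV P >-> R}) (W : T -> R) (c : R) (f : R -> R) :
    measurable_fun [set: T] W -> (forall w, 0 <= W w) -> 0 < c ->
    (forall A : set R, measurable A ->
      (\int[P]_w (W w * \1_A (X w))%:E = (c * rprob (X @^-1` A))%:E)%E) ->
    measurable_fun [set: R] f ->
    P.-integrable [set: T] (fun w => (f (X w))%:E) ->
  P.-integrable [set: T] (fun w => (W w * f (X w))%:E) /\
  (\int[P]_w (W w * f (X w))%:E = c%:E * \int[P]_w (f (X w))%:E)%E.
Proof.
move=> mW W0 c0 WX mf inf.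
have mX : measurable_fun [set: T] X by [].
have m1 : measurable_fun [set: T] (fun=> 1 : R) by exact: measurable_cst.
have p1 (w : T) : 0 <= (1 : R) by exact: ler01.
have D1 (A : set R) : measurable A ->
    (\int[P]_w (1 * \1_A (X w))%:E = distribution P X A)%E.
  move=> mA; under eq_integral do rewrite mul1r.
  by have := integral_indic P measurableT (measurable_sfunP X mA); rewrite setIT.
have mU : measurable_fun [set: T] (fun w => c^-1 * W w) by exact: measurable_funM.
have pU w : 0 <= c^-1 * W w by rewrite mulr_ge0 // invr_ge0 ltW.
have D2 (A : set R) : measurable A ->
    (\int[P]_w (c^-1 * W w * \1_A (X w))%:E = distribution P X A)%E.
  move=> mA; under eq_integral do rewrite -mulrA EFinM.
  rewrite ge0_integralZl_EFin //; last 3 first.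
  - by move=> w _; rewrite lee_fin mulr_ge0.
  - apply/measurable_EFinP; apply: measurable_funM => //.
    by apply: measurableT_comp => //; exact: measurable_indic.
  - by rewrite invr_ge0 ltW.
  rewrite WX // -EFinM mulrA mulVf ?gt_eqF // mul1r -rprobE //.
  exact: measurable_funPTI.
have iD : (distribution P X).-integrable [set: R] (EFin \o f).
  apply: (proj1 (density_integrable m1 p1 mX D1 mf)).
  by under eq_fun do rewrite mul1r.
have iU := proj2 (density_integrable mU pU mX D2 mf) iD.
have E w : (W w * f (X w))%:E = (c%:E * (c^-1 * W w * f (X w))%:E)%E.
  by rewrite -EFinM !mulrA mulfV ?gt_eqF // mul1r.
split.
  by under eq_fun do rewrite E; exact: integrableZl.
under eq_integral do rewrite E; rewrite integralZl //; congr (_ * _)%E.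
rewrite (density_integral_signed mU pU mX D2 mf iD).
rewrite -(density_integral_signed m1 p1 mX D1 mf iD).
by apply: eq_integral => w _; rewrite mul1r.
Qed.

(* [U] is the difference of the positive densities [`|U| + U + 1] and [`|U| + 1]. *)
Lemma factor_signed (X : {RV P >-> R}) (U : T -> R) (c c' : R) (f : R -> R) :
    measurable_fun [set: T] U ->
    P.-integrable [set: T] (fun w => (U w)%:E) ->
    (forall A : set R, measurable A ->
      (\int[P]_w (U w * \1_A (X w))%:E = (c * rprob (X @^-1` A))%:E)%E) ->
    (forall A : set R, measurable A ->
      (\int[P]_w (`|U w| * \1_A (X w))%:E = (c' * rprob (X @^-1` A))%:E)%E) ->
    measurable_fun [set: R] f ->
    P.-integrable [set: T] (fun w => (f (X w))%:E) ->
  P.-integrable [set: T] (fun w => (U w * f (X w))%:E) /\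
  (\int[P]_w (U w * f (X w))%:E = c%:E * \int[P]_w (f (X w))%:E)%E.
Proof.
move=> mU iU UX aX mf inf.
have mX : measurable_fun [set: T] X by [].
have maU : measurable_fun [set: T] (fun w => `|U w|) by exact: measurableT_comp.
have iA (W : T -> R) (A : set R) : measurable A -> measurable_fun [set: T] W ->
    P.-integrable [set: T] (fun w => (W w)%:E) ->
    P.-integrable [set: T] (fun w => (W w * \1_A (X w))%:E).
  move=> mA mW iW; apply: le_integrable iW => //.
    apply/measurable_EFinP; apply: measurable_funM => //.
    by apply: measurableT_comp => //; exact: measurable_indic.
  move=> w _; rewrite /= lee_fin normrM ler_piMr // indicE.
  by case: (_ \in _); rewrite ?normr1 ?normr0.
have iaU : P.-integrable [set: T] (fun w => (`|U w|)%:E).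
  by apply: le_integrable iU => // [|w _]; [exact/measurable_EFinP | rewrite /= normr_id].
have i1 : P.-integrable [set: T] (fun w => (1 : R)%:E).
  exact: finite_measure_integrable_cst.
have PX (A : set R) : measurable A -> (\int[P]_w (1 * \1_A (X w))%:E = (rprob (X @^-1` A))%:E)%E.
  move=> mA; under eq_integral do rewrite mul1r.
  rewrite -rprobE; last exact: measurable_funPTI.
  by have := integral_indic P measurableT (measurable_sfunP X mA); rewrite setIT.
have XT : rprob (X @^-1` setT) = 1 by rewrite preimage_setT /rprob probability_setT.
have indT w : \1_[set: R] (X w) = 1 :> R by rewrite indicT.
have c'0 : 0 <= c'.
  have : (0 <= \int[P]_w (`|U w| * \1_setT (X w))%:E)%E.
    by apply: integral_ge0 => w _; rewrite lee_fin indT mulr1.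
  by rewrite aX // XT mulr1 lee_fin.
have cc' : 0 <= c' + c.
  have : (0 <= \int[P]_w ((`|U w| * \1_setT (X w))%:E + (U w * \1_setT (X w))%:E))%E.
    apply: integral_ge0 => w _; rewrite -EFinD lee_fin indT !mulr1.
    by rewrite -lerBlDr sub0r -normrN ler_norm.
  by rewrite integralD ?aX ?UX ?XT ?mulr1 -?EFinD ?lee_fin //; exact: iA.
pose W1 w := `|U w| + 1; pose W2 w := `|U w| + U w + 1.
have mW1 : measurable_fun [set: T] W1 by exact: measurable_funD.
have mW2 : measurable_fun [set: T] W2.
  by apply: measurable_funD => //; exact: measurable_funD.
have W10 w : 0 <= W1 w by rewrite addr_ge0.
have W20 w : 0 <= W2 w.
  by rewrite addr_ge0 // -lerBlDr sub0r -normrN ler_norm.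
have W1X (A : set R) : measurable A ->
    (\int[P]_w (W1 w * \1_A (X w))%:E = ((c' + 1) * rprob (X @^-1` A))%:E)%E.
  move=> mA; under eq_integral do rewrite mulrDl EFinD.
  by rewrite integralD ?aX ?PX -?EFinD ?mulrDl ?mul1r //; exact: iA.
have W2X (A : set R) : measurable A ->
    (\int[P]_w (W2 w * \1_A (X w))%:E = ((c' + c + 1) * rprob (X @^-1` A))%:E)%E.
  move=> mA; have E w : (W2 w * \1_A (X w))%:E =
      ((`|U w| * \1_A (X w))%:E + (U w * \1_A (X w))%:E + (1 * \1_A (X w))%:E)%E.
    by rewrite -!EFinD; congr EFin; rewrite /W2; ring.
  have iA1 := iA _ _ mA maU iaU; have iA2 := iA _ _ mA mU iU.
  have iA3 := iA (fun=> 1) _ mA (measurable_cst (1 : R)) i1.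
  under eq_integral do rewrite E.
  rewrite integralD //; last exact: integrableD.
  by rewrite integralD // aX // UX // PX // -!EFinD !mulrDl mul1r.
have c1 : 0 < c' + 1 by rewrite ltr_wpDl.
have c2 : 0 < c' + c + 1 by rewrite ltr_wpDl.
have [j1 e1] := factor_nonneg mW1 W10 c1 W1X mf inf.
have [j2 e2] := factor_nonneg mW2 W20 c2 W2X mf inf.
have E w : (U w * f (X w))%:E = ((W2 w * f (X w))%:E - (W1 w * f (X w))%:E)%E.
  by rewrite -EFinB; congr EFin; rewrite /W1 /W2; ring.
split; first by under eq_fun do rewrite E; exact: integrableB.
under eq_integral do rewrite E; rewrite integralB // e1 e2.
have /fineK <- := integrable_fin_num measurableT inf.
by rewrite -!EFinM -EFinB; congr EFin; ring.
Qed.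

Variables (V : finType) (X : V -> {RV P >-> R}) (C : set T).
Hypothesis mC : measurable C.
Hypothesis indep : forall A : V -> set R, (forall v, measurable (A v)) ->
  (P (C `&` \bigcap_(v in [set: V]) (X v @^-1` A v)) =
   (rprob C * \prod_v rprob (X v @^-1` A v))%:E)%E.

Let mean (v : V) (g : R -> R) : R := fine (\int[P]_w (g (X v w))%:E)%E.

Let adm (s : seq V) (g : V -> R -> R) := forall v,
  [/\ measurable_fun [set: R] (g v),
      P.-integrable [set: T] (fun w => (g v (X v w))%:E) &
      v \notin s -> exists2 A, measurable A & g v = \1_A].

Let prodg (Q : pred V) (g : V -> R -> R) w : R := \1_C w * \prod_(v | Q v) g v (X v w).

Let meas_prodg Q g : (forall v, measurable_fun [set: R] (g v)) ->
  measurable_fun [set: T] (prodg Q g).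
Proof.
move=> mg; apply: measurable_funM; first exact: measurable_indic.
under eq_fun do rewrite -big_filter.
apply: measurable_prod => v _; exact: measurableT_comp.
Qed.

Let mean_indic v (A : set R) : measurable A -> mean v \1_A = rprob (X v @^-1` A).
Proof.
move=> mA; rewrite /mean /rprob; congr fine.
by have := integral_indic P measurableT (measurable_sfunP (X v) mA); rewrite setIT.
Qed.

(* Induction on the set [s] of indices at which [g] need not be an indicator. *)
Let factor_adm s g : adm s g ->
  P.-integrable [set: T] (fun w => (prodg predT g w)%:E) /\
  (\int[P]_w (prodg predT g w)%:E = (rprob C * \prod_v mean v (g v))%:E)%E.
Proof.
elim: s g => [|v0 s IH] g ag.
  have [A mA] : exists2 A : V -> set R, (forall v, measurable (A v)) & forall v, g v = \1_(A v).
    have /choice[A HA] : forall v, exists A : set R, measurable A /\ g v = \1_A.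
      by move=> v; have [_ _ /(_ isT)[A mA gA]] := ag v; exists A.
    by exists A => v; have [] := HA v.
  move=> gA; have mAX : measurable (\bigcap_(v in [set: V]) (X v @^-1` A v)).
    apply: fin_bigcap_measurable; first exact: finite_finset.
    by move=> v _; exact: measurable_funPTI.
  have mB := measurableI _ _ mC mAX.
  have E w : prodg predT g w =
      \1_(C `&` \bigcap_(v in [set: V]) (X v @^-1` A v)) w.
    rewrite /prodg indicI; congr (_ * _).
    have [inA|ninA] := pselect ((\bigcap_(v in [set: V]) (X v @^-1` A v)) w).
      rewrite indicE mem_set // big1 // => v _.
      by rewrite gA indicE mem_set //; exact: inA.
    rewrite indicE memNset //.
    have [v nv] : exists v, ~ A v (X v w).
      by apply/not_existsP => H; apply: ninA => v _; have := H v; rewrite not_notE.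
    by rewrite (bigD1 v) //= gA indicE memNset // mul0r.
  split.
    under eq_fun do rewrite E.
    exact: integrable_indic.
  under eq_integral do rewrite E.
  rewrite integral_indic // setIT; apply: etrans (indep mA) _; congr (_ * _)%:E.
  by apply: eq_bigr => v _; rewrite gA mean_indic.
have mg v : measurable_fun [set: R] (g v) by have [] := ag v.
pose C' h := rprob C * \prod_(v | v != v0) mean v (h v).
have step h : adm (v0 :: s) h -> forall B : set R, measurable B ->
    P.-integrable [set: T] (fun w => (prodg (predC1 v0) h w * \1_B (X v0 w))%:E) /\
    (\int[P]_w (prodg (predC1 v0) h w * \1_B (X v0 w))%:E =
      (C' h * rprob (X v0 @^-1` B))%:E)%E.
  move=> ah B mB; pose h' v := if v == v0 then \1_B else h v.
  have /IH[ih eh] : adm s h'.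
    move=> v; rewrite /h'; have [->|nv] := eqVneq v v0; last first.
      by have [? ? H] := ah v; split=> // vs; apply: H; rewrite inE negb_or nv.
    split; [exact: measurable_indic| |by move=> _; exists B].
    have -> : (fun w => (\1_B (X v0 w))%:E) = (fun w => (\1_(X v0 @^-1` B) w : R)%:E) by [].
    by apply: integrable_indic; exact: measurable_funPTI.
  have E w : prodg predT h' w = prodg (predC1 v0) h w * \1_B (X v0 w).
    rewrite /prodg (bigD1 v0) //= {1}/h' eqxx mulrCA mulrC; congr (_ * _ * _).
    by apply: eq_bigr => v /negbTE nv; rewrite /h' nv.
  split; first by under eq_fun do rewrite -E.
  under eq_integral do rewrite -E.
  rewrite eh (bigD1 v0) //= {1}/h' eqxx mean_indic // mulrCA mulrC /C'.
  congr (_ * _ * _)%:E.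
  by apply: eq_bigr => v /negbTE nv; rewrite /h' nv.
(* [factor_signed] also needs the weight [|U|], which is the same product formed with the functions
   [|g v|]; indicators are unchanged, so admissibility persists. *)
pose h v t := `|g v t|.
have ah : adm (v0 :: s) h.
  move=> v; have [m1 i1 H] := ag v; split.
  - exact: measurableT_comp.
  - apply: le_integrable i1 => // [|w _]; last by rewrite /= normr_id.
    by apply/measurable_EFinP; apply: measurableT_comp => //; exact: measurableT_comp.
  - move=> /H[B mB gB]; exists B => //; apply/funext => t.
    by rewrite /h gB ger0_norm // indicE; case: (_ \in _).
have absE w : `|prodg (predC1 v0) g w| = prodg (predC1 v0) h w.
  rewrite /prodg normrM normr_prod; congr (_ * _).
  by rewrite indicE; case: (_ \in _); rewrite ?normr1 ?normr0.
have [m0 i0 _] := ag v0.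
have iU : P.-integrable [set: T] (fun w => (prodg (predC1 v0) g w)%:E).
  have [+ _] := step g ag setT measurableT.
  by apply: eq_integrable => // w _; rewrite indicT mulr1.
have [] := @factor_signed (X v0) (prodg (predC1 v0) g) (C' g) (C' h) (g v0)
  (@meas_prodg _ _ mg) iU (fun B mB => (step g ag B mB).2) _ m0 i0.
  by move=> B mB; under eq_integral do rewrite absE; exact: (step h ah B mB).2.
have E w : prodg predT g w = prodg (predC1 v0) g w * g v0 (X v0 w).
  by rewrite /prodg (bigD1 v0) //= mulrCA mulrC.
move=> ii ei; split; first by under eq_fun do rewrite E.
under eq_integral do rewrite E.
rewrite ei -(fineK (integrable_fin_num measurableT i0)) -EFinM; congr EFin.
by rewrite (bigD1 v0) //= [in RHS]mulrCA mulrC.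
Qed.

Lemma integral_factor (f : V -> R -> R) :
    (forall v, measurable_fun [set: R] (f v)) ->
    (forall v, P.-integrable [set: T] (fun w => (f v (X v w))%:E)) ->
  P.-integrable [set: T] (fun w => (\1_C w * \prod_v f v (X v w))%:E) /\
  (\int[P]_w (\1_C w * \prod_v f v (X v w))%:E =
   (fine (P C) * \prod_v fine (\int[P]_w (f v (X v w))%:E))%:E)%E.
Proof.
move=> mf inf; apply: (@factor_adm (enum V)) => v; split=> //.
by rewrite mem_enum.
Qed.

End Factorization.

Lemma g_sigma_fin_bigcap (T : pointedType) (G : set (set T)) (I : finType)
    (A : I -> set T) :
  (forall i, <<s G >> (A i)) -> <<s G >> (\bigcap_(i in [set: I]) A i).
Proof.
move=> GA; apply: (@fin_bigcap_measurable _ (g_sigma_algebraType G)).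
  exact: finite_finset.
by move=> i _; exact: GA.
Qed.

Section Prior.
Context d (T : measurableType d) (R : realType) (P : probability T R).

Lemma mutually_independentT (I : finType) (F : I -> set (set T)) (A : I -> set T) :
    mutually_independent P F -> (forall i, F i (A i)) ->
  P (\bigcap_(i in [set: I]) A i) = (\prod_i P (A i))%E.
Proof.
move=> indF FA; have := indF [set: I]%SET A (fun i _ => FA i).
rewrite (_ : [set` _] = setT); last by apply/seteqP; split=> // i _ /=; rewrite finset.inE.
by move=> ->; apply: eq_bigl => i; rewrite finset.inE.
Qed.

Variables (n p K : nat) (sigma Delta : R) (kstar : T -> {ffun 'I_n -> 'I_K})
  (mu : 'I_K -> 'I_p -> {RV P >-> R}) (E : 'I_n -> 'I_p -> {RV P >-> R}).
Hypotheses (prior : gaussian_mixture_prior sigma Delta kstar mu E).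

Definition latent (v : 'I_K * 'I_p + 'I_n * 'I_p) : {RV P >-> R} :=
  match v with inl kj => mu kj.1 kj.2 | inr ij => E ij.1 ij.2 end.

Definition latent_sd (v : 'I_K * 'I_p + 'I_n * 'I_p) : R :=
  if v is inl _ then Num.sqrt (p%:R^-1 * Delta ^+ 2 * sigma ^+ 2) else sigma.

Lemma measurable_label a : measurable (kstar @^-1` [set a]).
Proof.
apply: (kstar_measurable prior); exists [set a] => //.
by rewrite setTI.
Qed.

(** Labels, centers and noise are first separated as three classes: the intersections [B1] and [B2]
    belong to the generated sigma-algebras. Each of them then splits within its own family. *)
Lemma latent_independent a (A : 'I_K * 'I_p + 'I_n * 'I_p -> set R) :
    (forall v, measurable (A v)) ->
  P (kstar @^-1` [set a] `&` \bigcap_(v in setT) (latent v @^-1` A v)) =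
  (fine (P (kstar @^-1` [set a])) * \prod_v fine (P (latent v @^-1` A v)))%:E.
Proof.
move=> mA.
pose B1 := \bigcap_(kj in [set: 'I_K * 'I_p]) (latent (inl kj) @^-1` A (inl kj)).
pose B2 := \bigcap_(ij in [set: 'I_n * 'I_p]) (latent (inr ij) @^-1` A (inr ij)).
have S (v : 'I_K * 'I_p + 'I_n * 'I_p) : sigma_real (latent v) (latent v @^-1` A v).
  by exists (A v) => //; rewrite setTI.
have e1 := mutually_independentT (mu_independent prior) (fun kj => S (inl kj)).
have e2 := mutually_independentT (E_independent prior) (fun ij => S (inr ij)).
have indB : P (kstar @^-1` [set a] `&` (B1 `&` B2)) =
    (P (kstar @^-1` [set a]) * (P B1 * P B2))%E.
  have := mutually_independentT (A := tnth [tuple kstar @^-1` [set a]; B1; B2])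
    (kstar_mu_E_independent prior).
  rewrite !big_ord_recl big_ord0 mule1 !(tnth_nth set0) /= => <-.
    congr (P _); apply/seteqP; split=> w.
      move=> [wC [w1 w2]] i _; case: i => -[|[|[|//]]] /= ?;
        by rewrite (tnth_nth set0).
    move=> H; split; first by have := H ord0 I; rewrite (tnth_nth set0).
    split; first by have := H (inord 1) I; rewrite (tnth_nth set0) inordK.
    by have := H (inord 2) I; rewrite (tnth_nth set0) inordK.
  move=> i; case: i => -[|[|[|//]]] /= ?; rewrite !(tnth_nth set0) /=.
  - by exists [set a] => //; rewrite setTI.
  - apply: g_sigma_fin_bigcap => kj; apply: sub_gen_smallest; exists kj => //.
    exact: S (inl kj).
  - apply: g_sigma_fin_bigcap => ij; apply: sub_gen_smallest; exists ij => //.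
    exact: S (inr ij).
have fin v : P (latent v @^-1` A v) = (fine (P (latent v @^-1` A v)))%:E.
  by rewrite fineK // fin_num_measure //; exact: measurable_funPTI.
rewrite (_ : \bigcap_(v in setT) _ = B1 `&` B2); last first.
  apply/seteqP; split=> [w H|w [H1 H2] [v|v] _]; [|exact: H1|exact: H2].
  by split=> v _; [exact: (H (inl v)) | exact: (H (inr v))].
rewrite indB big_sumType /= !EFinM -!prodEFin fineK; last first.
  by rewrite fin_num_measure //; exact: measurable_label.
congr (_ * (_ * _))%E.
  by apply: etrans e1 _; apply: eq_bigr => v _; exact: fin (inl v).
by apply: etrans e2 _; apply: eq_bigr => v _; exact: fin (inr v).
Qed.

Hypotheses (sigma_gt0 : 0 < sigma)
  (lambda_gt0 : 0 < Num.sqrt (p%:R^-1 * Delta ^+ 2 * sigma ^+ 2)).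

Lemma latent_moments a (m : 'I_K * 'I_p + 'I_n * 'I_p -> nat) :
  P.-integrable [set: T]
    (fun w => (\1_(kstar @^-1` [set a]) w * \prod_v latent v w ^+ m v)%:E) /\
  (\int[P]_w (\1_(kstar @^-1` [set a]) w * \prod_v latent v w ^+ m v)%:E =
   ((K%:R ^+ n)^-1 * \prod_v normal_moment (latent_sd v) (m v))%:E)%E.
Proof.
have H v : P.-integrable [set: T] (fun w => (latent v w ^+ m v)%:E) /\
    (\int[P]_w (latent v w ^+ m v)%:E = (normal_moment (latent_sd v) (m v))%:E)%E.
  apply: centered_normal_moment; first by case: v.
  by case: v => v; [exact: mu_normal prior _ _ | exact: E_normal prior _ _].
have [] := integral_factor (measurable_label a) (latent_independent a)
  (f := fun v t => t ^+ m v) _ (fun v => (H v).1).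
  by move=> v; exact: exprn_measurable.
move=> ? ->; split=> //; rewrite (kstar_uniform prior) /=.
by congr (_ * _)%:E; apply: eq_bigr => v _; rewrite (H v).2.
Qed.
End Prior.

Lemma mpoly_mul_ind (R : realType) (N : nat) (P : mpoly N R -> Prop) :
    (forall a f g, P f -> P g -> P (a *: f + g)) -> P 1 ->
    (forall j f, P f -> P (mpolyX R (mnm1 j) * f)) -> forall f, P f.
Proof.
move=> Pl P1 PX f.
apply: (@mpoly_deg_ind _ _ (fun _ => P)) (leqnSn _) => //.
  by move=> _; rewrite -(addNr 1) -scaleN1r; exact: Pl.
by move=> k j g gk H; apply: PX; exact: H.
Qed.

(** * Moments of the observation *)

Section Extension.
Variables (R : realType) (N : nat) (phi : multinom N -> R).
Local Notation MP := (mpoly N R).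

(** Prescribing values on monomials makes a Gaussian law a functional on polynomials, without any
    integral. *)
Definition monomial_extension (f : MP) : R :=
  \sum_(m <- msupp f) mcoeff m f * phi m.

Lemma monomial_extensionE (s : seq (multinom N)) f :
    uniq s -> {subset msupp f <= s} ->
  monomial_extension f = \sum_(m <- s) mcoeff m f * phi m.
Proof.
move=> us fs; rewrite [RHS](bigID (fun m => m \in msupp f)) /=.
rewrite [X in _ = _ + X]big1 ?addr0; last first.
  by move=> m nm; rewrite memN_msupp_eq0 ?mul0r //.
rewrite -big_filter; apply: perm_big; apply: uniq_perm.
- exact: msupp_uniq.
- exact: filter_uniq.
- by move=> m; rewrite mem_filter; case: (boolP (m \in msupp f)) => // /fs ->.
Qed.

Lemma monomial_extension_linear : linear_for *%R monomial_extension.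
Proof.
move=> a f g; pose s := undup (msupp f ++ msupp g ++ msupp (a *: f + g)).
have us : uniq s by exact: undup_uniq.
have sub h : {subset msupp h <= msupp f ++ msupp g ++ msupp (a *: f + g)} ->
    monomial_extension h = \sum_(m <- s) mcoeff m h * phi m.
  by move=> H; apply: monomial_extensionE => // m /H; rewrite mem_undup.
rewrite !sub; try by move=> m hm; rewrite !mem_cat hm ?orbT.
rewrite mulr_sumr -big_split; apply: eq_bigr => m _ /=.
by rewrite mcoeffD mcoeffZ mulrDl mulrA.
Qed.

HB.instance Definition _ :=
  GRing.isLinear.Build R MP R _ monomial_extension monomial_extension_linear.

Lemma monomial_extensionX m : monomial_extension (mpolyX R m) = phi m.
Proof. by rewrite /monomial_extension msuppX big_seq1 mcoeffX eqxx mul1r. Qed.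

End Extension.

Section LinearForms.
Variables (R : realType) (N N' : nat) (b : 'I_N -> 'I_N' -> R).

Definition linear_form l : mpoly N' R :=
  \sum_v b l v *: mpolyX R (mnm1 v).

Definition substitute (f : mpoly N R) : mpoly N' R :=
  comp_mpoly [tuple linear_form l | l < N] f.

Lemma substitute_is_linear : linear substitute.
Proof. by move=> a f g; rewrite /substitute linearP. Qed.

HB.instance Definition _ := GRing.isLinear.Build R (mpoly N R) (mpoly N' R) _
  substitute substitute_is_linear.

Lemma substitute1 : substitute 1 = 1. Proof. exact: comp_mpoly1. Qed.

Lemma substituteM f g : substitute (f * g) = substitute f * substitute g.
Proof. exact: rmorphM. Qed.

Lemma substituteX l : substitute (mpolyX R (mnm1 l)) = linear_form l.
Proof. by rewrite /substitute comp_mpolyXU -tnth_nth tnth_mktuple. Qed.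

Lemma mderiv_linear_formM l v f : mderiv v (linear_form l * f) =
  linear_form l * mderiv v f + b l v *: f.
Proof.
rewrite /linear_form !mulr_suml linear_sum (bigD1 v) //= [in RHS](bigD1 v) //=.
rewrite -!scalerAl linearZ /= mderivXM eqxx scale1r scalerDr addrAC; congr (_ + _ + _).
apply: eq_bigr => w /negbTE wv; rewrite -!scalerAl linearZ /= mderivXM eq_sym wv.
by rewrite scale0r addr0.
Qed.

Lemma mderiv_substitute v f :
  mderiv v (substitute f) = \sum_l b l v *: substitute (mderiv l f).
Proof.
elim/mpoly_mul_ind: f => [a f g IHf IHg||j f IH].
- rewrite substitute_is_linear [LHS]linearP /= IHf IHg scaler_sumr -big_split.
  by apply: eq_bigr => l _ /=; rewrite linearP substitute_is_linear scalerDr !scalerA mulrC.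
- by rewrite substitute1 mderiv1 big1 // => l _; rewrite mderiv1 linear0 scaler0.
rewrite substituteM substituteX mderiv_linear_formM IH mulr_sumr.
under [RHS]eq_bigr do
  rewrite mderivXM linearD linearZ /= substituteM substituteX scalerDr.
rewrite big_split /=; congr (_ + _).
  by apply: eq_bigr => l _; rewrite scalerAr.
rewrite (bigD1 j) //= eqxx scale1r big1 ?addr0 // => l /negbTE ->.
by rewrite scale0r scaler0.
Qed.

(* A linear image of a centered Gaussian vector is Gaussian. *)
Lemma ibp_substitute (m : {scalar mpoly N' R}) (c : 'I_N' -> R) :
    ibp (fun v w => (v == w)%:R * c v) m ->
  ibp (fun l l' => \sum_v c v * (b l v * b l' v)) (fun f => m (substitute f)).
Proof.
move=> mX l f; rewrite substituteM substituteX /linear_form mulr_suml linear_sum.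
under [RHS]eq_bigr do rewrite mulr_suml.
rewrite exchange_big /=; apply: eq_bigr => v _.
rewrite -scalerAl linearZ /= mX (bigD1 v) //= eqxx mul1r big1 ?addr0; last first.
  by move=> w /negbTE wv; rewrite eq_sym wv !mul0r.
rewrite mderiv_substitute linear_sum !mulr_sumr; apply: eq_bigr => l' _.
by rewrite linearZ /=; ring.
Qed.

End LinearForms.

Section GaussianFunctional.
Variables (R : realType) (N : nat) (s : 'I_N -> R).

Definition gaussian : mpoly N R -> R :=
  monomial_extension (fun m : multinom N => \prod_v normal_moment (s v) (m v)).

HB.instance Definition _ := GRing.Linear.on gaussian.

Lemma gaussianX m : gaussian (mpolyX R m) = \prod_v normal_moment (s v) (m v).
Proof. exact: monomial_extensionX. Qed.

Lemma gaussian1 : gaussian 1 = 1.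
Proof. by rewrite -mpolyX0 gaussianX big1 // => v _; rewrite mnm0E. Qed.

Lemma gaussian_ibp : ibp (fun v w => (v == w)%:R * s v ^+ 2) gaussian.
Proof.
move=> j f; rewrite (bigD1 j) //= eqxx mul1r big1 ?addr0; last first.
  by move=> w /negbTE wv; rewrite eq_sym wv !mul0r.
elim/mpolyind: f => [|a m f _ _ IH]; first by rewrite mulr0 !linear0 mulr0.
rewrite mulrDr -scalerAr !linearP /= IH mulrDr mulrCA; congr (a * _ + _).
rewrite -mpolyXD mderivX linearZ /= !gaussianX (bigD1 j) //= [in RHS](bigD1 j) //=.
rewrite mnmDE mnmBE !mnm1E eqxx add1n.
rewrite (eq_bigr (fun v => normal_moment (s v) (m v))); last first.
  by move=> v vj; rewrite mnmDE mnm1E eq_sym (negbTE vj).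
rewrite [in RHS](eq_bigr (fun v => normal_moment (s v) (m v))); last first.
  by move=> v vj; rewrite mnmBE mnm1E eq_sym (negbTE vj) subn0.
by case: (m j) => [|k] /=; [ring | rewrite subSS subn0; ring].
Qed.

End GaussianFunctional.

Section Model.
Variables (R : realType) (n p K : nat) (sigma Delta : R).
Local Notation W := ('I_K * 'I_p + 'I_n * 'I_p)%type.
Local Notation lambda := (Num.sqrt (p%:R^-1 * Delta ^+ 2 * sigma ^+ 2)).

Definition mxvec_pos (l : 'I_(n * p)) : 'I_n * 'I_p :=
  enum_val (cast_ord (esym (mxvec_cast n p)) l).

Lemma mxvec_posK : cancel mxvec_pos (fun ij => mxvec_index ij.1 ij.2).
Proof.
by move=> l; rewrite /mxvec_index /mxvec_pos -surjective_pairing enum_valK cast_ordKV.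
Qed.

Lemma mxvec_indexK i j : mxvec_pos (mxvec_index i j) = (i, j).
Proof. by rewrite /mxvec_pos /mxvec_index cast_ordK enum_rankK. Qed.

Implicit Type a : {ffun 'I_n -> 'I_K}.

(** Given the labels [a], the entry [l] of the observation is this 0-1 combination of the latent
    variables: one center coordinate plus one noise variable. *)
Definition incidence a (l : 'I_(n * p)) (v : 'I_#|{: W}|) : R :=
  match enum_val v with
  | inl kj => ((a (mxvec_pos l).1, (mxvec_pos l).2) == kj)%:R
  | inr ij => (mxvec_pos l == ij)%:R
  end.

Definition cond_moment a (f : mpoly (n * p) R) : R :=
  gaussian (fun v : 'I_#|{: W}| => latent_sd sigma Delta (enum_val v))
    (substitute (incidence a) f).

Lemma cond_moment_is_linear a : linear_for *%R (cond_moment a).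
Proof. by move=> c f g; rewrite /cond_moment substitute_is_linear linearP. Qed.

HB.instance Definition _ a := GRing.isLinear.Build R (mpoly (n * p) R) R _
  (cond_moment a) (cond_moment_is_linear a).

Lemma cond_moment1 a : cond_moment a 1 = 1.
Proof. by rewrite /cond_moment substitute1 gaussian1. Qed.

(** The vectors whose rank-one squares make up the excess of the conditional covariance over
    [sigma ^+ 2] times the identity, in the form that [pairing_ge_bessel] asks for. *)
Definition center_profile a (kj : 'I_K * 'I_p) (l : 'I_(n * p)) : R :=
  lambda * ((a (mxvec_pos l).1, (mxvec_pos l).2) == kj)%:R.

Definition cond_cov a (l l' : 'I_(n * p)) : R :=
  sigma ^+ 2 * delta R l l' + \sum_kj center_profile a kj l * center_profile a kj l'.

Lemma cond_moment_ibp a : ibp (cond_cov a) (cond_moment a).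
Proof.
pose sd (v : 'I_#|{: W}|) : R := latent_sd sigma Delta (enum_val v).
have H := @ibp_substitute R _ _ (incidence a) (gaussian sd) (fun v => sd v ^+ 2)
  (gaussian_ibp sd).
move=> l f; rewrite [LHS](H l f); apply: eq_bigr => l' _; congr (_ * _).
rewrite /cond_cov (reindex (fun w : W => enum_rank w)) /=; last first.
  by exists enum_val => v _; rewrite ?enum_rankK ?enum_valK.
rewrite big_sumType /= addrC; congr (_ + _).
  rewrite (bigD1 (mxvec_pos l)) //= big1 ?addr0 => [|ij].
    rewrite /incidence enum_rankK eqxx mul1r /=; congr (_ * _).
      by rewrite /sd enum_rankK.
    by rewrite /delta eq_sym (can_eq mxvec_posK).
  by rewrite eq_sym /incidence enum_rankK => /negbTE ->; rewrite mul0r mulr0.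
apply: eq_bigr => kj _; rewrite /incidence /sd enum_rankK /center_profile /=; ring.
Qed.

Lemma cond_covE a l l' : cond_cov a l l' = sigma ^+ 2 * delta R l l' +
  lambda ^+ 2 * ((a (mxvec_pos l).1 == a (mxvec_pos l').1) &&
                 ((mxvec_pos l).2 == (mxvec_pos l').2))%:R.
Proof.
congr (_ + _); rewrite (bigD1 (a (mxvec_pos l).1, (mxvec_pos l).2)) //= big1 ?addr0.
  rewrite /center_profile eqxx mulr1 mulrA -expr2; congr (_ * _%:R).
  by congr nat_of_bool; rewrite eq_sym xpair_eqE.
by move=> kj; rewrite eq_sym /center_profile => /negbTE ->; rewrite mulr0 mul0r.
Qed.

End Model.

Section Risk.
Context d (T : measurableType d) (R : realType) (P : probability T R).
Variables (n p K : nat) (sigma Delta : R) (kstar : T -> {ffun 'I_n -> 'I_K})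
  (mu : 'I_K -> 'I_p -> {RV P >-> R}) (E : 'I_n -> 'I_p -> {RV P >-> R}).
Hypotheses (prior : gaussian_mixture_prior sigma Delta kstar mu E)
  (sigma_gt0 : 0 < sigma)
  (lambda_gt0 : 0 < Num.sqrt (p%:R^-1 * Delta ^+ 2 * sigma ^+ 2)).
Local Notation W := ('I_K * 'I_p + 'I_n * 'I_p)%type.

Let point w (v : 'I_#|{: W}|) : R := latent mu E (enum_val v) w.
Let sd (v : 'I_#|{: W}|) : R := latent_sd sigma Delta (enum_val v).

Lemma label_integral a (h : mpoly #|{: W}| R) :
  P.-integrable [set: T]
    (fun w => (\1_(kstar @^-1` [set a]) w * meval (point w) h)%:E) /\
  (\int[P]_w (\1_(kstar @^-1` [set a]) w * meval (point w) h)%:E =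
   ((K%:R ^+ n)^-1 * gaussian sd h)%:E)%E.
Proof.
elim/mpolyind: h => [|c m h _ _ [ih eh]].
  under eq_fun do rewrite meval0 mulr0.
  by rewrite integral0 linear0 mulr0; split=> //; exact: integrable0.
have [im em] := latent_moments prior sigma_gt0 lambda_gt0 a (fun v => m (enum_rank v)).
have mE w : meval (point w) (mpolyX R m) = \prod_v latent mu E v w ^+ m (enum_rank v).
  rewrite mevalX (reindex (fun v : W => enum_rank v)) /=; last first.
    by exists enum_val => v _; rewrite ?enum_rankK ?enum_valK.
  by apply: eq_bigr => v _; rewrite /point enum_rankK.
have e w : (\1_(kstar @^-1` [set a]) w * meval (point w) (c *: mpolyX R m + h))%:E =
    (c%:E * (\1_(kstar @^-1` [set a]) w * \prod_v latent mu E v w ^+ m (enum_rank v))%:E +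
    (\1_(kstar @^-1` [set a]) w * meval (point w) h)%:E)%E.
  rewrite mevalD mevalZ mE -EFinM -EFinD; congr EFin; ring.
have ic := integrableZl measurableT (c : R) im.
split; first by under eq_fun do rewrite e; exact: integrableD.
under eq_integral do rewrite e.
rewrite integralD // integralZl // em eh -EFinM -EFinD; congr EFin.
rewrite linearP /= gaussianX [in RHS](reindex (fun v : W => enum_rank v)) /=; last first.
  by exists enum_val => v _; rewrite ?enum_rankK ?enum_valK.
under [in RHS]eq_bigr do rewrite /sd enum_rankK.
ring.
Qed.

Lemma risk_eq (x : {ffun 'I_n -> 'I_K} -> R) (f : mpoly (n * p) R) :
  (forall a, x a ^+ 2 = x a) ->
  ('E_P[fun w => ((meval_mx f (observation kstar mu E w) - x (kstar w)) ^+ 2)%R] =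
   ((K%:R ^+ n)^-1 * \sum_a (cond_moment sigma Delta a (f * f) -
     2 * (x a * cond_moment sigma Delta a f) + x a))%:E)%E.
Proof.
(* On the event that the labels are [a], the squared error is the polynomial [h a] in the latent
   variables. *)
move=> xx; pose h a := (substitute (incidence R a) f - mpolyC _ (x a)) ^+ 2.
have gh a : gaussian sd (h a) = cond_moment sigma Delta a (f * f) -
     2 * (x a * cond_moment sigma Delta a f) + x a.
  have -> : h a = substitute (incidence R a) (f * f) -
      (2 * x a) *: substitute (incidence R a) f + (x a) *: 1.
    rewrite /h sqrrB substituteM -expr2; congr (_ - _ + _).
      by rewrite mulrC mul_mpolyC scalerMnl mulr_natl.
    by rewrite alg_mpolyC expr2 -mpolyCM -expr2 xx.
  rewrite linearD linearB [in X in _ - X]linearZ [in X in _ + X]linearZ /=.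
  by rewrite gaussian1 mulr1 /cond_moment -/sd mulrA.
have e w : ((meval_mx f (observation kstar mu E w) - x (kstar w)) ^+ 2)%:E =
    (\sum_a (\1_(kstar @^-1` [set a]) w * meval (point w) (h a))%:E)%E.
  rewrite (bigD1 (kstar w)) //= big1 ?adde0; last first.
    by move=> a ak; rewrite indicE memNset ?mul0r //= => H; rewrite -H eqxx in ak.
  rewrite indicE mem_set // mul1r /h rmorphXn rmorphB /= mevalC; congr ((_ - _) ^+ 2)%:E.
  rewrite /substitute comp_mpoly_meval /meval_mx.
  apply: meval_eq => l; rewrite tnth_mktuple /linear_form.
  rewrite -{1}[l]mxvec_posK mxvecE mxE.
  rewrite raddf_sum /=; under eq_bigr do rewrite mevalZ mevalXU.
  rewrite (reindex (fun v : W => enum_rank v)) /=; last first.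
    by exists enum_val => v _; rewrite ?enum_rankK ?enum_valK.
  rewrite big_sumType /=; congr (_ + _).
    rewrite (bigD1 (kstar w (mxvec_pos l).1, (mxvec_pos l).2)) //= big1 ?addr0.
      by rewrite /point /incidence enum_rankK eqxx mul1r.
    by move=> kj; rewrite eq_sym /incidence enum_rankK => /negbTE ->; rewrite mul0r.
  rewrite (bigD1 (mxvec_pos l)) //= big1 ?addr0.
    by rewrite /point /incidence enum_rankK eqxx mul1r.
  by move=> kj; rewrite eq_sym /incidence enum_rankK => /negbTE ->; rewrite mul0r.
rewrite unlock; under eq_integral do rewrite e.
rewrite integral_sum //; last by move=> a; exact: (label_integral a (h a)).1.
rewrite mulr_sumr -sumEFin; apply: eq_bigr => a _.
by rewrite (label_integral a (h a)).2 gh.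
Qed.
End Risk.

(** * Inner products of rows of the observation *)

Section PairForms.
Variables (R : realType) (n p : nat).
Local Notation MP := (mpoly (n * p) R).
Local Notation Xv j := (mpolyX R (mnm1 j)).

Definition fst_entry (e : 'I_n * 'I_n) (j : 'I_p) := mxvec_index e.1 j.
Definition snd_entry (e : 'I_n * 'I_n) (j : 'I_p) := mxvec_index e.2 j.
Local Notation quad := (@quad R _ _ _ fst_entry snd_entry).
Local Notation dquad := (@dquad R _ _ _ fst_entry snd_entry).

Lemma mxvec_index_eq i j i' j' :
  (mxvec_index i j == mxvec_index i' j' :> 'I_(n * p)) = (i == i') && (j == j').
Proof.
rewrite -(inj_eq (can_inj (@mxvec_posK n p))) !mxvec_indexK.
exact: xpair_eqE.
Qed.

Lemma sum_mxvec (F : 'I_(n * p) -> MP) :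
  \sum_l F l = \sum_i \sum_j F (mxvec_index i j).
Proof.
rewrite pair_bigA /= (reindex (fun ij : 'I_n * 'I_p => mxvec_index ij.1 ij.2)) //.
by exists (@mxvec_pos n p) => l _; rewrite ?mxvec_posK // mxvec_indexK -surjective_pairing.
Qed.

Lemma mderivXn l (q : MP) s : mderiv l (q ^+ s.+1) = s.+1%:R *: (q ^+ s * mderiv l q).
Proof.
elim: s => [|s IH]; first by rewrite expr1 expr0 mul1r scale1r.
rewrite exprS mderivM IH -scalerAr mulrA -exprS [mderiv l q * _]mulrC.
by rewrite -{1}[_ * _]scale1r -scalerDl -mulrS.
Qed.

Definition column_sum (j : 'I_p) : MP := \sum_i Xv (mxvec_index i j).

Lemma sum_quad : \sum_e quad e = \sum_j column_sum j ^+ 2.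
Proof.
rewrite /quad exchange_big; apply: eq_bigr => j _ /=.
rewrite expr2 mulr_suml; under [RHS]eq_bigr do rewrite mulr_sumr.
by rewrite pair_bigA.
Qed.

Lemma mderiv_column_sum i j j' :
  mderiv (mxvec_index i j) (column_sum j') = (j == j')%:R.
Proof.
rewrite /column_sum linear_sum (bigD1 i) //= big1 ?addr0 => [|i' ii'].
  rewrite mderivX mnm1E mxvec_index_eq eqxx eq_sym /=.
  case: eqVneq => [->|_]; last by rewrite scale0r.
  rewrite scale1r (_ : mnm_sub _ _ = mnm0) ?mpolyX0 //.
  by apply/mnmP => k; rewrite mnmBE subnn mnm0E.
by rewrite mderivX mnm1E mxvec_index_eq (negbTE ii') scale0r.
Qed.

Lemma mderiv_sum_quad i j :
  mderiv (mxvec_index i j) (\sum_e quad e) = 2%:R *: column_sum j.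
Proof.
rewrite sum_quad linear_sum (bigD1 j) //= big1 ?addr0 => [|j' jj'].
  by rewrite mderivXn mderiv_column_sum eqxx mulr1 expr1.
by rewrite mderivXn mderiv_column_sum eq_sym (negbTE jj') mulr0 scaler0.
Qed.

(** On functions of the column sums, every [dquad e] acts as the Laplacian in dimension [p], and the
    Laplacian of [|x|^(2s+2)] is [(2s+2)(2s+p) |x|^(2s)]. The coefficient does not depend on [e],
    which makes the Schur test explicit. *)
Lemma dquad_sum_quad_exp e s :
  dquad e ((\sum_e quad e) ^+ s.+1) =
  (2 * s.+1%:R * (p + s.*2)%:R) *: (\sum_e quad e) ^+ s.
Proof.
set q := \sum_e _.
have H j : mderiv (snd_entry e j) (mderiv (fst_entry e j) (q ^+ s.+1)) =
    (2 * s.+1%:R) *: (q ^+ s + (s%:R * 2) *: (q ^+ s.-1 * column_sum j ^+ 2)).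
  rewrite mderivXn mderiv_sum_quad linearZ /= -scalerAr linearZ /= scalerA mulrC.
  congr (_ *: _); rewrite mderivM mderiv_column_sum eqxx mulr1 addrC; congr (_ + _).
  case: s => [|s]; first by rewrite expr0 mderiv1 mul0r mulr0n mul0r scale0r.
  rewrite mderivXn mderiv_sum_quad -scalerAr -!scalerAl scalerA expr2 mulrA.
  done.
rewrite /dquad; under eq_bigr do rewrite H.
rewrite -scaler_sumr big_split /= sumr_const card_ord -scaler_sumr -mulr_sumr -sum_quad -/q.
rewrite -[RHS]scalerA; congr (_ *: _).
case: s {H} => [|s]; first by rewrite mulr0n mul0r scale0r addr0 addn0 scaler_nat.
rewrite -exprSr -scaler_nat -scalerDl; congr (_ *: _).
by rewrite natrD -mul2n natrM [2 * _]mulrC.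
Qed.

Lemma dquadXM e i j f : dquad e (Xv (mxvec_index i j) * f) =
  Xv (mxvec_index i j) * dquad e f +
  ((e.1 == i)%:R *: mderiv (snd_entry e j) f + (e.2 == i)%:R *: mderiv (fst_entry e j) f).
Proof.
rewrite /dquad mulr_sumr.
have H k : mderiv (snd_entry e k) (mderiv (fst_entry e k) (Xv (mxvec_index i j) * f)) =
    Xv (mxvec_index i j) * mderiv (snd_entry e k) (mderiv (fst_entry e k) f) +
    (k == j)%:R *: ((e.1 == i)%:R *: mderiv (snd_entry e k) f +
                    (e.2 == i)%:R *: mderiv (fst_entry e k) f).
  rewrite mderivXM linearD linearZ /= mderivXM -addrA; congr (_ + _).
  rewrite /snd_entry /fst_entry !mxvec_index_eq scalerDr !scalerA -!natrM !mulnb.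
  rewrite addrC; congr (_ *: _ + _ *: _); by rewrite andbC.
under eq_bigr do rewrite H.
rewrite big_split /=; congr (_ + _).
rewrite (bigD1 j) //= eqxx scale1r big1 ?addr0 // => k /negbTE ->.
by rewrite scale0r.
Qed.

End PairForms.

Section CondExpansion.
Variables (R : realType) (n p K' : nat) (sigma Delta : R).
Local Notation MP := (mpoly (n * p) R).
Local Notation Xv j := (mpolyX R (mnm1 j)).
Local Notation K := K'.+1.
Local Notation lambda := (Num.sqrt (p%:R^-1 * Delta ^+ 2 * sigma ^+ 2)).
Local Notation col := {ffun 'I_n -> 'I_K}.
Local Notation quad := (@quad R _ _ _ (@fst_entry n p) (@snd_entry n p)).
Local Notation dquad := (@dquad R _ _ _ (@fst_entry n p) (@snd_entry n p)).
Local Notation theta := (@theta R _ _ _ (@fst_entry n p) (@snd_entry n p)).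
Implicit Types (a : col) (f : MP).
Local Notation La a := (@cond_moment R n p K sigma Delta a).

Let same_label a (e : 'I_n * 'I_n) : R := (a e.1 == a e.2)%:R.
Let Q0 a f : MP := \sum_e same_label a e *: dquad e f.

Let Q0_linear a : linear (Q0 a).
Proof.
move=> c f g; rewrite scaler_sumr -big_split; apply: eq_bigr => e _ /=.
by rewrite linearP scalerDr !scalerA mulrC.
Qed.

Let Q a f : MP := (lambda ^+ 2 / 2) *: Q0 a f.

Let Q_linear a : linear (Q a).
Proof. by move=> c f g; rewrite /Q Q0_linear scalerDr !scalerA mulrC. Qed.

HB.instance Definition _ a := GRing.isLinear.Build R MP MP _ (Q a) (@Q_linear a).

Let iterQ a s f : iter s (Q a) f = (lambda ^+ 2 / 2) ^+ s *: iter s (Q0 a) f.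
Proof.
elim: s => [|s IH]; first by rewrite expr0 scale1r.
rewrite !iterS IH /Q -[X in Q0 a X]addr0 Q0_linear.
rewrite [Q0 a 0](_ : _ = 0) ?addr0 ?scalerA ?exprS //.
by rewrite /Q0 big1 // => e _; rewrite linear0 scaler0.
Qed.

Let spread a (j l : 'I_(n * p)) : R := lambda ^+ 2 *
  ((a (mxvec_pos j).1 == a (mxvec_pos l).1) && ((mxvec_pos j).2 == (mxvec_pos l).2))%:R.

Let QX a j f : Q a (Xv j * f) = Xv j * Q a f + \sum_l spread a j l *: mderiv l f.
Proof.
rewrite -[j]mxvec_posK; case: (mxvec_pos j) => r c /=.
rewrite /Q /Q0; under [in LHS]eq_bigr do rewrite dquadXM scalerDr scalerAr.
rewrite big_split /= -mulr_sumr scalerDr scalerAr; congr (_ + _).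
under eq_bigr do rewrite scalerDr.
rewrite big_split /=.
(* [Xv j] can be hit through either end of the pair; the two contributions agree by symmetry and
   cancel the factor 1/2 in [Q]. *)
have -> : \sum_(e : 'I_n * 'I_n) same_label a e *: ((e.1 == r)%:R *: mderiv (snd_entry e c) f) =
    \sum_i (a r == a i)%:R *: mderiv (mxvec_index i c) f.
  rewrite -(pair_bigA _ (fun i i' => (a i == a i')%:R *: ((i == r)%:R *:
    mderiv (mxvec_index i' c) f))) /= (bigD1 r) //= [X in _ + X]big1 ?addr0.
    by apply: eq_bigr => i _; rewrite eqxx scale1r.
  by move=> i /negbTE ir; apply: big1 => i' _; rewrite ir scale0r scaler0.
have -> : \sum_(e : 'I_n * 'I_n) same_label a e *: ((e.2 == r)%:R *: mderiv (fst_entry e c) f) =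
    \sum_i (a r == a i)%:R *: mderiv (mxvec_index i c) f.
  rewrite -(pair_bigA _ (fun i i' => (a i == a i')%:R *: ((i' == r)%:R *:
    mderiv (mxvec_index i c) f))) /=; apply: eq_bigr => i _.
  rewrite (bigD1 r) //= [X in _ + X]big1 ?addr0; first by rewrite eqxx scale1r eq_sym.
  by move=> i' /negbTE ->; rewrite scale0r scaler0.
rewrite sum_mxvec -mulr2n -scalerMnr scalerMnl.
rewrite -(mulr_natr (_ / _)) divfK ?pnatr_eq0 //.
rewrite scaler_sumr; apply: eq_bigr => i _; rewrite (bigD1 c) //= big1 ?addr0.
  by rewrite /spread !mxvec_indexK eqxx andbT scalerA.
move=> c' /negbTE cc'; rewrite /spread !mxvec_indexK /= [c == _]eq_sym cc' andbF.
by rewrite mulr0 scale0r.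
Qed.

Definition noise_moment : {scalar MP} := gaussian (fun=> sigma).

Lemma cond_moment_expand a k f : (msize f <= k.+1)%N ->
  La a f = \sum_(s < k.+1)
    (lambda ^+ 2 / 2) ^+ s / s`!%:R * noise_moment (theta s (@monochrom R _ _ a) f).
Proof.
move=> fk; rewrite (functional_expand (L0 := noise_moment) (g := spread a) (Q := Q a)
  (gaussian_ibp _) (@cond_moment_ibp R n p K sigma Delta a) _ _ _ _ _ _ fk).
- apply: eq_bigr => s _; rewrite iterQ /= linearZ /= mulrA; congr (_ * _).
    exact: mulrC.
  congr (gaussian _ _).
  by rewrite -(@theta_iter R _ _ _ (@fst_entry n p) (@snd_entry n p) s (same_label a)).
- exact: gaussian1.
- exact: cond_moment1.
- by move=> j l; rewrite cond_covE /delta mulrC.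
- exact: QX.
- move=> l h; rewrite /= /Q [RHS]linearZ /=; congr (_ *: _); rewrite /Q0 [RHS]linear_sum.
  by apply: eq_bigr => e _; rewrite linearZ /= dquad_mderiv.
- move=> k' h hk; rewrite /Q; apply: leq_trans (msizeZ_le _ _) _; apply: msize_sum => e _.
  apply: leq_trans (msizeZ_le _ _) _; apply: leq_trans (msize_dquad _ _ _ hk) _.
  by rewrite subSS leq_subr.
Qed.

End CondExpansion.

(** * The lower bound *)

Lemma sum_even_le (R : realType) (F : nat -> R) k : (forall r, 0 <= F r) ->
  \sum_(s < k./2.+1) F s.*2 <= \sum_(r < k.+1) F r.
Proof.
move=> F0; have H m : \sum_(s < m.+1) F s.*2 <= \sum_(r < m.*2.+1) F r.
  elim: m => [|m IH]; first by rewrite !big_ord_recr !big_ord0.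
  rewrite doubleS big_ord_recr [leRHS]big_ord_recr [X in _ <= X + _]big_ord_recr /=.
  by rewrite lerD2r (le_trans IH) // lerDl.
apply: le_trans (H _) _; set m := k./2.*2.
have -> : k = (odd k + m)%N by rewrite odd_double_half.
by case: (odd k) => //; rewrite add1n [leRHS]big_ord_recr lerDl.
Qed.

Section LowerBound.
Variables (R : realType) (n p K' : nat) (sigma Delta : R) (v1 v2 : 'I_n).
Hypothesis sigma_gt0 : 0 < sigma.
Local Notation MP := (mpoly (n * p) R).
Local Notation K := K'.+1.
Local Notation lambda := (Num.sqrt (p%:R^-1 * Delta ^+ 2 * sigma ^+ 2)).
Local Notation col := {ffun 'I_n -> 'I_K}.
Local Notation A := ('I_n * 'I_n)%type.
Local Notation dquads := (@dquads R _ _ _ (@fst_entry n p) (@snd_entry n p)).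
Implicit Types (a : col) (f : MP).
Local Notation La a := (@cond_moment R n p K sigma Delta a).
Local Notation w := (#|{: col}|%:R^-1 : R).
Local Notation kappa := (kappa R K' v1 v2).

Definition avg_moment f : R := \sum_a w * La a f.

Lemma avg_moment_is_linear : linear_for *%R avg_moment.
Proof.
move=> c f g; rewrite /avg_moment mulr_sumr -big_split; apply: eq_bigr => a _ /=.
by rewrite linearP /= mulrDr mulrCA.
Qed.

HB.instance Definition _ := GRing.isLinear.Build R MP R _ avg_moment avg_moment_is_linear.

Definition joint_moment f : R := \sum_(a : col) w * ((a v1 == a v2)%:R * La a f).

Lemma joint_moment_cumulant k f : (msize f <= k.+1)%N ->
  joint_moment f = \sum_(s < k./2.+1) (lambda ^+ 2 / 2) ^+ s / s`!%:R *
    \sum_(e <- words A s) kappa e * avg_moment (dquads e f).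
Proof.
apply: (@moment_cumulant R _ _ _ _ _ {ffun 'I_n -> 'I_K} (fun=> w)
  (fun a : col => (a v1 == a v2)%:R) _ (noise_moment n p sigma) avg_moment
  (fun a => La a) _ (fun a => @monochrom R _ _ a)) => //.
  by move=> a h hk; exact: cond_moment_expand.
exact: kappa_conv.
Qed.

Lemma avg_moment_sq_ge k f : (msize f <= k.+1)%N ->
  \sum_(s < k./2.+1) sigma ^+ 2 ^+ s.*2 / (s.*2)`!%:R * bessel avg_moment s.*2 f
  <= avg_moment (f * f).
Proof.
move=> fk.
apply: le_trans (sum_even_le
  (F := fun r => sigma ^+ 2 ^+ r / r`!%:R * bessel avg_moment r f) _ _) _.
  by move=> r; rewrite mulr_ge0 ?bessel_ge0 // divr_ge0 // exprn_ge0 // sqr_ge0.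
have La_ge a : \sum_(r < k.+1) sigma ^+ 2 ^+ r / r`!%:R * bessel (La a) r f <= La a (f * f).
  have covC (i j : 'I_(n * p)) : cond_cov sigma Delta a i j = cond_cov sigma Delta a j i.
    rewrite /cond_cov /delta eq_sym; congr (_ + _).
    by apply: eq_bigr => b _; rewrite mulrC.
  rewrite (ibp_mul_expand (@cond_moment_ibp R n p K sigma Delta a) (cond_moment1 _ _ _ _) covC f fk).
  apply: ler_sum => r _; rewrite mulrAC mulrC ler_wpM2l ?invr_ge0 //.
  apply: pairing_ge_bessel (sqr_ge0 _) _ => l l'; exact: erefl.
rewrite /avg_moment; apply: (@le_trans _ _ (\sum_(a : col) w *
    \sum_(r < k.+1) sigma ^+ 2 ^+ r / r`!%:R * bessel (La a) r f)); last first.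
  by apply: ler_sum => a _; rewrite ler_wpM2l ?invr_ge0.
under [leRHS]eq_bigr do rewrite mulr_sumr.
rewrite exchange_big; apply: ler_sum => r _ /=.
under eq_bigr do rewrite mulrCA; rewrite -mulr_sumr ler_wpM2l //.
  by rewrite divr_ge0 // exprn_ge0 // sqr_ge0.
rewrite -mulr_sumr.
apply: (@bessel_avg R _ col avg_moment (fun a => La a) r f) => [|g].
  by rewrite lt0n -(pnatr_eq0 R) card_col_neq0.
by rewrite /= /avg_moment -mulr_sumr.
Qed.

(** The bound on the gain at order [s.*2] left by completing the square: the squared coefficient of
    the cumulant expansion, over the weight of [bessel], times the Schur bound on the test
    polynomial; the factors [(s.*2)!] have cancelled. *)
Definition cumulant_energy s : R :=
  ((lambda ^+ 2 / 2) ^+ s / s`!%:R) ^+ 2 / sigma ^+ 2 ^+ s.*2 *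
  (\prod_(i < s) (2 * i.+1%:R * (p + i.*2)%:R)) *
  \sum_(e <- words A s) kappa e ^+ 2.

Lemma risk_ge k f : (msize f <= k.+1)%N ->
  - \sum_(s < k./2.+1) cumulant_energy s <= avg_moment (f * f) - 2 * joint_moment f.
Proof.
move=> fk; rewrite lerBrDr; apply: le_trans (avg_moment_sq_ge fk).
rewrite (joint_moment_cumulant fk) mulr_sumr -sumrN -big_split.
apply: ler_sum => s _ /=.
set c := sigma ^+ 2 ^+ s.*2; set t := (lambda ^+ 2 / 2) ^+ s / s`!%:R.
have c0 : 0 < c by rewrite !exprn_gt0.
have b0 : 0 < c / (s.*2)`!%:R by rewrite divr_gt0 // ltr0n fact_gt0.
pose q := qsum (@fst_entry n p) (@snd_entry n p) kappa s.
(* The multiplier [t / c] makes the cross term equal to twice the term of order [s] of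
   [joint_moment]. *)
have low := bessel_complete avg_moment (@ev0 R _) (t / c) s.*2 f q.
have norm := @qsum_norm_le R _ _ _ _ _ kappa s _ (@dquad_sum_quad_exp R n p).
rewrite pairing_qsum -/q in low; rewrite -/q in norm.
apply: le_trans (ler_wpM2l (ltW b0) low).
apply: (@le_trans _ _ (c / (s.*2)`!%:R * (2 * (t / c) * ((s.*2)`!%:R *
    \sum_(e <- words A s) kappa e * avg_moment (dquads e f)) -
    (t / c) ^+ 2 * ((s.*2)`!%:R * (\prod_(i < s) (2 * i.+1%:R * (p + i.*2)%:R)) *
      \sum_(e <- words A s) kappa e ^+ 2)))); last first.
  by rewrite ler_wpM2l ?(ltW b0) // lerD2l lerN2 ler_wpM2l ?sqr_ge0.
rewrite /cumulant_energy -/t -/c le_eqVlt; apply/orP; left; apply/eqP.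
have c1 : c != 0 by rewrite gt_eqF.
have s1 : (s.*2)`!%:R != 0 :> R by rewrite pnatr_eq0 -lt0n fact_gt0.
field; exact/andP.
Qed.


End LowerBound.

(** Each factor is at most [p exp(D / p)], and [s D <= D^2 <= D^5 <= p], so the product exceeds
    [p ^+ s] by a factor of at most [exp 1 <= 4]. *)
Lemma rising_product_le (R : realType) (p D s : nat) :
    (0 < p)%N -> (D ^ 5 <= p)%N -> (s.*2 <= D)%N ->
  \prod_(i < s) (p + i.*2)%:R <= 4 * p%:R ^+ s :> R.
Proof.
move=> p0 Dp sD; have pR : 0 < p%:R :> R by rewrite ltr0n.
apply: (@le_trans _ _ (\prod_(i < s) (p%:R * expR (D%:R / p%:R)))).
  apply: ler_prod => i _; rewrite ler0n /=.
  apply: (@le_trans _ _ (p%:R * (1 + D%:R / p%:R))).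
    rewrite mulrDr mulr1 mulrC divfK ?gt_eqF // natrD lerD2l ler_nat.
    by rewrite (leq_trans _ sD) // leq_double ltnW.
  by rewrite ler_wpM2l ?(ltW pR) // expR_ge1Dx.
rewrite prodr_const card_ord exprMn mulrC ler_wpM2r ?exprn_ge0 ?ler0n //.
apply: le_trans (expR1_le4 R); rewrite -expRM_natl ler_expR.
rewrite mulrA ler_pdivrMr // mul1r -natrM ler_nat.
apply: leq_trans Dp; case: D sD => [|D]; first by rewrite muln0.
move=> sD; apply: leq_trans (_ : D.+1 ^ 2 <= _)%N; last exact: leq_pexp2l.
by rewrite leq_mul2r (leq_trans _ sD) ?orbT // -addnn leq_addr.
Qed.

Section EnergyBound.
Variables (R : realType) (n p K' : nat) (sigma Delta : R) (v1 v2 : 'I_n).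
Hypotheses (v12 : v1 != v2) (sigma_gt0 : 0 < sigma) (p_gt0 : (0 < p)%N).
Local Notation K := K'.+1.
Local Notation energy := (cumulant_energy p K' sigma Delta v1 v2).

Lemma cumulant_energy0 : energy 0 = (K%:R ^+ 2)^-1.
Proof.
rewrite /cumulant_energy !expr0 big_ord0 big_words0 kappa_nil //.
by rewrite fact0 !divr1 expr1n mulr1 mul1r exprVn.
Qed.

(** The factor 4 of [rising_product_le] cancels the 1/4 of [sum_kappa_sq_le], the two factors
    [2 ^+ s * s!] cancel the denominators of the squared coefficient, and the rising product takes
    one power of [p] from [lambda^4 / sigma^4 = Delta^4 / p^2]. *)
Lemma cumulant_energy_le D s (Nb : R) :
    (D ^ 5 <= p)%N -> (0 < s)%N -> (s.*2 <= D)%N ->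
    D%:R ^+ 18 <= Nb -> n%:R / K%:R ^+ 2 <= Nb ->
  energy s <= (K%:R ^+ 2)^-1 * (Delta ^+ 4 / p%:R * Nb) ^+ s.
Proof.
move=> Dp s0 sD DN nN; have pR : 0 < p%:R :> R by rewrite ltr0n.
have K0 : K%:R != 0 :> R by rewrite pnatr_eq0.
have sg : sigma != 0 by rewrite gt_eqF.
have S0 : s`!%:R != 0 :> R by rewrite pnatr_eq0 -lt0n fact_gt0.
rewrite /cumulant_energy sqr_sqrtr; last first.
  by rewrite mulr_ge0 ?sqr_ge0 // mulr_ge0 ?sqr_ge0 // invr_ge0.
have -> : \prod_(i < s) (2 * i.+1%:R * (p + i.*2)%:R) =
    2 ^+ s * s`!%:R * \prod_(i < s) (p + i.*2)%:R :> R.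
  rewrite !big_split /= prodr_const card_ord; congr (_ * _ * _).
  by rewrite fact_prod natr_prod big_add1 big_mkord.
have Nb0 : 0 <= Nb by apply: le_trans DN; rewrite exprn_ge0.
have le1 := @rising_product_le R p D s p_gt0 Dp sD.
have le2 := @sum_kappa_sq_le R _ K' v1 v2 v12 D%:R Nb s s0 _ DN _.
rewrite ler_nat card_ord in le2; have {}le2 := le2 sD nN.
set c := _ ^+ 2 / sigma ^+ 2 ^+ s.*2; have c0 : 0 <= c.
  by rewrite divr_ge0 ?sqr_ge0 // !exprn_ge0 // ltW.
apply: (@le_trans _ _ (c * (2 ^+ s * s`!%:R * (4 * p%:R ^+ s)) *
    (2 ^+ s * s`!%:R * (Nb ^+ s / (4 * K%:R ^+ 2))))).
  apply: ler_pM => //.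
  - by rewrite mulr_ge0 // mulr_ge0 ?prodr_ge0 // mulr_ge0 ?exprn_ge0.
  - by apply: sumr_ge0 => e _; exact: sqr_ge0.
  - by rewrite ler_wpM2l // ler_wpM2l // mulr_ge0 ?exprn_ge0.
rewrite le_eqVlt; apply/orP; left; apply/eqP.
have pR0 : p%:R != 0 :> R by rewrite gt_eqF.
have cE : c = (Delta ^+ 4 / (p%:R ^+ 2 * 4)) ^+ s / s`!%:R ^+ 2.
  rewrite /c; have -> : sigma ^+ 2 ^+ s.*2 = (sigma ^+ 4) ^+ s.
    by rewrite -!exprM -mul2n mulnA.
  have X2 (X : R) : (X ^+ s / s`!%:R) ^+ 2 = (X ^+ 2) ^+ s / s`!%:R ^+ 2.
    by rewrite expr_div_n -!exprM mulnC.
  rewrite X2 mulrAC -expr_div_n; congr (_ ^+ s / _); field; exact/andP.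
rewrite cE; have -> : (Delta ^+ 4 / p%:R * Nb) ^+ s =
    (Delta ^+ 4 / (p%:R ^+ 2 * 4)) ^+ s * 2 ^+ s * 2 ^+ s * p%:R ^+ s * Nb ^+ s.
  by rewrite -!exprMn; congr (_ ^+ s); field.
by field; exact/andP.
Qed.


End EnergyBound.

(** The sum is at most [z / (1 - z)], and [(1 - sqrt z)^3 <= 1 - sqrt z <= 1 - z] since
    [z <= sqrt z]. *)
Lemma geometric_correction_le (R : realType) (z : R) m : 0 <= z -> z < 1 ->
  1 + \sum_(s < m) z ^+ s.+1 <= 1 + z / (1 - Num.sqrt z) ^+ 3.
Proof.
move=> z0 z1; rewrite lerD2l.
have q0 : 0 <= Num.sqrt z := sqrtr_ge0 z.
have q1 : Num.sqrt z < 1 by rewrite -sqrtr1 ltr_sqrt.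
have qz : z = Num.sqrt z ^+ 2 by rewrite sqr_sqrtr.
have zq : z <= Num.sqrt z by rewrite [leLHS]qz expr2 ler_piMr // ltW.
have y0 : 0 < 1 - Num.sqrt z by rewrite subr_gt0.
have z10 : 0 < 1 - z by rewrite subr_gt0.
apply: (@le_trans _ _ (z / (1 - z))).
  rewrite ler_pdivlMr //; under eq_bigr do rewrite exprS.
  rewrite -mulr_sumr -mulrA ler_piMr // mulrC.
  rewrite -[1 - z]opprB mulNr -subrX1 opprB.
  by rewrite lerBlDr lerDl exprn_ge0.
rewrite ler_wpM2l // lef_pV2 ?posrE ?exprn_gt0 //.
apply: (@le_trans _ _ (1 - Num.sqrt z)); last by rewrite lerB.
by rewrite exprS ler_piMr ?(ltW y0) // exprn_ile1 ?(ltW y0) // lerBlDr lerDl.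
Qed.

Theorem theorem3p1 (R : realType) (d : measure_display) (T : measurableType d)
    (P : probability T R) (n p K : nat) (sigma Delta : R)
    (kstar : T -> {ffun 'I_n -> 'I_K})
    (mu : 'I_K -> 'I_p -> {RV P >-> R})
    (E : 'I_n -> 'I_p -> {RV P >-> R})
    (D : nat)
    (n_ge2 : (2 <= n)%N) (p_ge1 : (1 <= p)%N) (K_ge1 : (1 <= K)%N)
    (sigma_gt0 : 0 < sigma) (Delta_gt0 : 0 < Delta)
    (prior : gaussian_mixture_prior sigma Delta kstar mu E)
    (D_small : (D ^ 5 <= p)%N) :
  let zeta : R :=
    Delta ^+ 4 / p%:R * Num.max (D%:R ^+ 18) (n%:R / K%:R ^+ 2) in
  let i1 : 'I_n := Ordinal (ltnW n_ge2) in
  let i2 : 'I_n := Ordinal n_ge2 in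
  let x : T -> R := fun w => (kstar w i1 == kstar w i2)%:R in
  zeta < 1 ->
  ((K%:R^-1 - (K%:R ^+ 2)^-1 * (1 + zeta / (1 - Num.sqrt zeta) ^+ 3))%:E
    <= MMSE_le P D (observation kstar mu E) x)%E.
Proof.
move=> zeta i1 i2 x zeta1.
(* Writing [K] as a successor gives the colours the cyclic group structure used by
   [card_independent]. *)
case: K K_ge1 kstar mu prior @x @zeta zeta1 => [//|K'] _ ks m pr x zeta zeta1.
have p0 : (0 < p)%N := p_ge1.
have pR : 0 < p%:R :> R by rewrite ltr0n.
set Nb := Num.max _ _ in zeta zeta1 *.
have Nb0 : 0 <= Nb by rewrite /Nb le_max exprn_ge0.
have zeta0 : 0 <= zeta by rewrite /zeta mulr_ge0 // divr_ge0 ?exprn_ge0 ?ltW.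
have lambda_gt0 : 0 < Num.sqrt (p%:R^-1 * Delta ^+ 2 * sigma ^+ 2).
  by rewrite sqrtr_gt0 !mulr_gt0 ?invr_gt0 ?exprn_gt0.
apply: le_ereal_inf_tmp => _ [f /= fD <-].
pose y (a : {ffun 'I_n -> 'I_K'.+1}) : R := (a i1 == a i2)%:R.
have yy a : y a ^+ 2 = y a by rewrite /y; case: eqP => _; rewrite ?expr1n ?expr0n.
rewrite (risk_eq pr sigma_gt0 lambda_gt0 f yy) lee_fin.
have i12 : i1 != i2 by [].
have risk := @risk_ge R n p K' sigma Delta i1 i2 sigma_gt0 D f fD.
have -> : (K'.+1%:R ^+ n)^-1 * \sum_a (cond_moment sigma Delta a (f * f) -
      2 * (y a * cond_moment sigma Delta a f) + y a) =
    avg_moment K' sigma Delta (f * f) - 2 * joint_moment K' sigma Delta i1 i2 f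
    + K'.+1%:R^-1.
  have wE : (K'.+1%:R ^+ n)^-1 = #|{: {ffun 'I_n -> 'I_K'.+1}}|%:R^-1 :> R.
    by rewrite card_ffun !card_ord natrX.
  rewrite big_split sumrB !mulrDr /= mulrN; congr (_ - _ + _).
  - by rewrite wE /avg_moment mulr_sumr.
  - by rewrite wE -mulr_sumr mulrCA /joint_moment mulr_sumr.
  - rewrite -(mono_joint_nil R K' i12) wE mulr_sumr; apply: eq_bigr => a _.
    by rewrite /monochrom big_nil mulr1.
apply: le_trans (lerD risk (lexx _)).
rewrite addrC lerD2r lerN2 big_ord_recl cumulant_energy0 //.
(* Order 0 contributes exactly [K^-2], the gain of the best constant predictor; the higher orders
   are dominated by a geometric series in [zeta]. *)
apply: le_trans (_ : (K'.+1%:R ^+ 2)^-1 * (1 + \sum_(s < D./2) zeta ^+ s.+1) <= _).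
  rewrite mulrDr mulr1 lerD2l mulr_sumr; apply: ler_sum => s _.
  rewrite lift0 /zeta.
  apply: (@cumulant_energy_le R n p K' sigma Delta i1 i2 i12 sigma_gt0 p0 D s.+1 Nb
    D_small) => //.
  - by rewrite -[leqRHS]odd_double_half (leq_trans _ (leq_addl _ _)) // leq_double.
  - by rewrite /Nb le_max lexx.
  - by rewrite /Nb le_max lexx orbT.
by rewrite ler_wpM2l ?invr_ge0 ?exprn_ge0 // geometric_correction_le.
Qed.
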